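(* Let $0\le\alpha<1$. Then for every $f\in\mathcal{K}(\alpha)$ the subordination $$\frac{f(z)}{z}\prec\frac{k_\alpha(z)}{z}\quad\text{on }\mathbb{D}$$ holds.
   Context: $\mathbb{D}=\{z\in\mathbb{C}:|z|<1\}$. For $0\le\alpha<1$, $\mathcal{K}(\alpha)$ (convex functions of order $\alpha$) is the set of analytic functions $f$ on $\mathbb{D}$ with $f(0)=0$, $f'(0)=1$ and $\operatorname{Re}\left(1+\frac{zf''(z)}{f'(z)}\right)>\alpha$ for all $z\in\mathbb{D}$. The function $k_\alpha$ is given on $\mathbb{D}$ by $k_\alpha(z)=(1-2\alpha)^{-1}\left[(1-z)^{2\alpha-1}-1\right]$ if $\alpha\neq 1/2$ and $k_{1/2}(z)=-\log(1-z)$ (principal branches). Functions of the form $f(z)/z$ with $f(0)=0$, $f'(0)=1$ are extended analytically to $z=0$ by the value $1$. For analytic functions $F,G$ on $\mathbb{D}$, $F\prec G$ ($F$ is subordinate to $G$) means that there is an analytic function $\omega$ on $\mathbb{D}$ with $\omega(0)=0$, $|\omega(z)|<1$ and $F(z)=G(\omega(z))$ for all $z\in\mathbb{D}$. *)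

(* Defs.v *)
From Stdlib Require Import Reals.
From Coquelicot Require Import Coquelicot.

Open Scope R_scope.

Definition disk (z : C) : Prop := Cmod z < 1.

(* Functions on the disk are represented by total functions [C -> C]; only
   their values on the (open) disk matter. *)
Definition analytic_on_disk (f : C -> C) : Prop :=
  forall z : C, disk z -> ex_derive (K := C_AbsRing) (V := C_NormedModule) f z.

Definition Cexp (z : C) : C := (exp (Re z) * cos (Im z), exp (Re z) * sin (Im z)).

(* Principal argument, in (-PI, PI]; the value at 0 is irrelevant. *)
Definition Carg (z : C) : R :=
  if Rle_dec 0 (Im z) then acos (Re z / Cmod z) else - acos (Re z / Cmod z).

Definition Clog (z : C) : C := (ln (Cmod z), Carg z).

Definition Cpower (z w : C) : C := Cexp (w * Clog z)%C.

(* [C_derive] is only meaningful where the derivative exists: for [f] analytic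
   on the disk, both [C_derive f] and [C_derive (C_derive f)] are, throughout
   the disk.  As division on [C] is total, the requirement that the quotient
   z f''(z) / f'(z) be defined is spelled out as [C_derive f z <> 0]. *)
Definition convex_of_order (alpha : R) (f : C -> C) : Prop :=
  analytic_on_disk f /\
  f (RtoC 0) = RtoC 0 /\
  C_derive f (RtoC 0) = RtoC 1 /\
  forall z : C, disk z ->
    C_derive f z <> RtoC 0 /\
    Re (1 + z * C_derive (C_derive f) z / C_derive f z)%C > alpha.

Definition k_fun (alpha : R) (z : C) : C :=
  if Req_EM_T alpha (1 / 2) then (- Clog (1 - z))%C
  else (/ (1 - 2 * alpha) * (Cpower (1 - z) (2 * alpha - 1)%R - 1))%C.

(* f(z)/z, with the value 1 at z = 0: its analytic extension when f(0) = 0 and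
   f'(0) = 1. *)
Definition div_by_z (f : C -> C) (z : C) : C :=
  if Ceq_dec z (RtoC 0) then RtoC 1 else (f z / z)%C.

Definition subordinate (F G : C -> C) : Prop :=
  exists omega : C -> C,
    analytic_on_disk omega /\
    omega (RtoC 0) = RtoC 0 /\
    (forall z : C, disk z -> Cmod (omega z) < 1) /\
    (forall z : C, disk z -> F z = G (omega z)).

(* Main.v *)
Require Import Defs.
From Stdlib Require Import Reals.
From Coquelicot Require Import Coquelicot.
From Stdlib Require Import Lra Lia Psatz ClassicalEpsilon.

(* Put b = 2 (1 - alpha).  Jack's lemma applied to w in (f')^(1/b) = 1 / (1 - w) turns the convexity
   condition into f'(z) = F(z)^b with Re F > 1/2.  In the variable u = 1 / (1 - z) the function
   k_alpha(z) / z becomes G(u) = u (u^(b-1) - 1) / ((b-1) (u - 1)), and G(u) + u (u - 1) G'(u) = u^b.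
   G is injective on Re u > 0, because in the variable log u its derivative has positive real part.
   So U = G^(-1)(f(z)/z) is defined near 0, and Re U > 1/2 has to be propagated to the whole disk.
   At a first boundary point z where Re U(z) = 1/2, Jack's lemma gives z U'(z) = q U (U - 1) with
   q >= 1; as f' = P + z P' for P = f(z)/z, and u (u - 1) = - |u|^2 when Re u = 1/2, this reads
   F^b = U^b - (q - 1) |U|^2 G'(U), which is excluded by the geometry of the set of values u^b
   with Re u > 1/2. *)

Open Scope R_scope.

(** Analyticity asks for one complex derivative only, whereas the convexity condition speaks of f'';
    this is why Goursat's lemma and Cauchy's formula come first. The equation for G is the identity
    (z * (k_alpha(z) / z))' = k_alpha'(z) = u^b, since z d/dz = u (u - 1) d/du when z = 1 - 1/u; so
    F = u is the extremal case. Two points make the first boundary point usable. Injectivity of G on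
    the larger half-plane Re u > 0 keeps U differentiable where Re U = 1/2, so that Jack's lemma
    applies there. And U must take a finite value at that point: a priori it could run to infinity
    along the radius while f(z)/z stays bounded, a real danger for alpha > 1/2, when G has the
    finite limit 1 / (2 alpha - 1) at infinity. Schwarz's lemma bounds |U| by the inverse relative
    distance to the circle, and this rate, set against the differentiability of f(z)/z, excludes the
    escape. *)

Notation CInt := (RInt (V := C_R_CompleteNormedModule)).
Notation Cpath_derive := (is_derive (K := R_AbsRing) (V := C_R_NormedModule)).

(* Goals about [continuous] and [RInt] see [C] through its structures, which hides it from [ring]. *)
Ltac as_Ceq :=
  repeat match goal with
  | w : UniformSpace.sort _ |- _ => change C in (type of w)
  end;
  match goal with |- @eq _ ?a ?b => change (@eq C a b) end.

(** * Continuity and complex derivatives *)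

Lemma locally_disk (z : C) (P : C -> Prop) :
  locally z P <-> exists d, 0 < d /\ forall w, Cmod (w - z) < d -> P w.
Proof.
split.
- intros [d Hd]. exists d. split; [apply cond_pos|]. intros w Hw.
  apply Hd. apply C_NormedModule_mixin_compat1. exact Hw.
- intros [d [Hd H]].
  (* Balls of the uniform structure on [C] are squares, not disks; [sqrt 2] is the price of passing
     from one to the other. *)
  assert (Hs : 0 < sqrt 2) by (apply sqrt_lt_R0; lra).
  assert (Hp : 0 < d / sqrt 2) by (apply Rdiv_lt_0_compat; assumption).
  exists (mkposreal _ Hp). intros w Hw. apply H.
  apply C_NormedModule_mixin_compat2 in Hw. simpl in Hw.
  replace (sqrt 2 * (d / sqrt 2)) with d in Hw by (field; lra). exact Hw.
Qed.

Lemma locally_Rabs (x : R) (P : R -> Prop) :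
  locally x P <-> exists d, 0 < d /\ forall y, Rabs (y - x) < d -> P y.
Proof.
split.
- intros [d Hd]. exists d. split; [apply cond_pos|]. intros w Hw. apply Hd, Hw.
- intros [d [Hd H]]. exists (mkposreal _ Hd). intros y Hy. apply H, Hy.
Qed.

Section Cont.
Context {T : UniformSpace}.
Implicit Types f g : T -> C.

Lemma continuous_Cmod_iff f x :
  continuous f x <-> forall eps, 0 < eps -> locally x (fun y => Cmod (f y - f x) < eps).
Proof.
split.
- intros H eps Heps.
  apply (H (fun y => Cmod (y - f x) < eps)).
  apply locally_disk. exists eps. auto.
- intros H P HP. apply locally_disk in HP. destruct HP as [d [Hd HP]].
  unfold filtermap. generalize (H d Hd). apply filter_imp. intros y Hy. apply HP, Hy.
Qed.

Lemma continuous_Re f x : continuous f x -> continuous (fun t => Re (f t)) x.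
Proof. intros H. apply (continuous_comp f fst); [exact H|apply continuous_fst]. Qed.

Lemma continuous_Im f x : continuous f x -> continuous (fun t => Im (f t)) x.
Proof. intros H. apply (continuous_comp f snd); [exact H|apply continuous_snd]. Qed.

Lemma continuous_C_pair (u v : T -> R) x :
  continuous u x -> continuous v x -> continuous (fun t => (u t, v t) : C) x.
Proof.
intros Hu Hv P [d HP].
specialize (Hu (ball (u x) d) (locally_ball _ _)).
specialize (Hv (ball (v x) d) (locally_ball _ _)).
unfold filtermap in *. generalize (filter_and _ _ Hu Hv). apply filter_imp.
intros y [H1 H2]. apply HP. split; assumption.
Qed.

Lemma continuous_Cplus f g x :
  continuous f x -> continuous g x -> continuous (fun t => (f t + g t)%C) x.
Proof. intros Hf Hg. apply (continuous_plus (V := C_R_NormedModule) f g x Hf Hg). Qed.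

Lemma continuous_Copp f x : continuous f x -> continuous (fun t => (- f t)%C) x.
Proof. intros Hf. apply (continuous_opp (V := C_R_NormedModule) f x Hf). Qed.

Lemma continuous_Cminus f g x :
  continuous f x -> continuous g x -> continuous (fun t => (f t - g t)%C) x.
Proof. intros Hf Hg. apply continuous_Cplus; [|apply continuous_Copp]; assumption. Qed.

Lemma continuous_Cmult f g x :
  continuous f x -> continuous g x -> continuous (fun t => (f t * g t)%C) x.
Proof.
intros Hf Hg.
assert (H1 := continuous_Re _ _ Hf). assert (H2 := continuous_Im _ _ Hf).
assert (H3 := continuous_Re _ _ Hg). assert (H4 := continuous_Im _ _ Hg).
apply continuous_C_pair.
- apply (continuous_minus (V := R_NormedModule));
    apply (continuous_mult (K := R_AbsRing)); assumption.
- apply (continuous_plus (V := R_NormedModule));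
    apply (continuous_mult (K := R_AbsRing)); assumption.
Qed.

Lemma continuous_RtoC (u : T -> R) x :
  continuous u x -> continuous (fun t => RtoC (u t)) x.
Proof. intros H. apply continuous_C_pair; [exact H|apply continuous_const]. Qed.

Lemma continuous_Cmod f x : continuous f x -> continuous (fun t => Cmod (f t)) x.
Proof.
intros H P [d HP]. rewrite continuous_Cmod_iff in H.
unfold filtermap. generalize (H d (cond_pos d)). apply filter_imp. intros y Hy. apply HP.
change (Rabs (Cmod (f y) - Cmod (f x)) < d).
assert (A1 := Cmod_triangle (f y - f x) (f x)).
assert (A2 := Cmod_triangle (f x - f y) (f y)).
replace (f y - f x + f x)%C with (f y) in A1 by ring.
replace (f x - f y + f y)%C with (f x) in A2 by ring.
replace (f x - f y)%C with (- (f y - f x))%C in A2 by ring. rewrite Cmod_opp in A2.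
apply Rabs_def1; lra.
Qed.

Lemma continuous_Cinv f x :
  f x <> 0 -> continuous f x -> continuous (fun t => (/ f t)%C) x.
Proof.
intros H0 Hf. unfold Cinv.
assert (H1 := continuous_Re _ _ Hf). assert (H2 := continuous_Im _ _ Hf).
assert (Hn : fst (f x) ^ 2 + snd (f x) ^ 2 <> 0).
{ intros E. apply H0. apply Cmod_eq_0. unfold Cmod. rewrite E. apply sqrt_0. }
assert (Hd : continuous (fun t => / (fst (f t) ^ 2 + snd (f t) ^ 2)) x).
{ apply continuous_comp with (f := fun t => fst (f t) ^ 2 + snd (f t) ^ 2) (g := Rinv).
  - simpl. apply (continuous_plus (V := R_NormedModule));
      repeat apply (continuous_mult (K := R_AbsRing)); try assumption; apply continuous_const.
  - apply continuity_pt_filterlim, continuity_pt_inv; [apply continuity_pt_id|exact Hn]. }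
apply continuous_C_pair; unfold Rdiv; apply (continuous_mult (K := R_AbsRing)); try assumption.
apply (continuous_opp (V := R_NormedModule)). assumption.
Qed.

Lemma continuous_Cdiv f g x :
  g x <> 0 -> continuous f x -> continuous g x -> continuous (fun t => (f t / g t)%C) x.
Proof. intros H0 Hf Hg. apply continuous_Cmult; [|apply continuous_Cinv]; assumption. Qed.

End Cont.

Implicit Types f g : C -> C.

(** Caratheodory's form of the derivative: the difference quotient, completed by [l] at [z], is
    continuous there. The product, inverse and chain rules become algebra with the factor provided
    by [Cderiv_factor]. *)
Definition Cderiv (f : C -> C) (z l : C) : Prop :=
  continuous (fun w => if Ceq_dec w z then l else ((f w - f z) / (w - z))%C) z.

Lemma Cderiv_eq f z l m : Cderiv f z l -> l = m -> Cderiv f z m.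
Proof. intros H <-. exact H. Qed.

Lemma Cderiv_factor f z l :
  Cderiv f z l -> exists phi : C -> C,
    continuous phi z /\ phi z = l /\ forall w, f w = (f z + phi w * (w - z))%C.
Proof.
intros H. eexists. split; [exact H|]. split; cbv beta.
- destruct (Ceq_dec z z); congruence.
- intros w. destruct (Ceq_dec w z) as [->|n]; [ring|].
  field. intros E. apply n. apply Ceq_minus, E.
Qed.

Lemma factor_Cderiv f z l (phi : C -> C) :
  continuous phi z -> phi z = l ->
  locally z (fun w => f w = (f z + phi w * (w - z))%C) -> Cderiv f z l.
Proof.
intros Hc Hl HL. apply continuous_ext_loc with (2 := Hc).
generalize HL. apply filter_imp. intros w Hw.
destruct (Ceq_dec w z) as [->|n]; [congruence|].
rewrite Hw. as_Ceq. field. intros E. apply n. apply Ceq_minus, E.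
Qed.

Lemma Cderiv_eps f z l :
  Cderiv f z l <-> forall eps, 0 < eps -> exists d, 0 < d /\
    forall w, Cmod (w - z) < d -> Cmod (f w - f z - l * (w - z)) <= eps * Cmod (w - z).
Proof.
split.
- intros H eps Heps. destruct (Cderiv_factor _ _ _ H) as [phi [Hc [Hl Hf]]].
  rewrite continuous_Cmod_iff in Hc. destruct (proj1 (locally_disk _ _) (Hc eps Heps)) as [d [Hd HH]].
  exists d. split; [exact Hd|]. intros w Hw. rewrite (Hf w).
  replace (f z + phi w * (w - z) - f z - l * (w - z))%C with ((phi w - phi z) * (w - z))%C
    by (rewrite Hl; ring).
  rewrite Cmod_mult. apply Rmult_le_compat_r; [apply Cmod_ge_0|].
  left. apply HH, Hw.
- intros H. apply continuous_Cmod_iff. intros eps Heps.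
  destruct (H (eps / 2)) as [d [Hd HH]]; [lra|].
  apply locally_disk. exists d. split; [exact Hd|]. intros w Hw.
  destruct (Ceq_dec z z) as [_|n]; [|congruence].
  destruct (Ceq_dec w z) as [->|n].
  + replace (l - l)%C with (RtoC 0) by ring. rewrite Cmod_0. exact Heps.
  + assert (Hn : (w - z)%C <> 0) by (intros E; apply n, Ceq_minus, E).
    replace ((f w - f z) / (w - z) - l)%C with ((f w - f z - l * (w - z)) / (w - z))%C by (field; exact Hn).
    rewrite Cmod_div by exact Hn.
    assert (Hp := proj1 (Cmod_gt_0 _) Hn).
    apply Rle_lt_trans with (eps / 2); [|lra].
    apply Rmult_le_reg_r with (Cmod (w - z)); [exact Hp|].
    unfold Rdiv at 1. rewrite Rmult_assoc, Rinv_l, Rmult_1_r by lra. apply HH, Hw.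
Qed.

Lemma Cderiv_continuous f z l : Cderiv f z l -> continuous f z.
Proof.
intros H. destruct (Cderiv_factor _ _ _ H) as [phi [Hc [Hl Hf]]].
apply continuous_ext with (f := fun w => (f z + phi w * (w - z))%C); [intros w; symmetry; apply Hf|].
apply continuous_Cplus; [apply continuous_const|]. apply continuous_Cmult; [exact Hc|].
apply continuous_Cminus; [apply continuous_id|apply continuous_const].
Qed.

Lemma is_derive_Cderiv f z l :
  is_derive (K := C_AbsRing) (V := C_NormedModule) f z l <-> Cderiv f z l.
Proof.
rewrite Cderiv_eps. split.
- intros [_ H] eps Heps.
  specialize (H z (fun P H => H) (mkposreal _ Heps)).
  (* The derivative over [C_AbsRing] uses the neighbourhoods given by the modulus; [locally_C]
     identifies them with those of the product structure. *)
  apply locally_C in H. apply locally_disk in H. destruct H as [d [Hd H]].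
  exists d. split; [exact Hd|]. intros w Hw. specialize (H w Hw). simpl in H.
  replace (l * (w - z))%C with ((w - z) * l)%C by ring. exact H.
- intros H. split; [apply is_linear_scal_l|].
  intros x Hx eps.
  assert (E : z = x).
  { apply (is_filter_lim_locally_unique (K := C_AbsRing) (V := AbsRing_NormedModule C_AbsRing)). exact Hx. }
  subst x. apply locally_C, locally_disk.
  destruct (H eps (cond_pos eps)) as [d [Hd HH]]. exists d. split; [exact Hd|].
  intros w Hw. specialize (HH w Hw).
  replace (l * (w - z))%C with ((w - z) * l)%C in HH by ring. exact HH.
Qed.

Lemma C_derive_eq f z l : Cderiv f z l -> C_derive f z = l.
Proof. intros H. apply is_C_derive_unique, is_derive_Cderiv, H. Qed.

Lemma Cderiv_unique f z l l' : Cderiv f z l -> Cderiv f z l' -> l = l'.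
Proof. intros H H'. rewrite <- (C_derive_eq _ _ _ H). apply C_derive_eq, H'. Qed.

Lemma Cderiv_ext_loc f g z l :
  locally z (fun w => f w = g w) -> Cderiv f z l -> Cderiv g z l.
Proof.
intros He H. destruct (Cderiv_factor _ _ _ H) as [phi [Hc [Hl Hf]]].
apply factor_Cderiv with phi; trivial.
generalize He. apply filter_imp. intros w Hw. rewrite <- Hw, <- (locally_singleton _ _ He). apply Hf.
Qed.

Lemma Cderiv_ext f g z l : (forall w, f w = g w) -> Cderiv f z l -> Cderiv g z l.
Proof. intros H. apply Cderiv_ext_loc, filter_forall, H. Qed.

Lemma Cderiv_const (k z : C) : Cderiv (fun _ => k) z 0.
Proof.
apply factor_Cderiv with (fun _ => RtoC 0); [apply continuous_const|reflexivity|].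
apply filter_forall. intros w. as_Ceq; ring.
Qed.

Lemma Cderiv_id (z : C) : Cderiv (fun w => w) z 1.
Proof.
apply factor_Cderiv with (fun _ => RtoC 1); [apply continuous_const|reflexivity|].
apply filter_forall. intros w. as_Ceq; ring.
Qed.

Lemma Cderiv_plus f g z l m :
  Cderiv f z l -> Cderiv g z m -> Cderiv (fun w => (f w + g w)%C) z (l + m).
Proof.
intros H1 H2. destruct (Cderiv_factor _ _ _ H1) as [p [Hp [Hl Hf]]].
destruct (Cderiv_factor _ _ _ H2) as [q [Hq [Hm Hg]]].
apply factor_Cderiv with (fun w => (p w + q w)%C).
- apply continuous_Cplus; assumption.
- congruence.
- apply filter_forall. intros w. rewrite (Hf w), (Hg w). as_Ceq; ring.
Qed.

Lemma Cderiv_mult f g z l m :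
  Cderiv f z l -> Cderiv g z m -> Cderiv (fun w => (f w * g w)%C) z (l * g z + f z * m).
Proof.
intros H1 H2. assert (Hgc := Cderiv_continuous _ _ _ H2).
destruct (Cderiv_factor _ _ _ H1) as [p [Hp [Hl Hf]]].
destruct (Cderiv_factor _ _ _ H2) as [q [Hq [Hm Hg]]].
apply factor_Cderiv with (fun w => (p w * g w + f z * q w)%C).
- apply continuous_Cplus; apply continuous_Cmult; trivial. apply continuous_const.
- congruence.
- apply filter_forall. intros w. rewrite (Hf w), (Hg w). as_Ceq; ring.
Qed.

Lemma Cderiv_scal k f z l : Cderiv f z l -> Cderiv (fun w => (k * f w)%C) z (k * l).
Proof.
intros H. replace (k * l)%C with (0 * f z + k * l)%C by ring.
apply (Cderiv_mult (fun _ => k)); [apply Cderiv_const|exact H].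
Qed.

Lemma Cderiv_opp f z l : Cderiv f z l -> Cderiv (fun w => (- f w)%C) z (- l).
Proof.
intros H. apply Cderiv_ext with (fun w => (-(1) * f w)%C); [intros; ring|].
replace (- l)%C with (-(1) * l)%C by ring. apply Cderiv_scal, H.
Qed.

Lemma Cderiv_minus f g z l m :
  Cderiv f z l -> Cderiv g z m -> Cderiv (fun w => (f w - g w)%C) z (l - m).
Proof. intros H1 H2. apply Cderiv_plus; [|apply Cderiv_opp]; assumption. Qed.

Lemma Cderiv_inv (f : C -> C) z l :
  f z <> 0 -> Cderiv f z l -> Cderiv (fun w => (/ f w)%C) z (- l / (f z * f z)).
Proof.
intros H0 H. assert (Hc := Cderiv_continuous _ _ _ H).
destruct (Cderiv_factor _ _ _ H) as [p [Hp [Hl Hf]]].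
apply factor_Cderiv with (fun w => (- p w / (f z * f w))%C).
- apply continuous_Cdiv; [apply Cmult_neq_0; exact H0| |].
  + apply continuous_Copp, Hp.
  + apply continuous_Cmult; [apply continuous_const|exact Hc].
- congruence.
- assert (Hn : locally z (fun w => f w <> 0)).
  { rewrite continuous_Cmod_iff in Hc.
    generalize (Hc (Cmod (f z)) (proj1 (Cmod_gt_0 _) H0)). apply filter_imp.
    intros w Hw E. rewrite E in Hw.
    replace (0 - f z)%C with (- f z)%C in Hw by ring. rewrite Cmod_opp in Hw. lra. }
  generalize Hn. apply filter_imp. intros w Hw.
  assert (E : (f w - f z = p w * (w - z))%C) by (rewrite (Hf w) at 1; ring).
  replace (- p w / (f z * f w) * (w - z))%C with (- (p w * (w - z)) / (f z * f w))%C by (field; auto).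
  rewrite <- E. field. auto.
Qed.

Lemma Cderiv_comp f g z l m :
  Cderiv f (g z) l -> Cderiv g z m -> Cderiv (fun w => f (g w)) z (l * m).
Proof.
intros H1 H2. assert (Hgc := Cderiv_continuous _ _ _ H2).
destruct (Cderiv_factor _ _ _ H1) as [p [Hp [Hl Hf]]].
destruct (Cderiv_factor _ _ _ H2) as [q [Hq [Hm Hg]]].
apply factor_Cderiv with (fun w => (p (g w) * q w)%C).
- apply continuous_Cmult; [|exact Hq]. apply (continuous_comp g p); assumption.
- congruence.
- apply filter_forall. intros w. rewrite (Hf (g w)). rewrite (Hg w) at 2. as_Ceq; ring.
Qed.

(** * Derivatives of complex-valued curves *)

Lemma path_factor (g : R -> C) t l :
  Cpath_derive g t l <-> exists psi : R -> C,
    continuous psi t /\ psi t = l /\ forall s, g s = (g t + psi s * RtoC (s - t))%C.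
Proof.
split.
- intros [_ H]. exists (fun s => if Req_EM_T s t then l else ((g s - g t) / RtoC (s - t))%C).
  split; [|split].
  + apply continuous_Cmod_iff. intros eps Heps.
    assert (He : 0 < eps / 2) by lra.
    specialize (H t (fun P H => H) (mkposreal _ He)).
    generalize H. apply filter_imp. intros s Hs. simpl in Hs.
    destruct (Req_EM_T t t) as [_|]; [|congruence].
    destruct (Req_EM_T s t) as [->|n].
    * replace (l - l)%C with (RtoC 0) by ring. rewrite Cmod_0. exact Heps.
    * assert (Hn : RtoC (s - t) <> 0) by (intros E; apply RtoC_inj in E; lra).
      replace ((g s - g t) / RtoC (s - t) - l)%C with ((g s - g t - RtoC (s - t) * l) / RtoC (s - t))%C
        by (field; exact Hn).
      rewrite Cmod_div by exact Hn. rewrite Cmod_R.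
      assert (Hp : 0 < Rabs (s - t)) by (apply Rabs_pos_lt; lra).
      apply Rle_lt_trans with (eps / 2); [|lra].
      apply Rmult_le_reg_r with (Rabs (s - t)); [exact Hp|].
      unfold Rdiv at 1. rewrite Rmult_assoc, Rinv_l, Rmult_1_r by lra.
      rewrite <- Cmod_norm in Hs.
      change (Cmod (g s - g t - @scal R_Ring C_R_ModuleSpace (s - t)%R l)%C <= eps / 2 * Rabs (s - t)) in Hs.
      rewrite scal_R_Cmult in Hs. exact Hs.
  + destruct (Req_EM_T t t); congruence.
  + intros s. destruct (Req_EM_T s t) as [->|n]; [rewrite Rminus_diag; ring|].
    field. intros E; apply RtoC_inj in E; lra.
- intros [psi [Hc [Hl Hg]]]. split; [apply is_linear_scal_l|].
  intros x Hx eps.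
  assert (E : t = x) by (apply (is_filter_lim_locally_unique (K := R_AbsRing) (V := R_NormedModule)); exact Hx).
  subst x. rewrite continuous_Cmod_iff in Hc. generalize (Hc eps (cond_pos eps)).
  apply filter_imp. intros s Hs.
  rewrite <- Cmod_norm.
change (Cmod (g s - g t - @scal R_Ring C_R_ModuleSpace (s - t)%R l)%C <= eps * Rabs (s - t)).
  rewrite scal_R_Cmult, (Hg s).
  replace (g t + psi s * RtoC (s - t) - g t - RtoC (s - t) * l)%C
    with ((psi s - psi t) * RtoC (s - t))%C by (rewrite Hl; ring).
  rewrite Cmod_mult, Cmod_R. apply Rmult_le_compat_r; [apply Rabs_pos|lra].
Qed.

Lemma path_comp f (g : R -> C) t l m :
  Cderiv f (g t) l -> Cpath_derive g t m -> Cpath_derive (fun s => f (g s)) t (l * m)%C.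
Proof.
intros H1 H2. assert (Hgc : continuous g t).
{ apply (ex_derive_continuous (K := R_AbsRing) (V := C_R_NormedModule)). exists m. exact H2. }
destruct (Cderiv_factor _ _ _ H1) as [p [Hp [Hl Hf]]].
apply path_factor in H2. destruct H2 as [q [Hq [Hm Hg]]].
apply path_factor. exists (fun s => (p (g s) * q s)%C). split; [|split].
- apply continuous_Cmult; [|exact Hq]. apply (continuous_comp g p); assumption.
- congruence.
- intros s. rewrite (Hf (g s)). rewrite (Hg s) at 2. ring.
Qed.

Lemma path_segment (p d : C) (t : R) : Cpath_derive (fun s => (p + RtoC s * d)%C) t d.
Proof.
apply path_factor. exists (fun _ => d). split; [apply continuous_const|]. split; [reflexivity|].
intros s. rewrite RtoC_minus. ring.
Qed.

Lemma path_Re (g : R -> C) t l : Cpath_derive g t l -> is_derive (fun s => Re (g s)) t (Re l).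
Proof.
intros H. apply path_factor in H. destruct H as [q [Hq [Hm Hg]]].
split; [apply is_linear_scal_l|].
intros x Hx eps.
assert (E : t = x) by (apply (is_filter_lim_locally_unique (K := R_AbsRing) (V := R_NormedModule)); exact Hx).
subst x. rewrite continuous_Cmod_iff in Hq. generalize (Hq eps (cond_pos eps)).
apply filter_imp. intros s Hs.
change (Rabs (Re (g s) - Re (g t) - (s - t) * Re l) <= eps * Rabs (s - t)).
rewrite (Hg s), <- Hm.
replace (Re (g t + q s * RtoC (s - t)) - Re (g t) - (s - t) * Re (q t))
  with (Re (q s - q t) * (s - t)) by (unfold Re, Im; simpl; ring).
rewrite Rabs_mult. apply Rmult_le_compat_r; [apply Rabs_pos|].
generalize (re_le_Cmod (q s - q t)). lra.
Qed.

Lemma path_scal (k : C) (g : R -> C) t l :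
  Cpath_derive g t l -> Cpath_derive (fun s => (k * g s)%C) t (k * l)%C.
Proof.
intros H. apply (path_comp (fun w => (k * w)%C)); [|exact H].
assert (H' : Cderiv (fun w => (k * w)%C) (g t) (k * 1)) by apply Cderiv_scal, Cderiv_id.
rewrite Cmult_1_r in H'. exact H'.
Qed.

Lemma path_mult (g h : R -> C) t l m :
  Cpath_derive g t l -> Cpath_derive h t m ->
  Cpath_derive (fun s => (g s * h s)%C) t (l * h t + g t * m)%C.
Proof.
intros H1 H2. assert (Hhc : continuous h t).
{ apply (ex_derive_continuous (K := R_AbsRing) (V := C_R_NormedModule)). exists m. exact H2. }
apply path_factor in H1. destruct H1 as [p [Hp [Hl Hg]]].
apply path_factor in H2. destruct H2 as [q [Hq [Hm Hh]]].
apply path_factor. exists (fun s => (p s * h s + g t * q s)%C). split; [|split].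
- apply continuous_Cplus; apply continuous_Cmult; trivial. apply continuous_const.
- congruence.
- intros s. rewrite (Hg s), (Hh s). ring.
Qed.

(** * Integrals of complex-valued functions *)

Section CIntegral.
Variables (a b : R) (Hab : a <= b).
Notation cont g := (forall t, a <= t <= b -> continuous (g : R -> C) t).

Lemma CInt_correct (g : R -> C) : cont g -> is_RInt (V := C_R_NormedModule) g a b (CInt g a b).
Proof.
intros H. apply (RInt_correct (V := C_R_CompleteNormedModule)).
apply (ex_RInt_continuous (V := C_R_CompleteNormedModule)).
rewrite Rmin_left, Rmax_right by exact Hab. exact H.
Qed.

Lemma CInt_unique (g : R -> C) (l : C) :
  is_RInt (V := C_R_NormedModule) g a b l -> CInt g a b = l.
Proof. intros H. apply (is_RInt_unique (V := C_R_CompleteNormedModule)). exact H. Qed.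

Lemma CInt_ext (g h : R -> C) :
  (forall t, a <= t <= b -> g t = h t) -> CInt g a b = CInt h a b.
Proof.
intros H. apply RInt_ext. intros t. rewrite Rmin_left, Rmax_right by exact Hab.
intros Ht. apply H. lra.
Qed.

Lemma CInt_plus (g h : R -> C) : cont g -> cont h ->
  CInt (fun t => (g t + h t)%C) a b = (CInt g a b + CInt h a b)%C.
Proof.
intros Hg Hh. apply CInt_unique.
apply (is_RInt_plus (V := C_R_NormedModule)); apply CInt_correct; assumption.
Qed.

Lemma CInt_Re (g : R -> C) : cont g -> Re (CInt g a b) = RInt (fun t => Re (g t)) a b.
Proof.
intros Hg. symmetry. apply (is_RInt_unique (V := R_CompleteNormedModule)).
apply (is_RInt_fct_extend_fst (U := R_NormedModule) (V := R_NormedModule)), CInt_correct, Hg.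
Qed.

(** The integral lives in a module over the reals, so a complex factor has to be taken out
    coordinate by coordinate. *)
Lemma CInt_scal (k : C) (g : R -> C) : cont g ->
  CInt (fun t => (k * g t)%C) a b = (k * CInt g a b)%C.
Proof.
intros Hg. apply CInt_unique.
assert (H := CInt_correct g Hg).
assert (H1 := is_RInt_fct_extend_fst (U := R_NormedModule) (V := R_NormedModule) _ _ _ _ H).
assert (H2 := is_RInt_fct_extend_snd (U := R_NormedModule) (V := R_NormedModule) _ _ _ _ H).
apply (is_RInt_fct_extend_pair (U := R_NormedModule) (V := R_NormedModule)); simpl.
- apply (is_RInt_minus (V := R_NormedModule)); apply (is_RInt_scal (V := R_NormedModule)); assumption.
- apply (is_RInt_plus (V := R_NormedModule)); apply (is_RInt_scal (V := R_NormedModule)); assumption.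
Qed.

Lemma CInt_minus (g h : R -> C) : cont g -> cont h ->
  CInt (fun t => (g t - h t)%C) a b = (CInt g a b - CInt h a b)%C.
Proof.
intros Hg Hh. apply CInt_unique.
apply (is_RInt_minus (V := C_R_NormedModule)); apply CInt_correct; assumption.
Qed.

Lemma CInt_const (k : C) : CInt (fun _ => k) a b = (RtoC (b - a) * k)%C.
Proof.
apply CInt_unique. rewrite <- scal_R_Cmult.
apply (is_RInt_const (V := C_R_NormedModule)).
Qed.

Lemma CInt_bound (g : R -> C) (M : R) : cont g ->
  (forall t, a <= t <= b -> Cmod (g t) <= M) -> Cmod (CInt g a b) <= (b - a) * M.
Proof.
intros Hg HM. rewrite Cmod_norm.
apply (norm_RInt_le_const (V := C_R_NormedModule) g); [exact Hab| |apply CInt_correct, Hg].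
intros t Ht. rewrite <- Cmod_norm. apply HM, Ht.
Qed.

Lemma CInt_derive (A g : R -> C) : cont g ->
  (forall t, a <= t <= b -> Cpath_derive A t (g t)) -> CInt g a b = (A b - A a)%C.
Proof.
intros Hg HA. apply CInt_unique.
apply (is_RInt_derive (V := C_R_CompleteNormedModule)); rewrite Rmin_left, Rmax_right by exact Hab; assumption.
Qed.

End CIntegral.

Lemma CInt_Chasles (a b c : R) (g : R -> C) : a <= b -> b <= c ->
  (forall t, a <= t <= c -> continuous g t) -> (CInt g a b + CInt g b c)%C = CInt g a c.
Proof.
intros H1 H2 Hg.
apply (RInt_Chasles (V := C_R_CompleteNormedModule)); eexists; apply CInt_correct; trivial;
  intros t Ht; apply Hg; lra.
Qed.

(** The real mean value theorem is applied along the segment to the real part of [Cconj D * f],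
    where [D] is the total increment: its variation is |D|^2, and one factor |D| cancels. *)
Lemma mean_value_C (f f' : C -> C) (p q : C) (m : R) :
  (forall s, 0 <= s <= 1 -> Cderiv f (p + RtoC s * (q - p)) (f' (p + RtoC s * (q - p))%C)) ->
  (forall s, 0 <= s <= 1 -> Cmod (f' (p + RtoC s * (q - p))%C) <= m) ->
  Cmod (f q - f p) <= m * Cmod (q - p).
Proof.
intros Hd Hm. set (D := (f q - f p)%C).
set (g := fun s => Re (Cconj D * f (p + RtoC s * (q - p))%C)).
assert (Hg : forall s, 0 <= s <= 1 -> is_derive g s (Re (Cconj D * (f' (p + RtoC s * (q - p)) * (q - p)))%C)).
{ intros s Hs. apply path_Re, path_scal. apply (path_comp f); [apply Hd, Hs|apply path_segment]. }
destruct (MVT_gen g 0 1 (fun s => Re (Cconj D * (f' (p + RtoC s * (q - p)) * (q - p)))%C)) as [s [Hs E]].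
- intros s Hs. rewrite Rmin_left, Rmax_right in Hs by lra. apply Hg; lra.
- intros s Hs. rewrite Rmin_left, Rmax_right in Hs by lra. apply continuity_pt_filterlim, (ex_derive_continuous (V := R_NormedModule)).
  eexists. apply Hg; lra.
- rewrite Rmin_left, Rmax_right in Hs by lra.
  unfold g in E. replace (p + RtoC 1 * (q - p))%C with q in E by ring.
  replace (p + RtoC 0 * (q - p))%C with p in E by ring.
  replace (Re (Cconj D * f q) - Re (Cconj D * f p)) with (Cmod D ^ 2) in E.
  2:{ rewrite Cmod2_alt. unfold D, Re, Im, Cconj. simpl. ring. }
  rewrite Rminus_0_r, Rmult_1_r in E.
  assert (B := re_le_Cmod (Cconj D * (f' (p + RtoC s * (q - p)) * (q - p)))%C).
  rewrite !Cmod_mult, Cmod_conj in B. specialize (Hm s Hs).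
  assert (B2 := Rle_abs (Re (Cconj D * (f' (p + RtoC s * (q - p))%C * (q - p))))).
  assert (P := Cmod_ge_0 D). assert (P2 := Cmod_ge_0 (q - p)).
  destruct (Req_dec (Cmod D) 0) as [->|n].
  { apply Rmult_le_pos; [|exact P2]. apply Rle_trans with (2 := Hm). apply Cmod_ge_0. }
  apply Rmult_le_reg_l with (Cmod D); [lra|].
  apply Rle_trans with (Cmod D * (Cmod (f' (p + RtoC s * (q - p))%C) * Cmod (q - p))); [nra|].
  apply Rmult_le_compat_l; [exact P|]. apply Rmult_le_compat_r; assumption.
Qed.

(** * Integrals depending on a complex parameter *)

Lemma uniform_segment (a b : R) (Q : R -> R -> Prop) :
  (forall t d d', Q t d -> d' <= d -> Q t d') ->
  (forall t, a <= t <= b -> exists d, 0 < d /\ forall s, Rabs (s - t) < d -> Q s d) ->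
  exists d, 0 < d /\ forall t, a <= t <= b -> Q t d.
Proof.
intros Hmon H.
assert (Hc : forall t, exists d : posreal, a <= t <= b -> forall s, Rabs (s - t) < d -> Q s d).
{ intros t. destruct (classic (a <= t <= b)) as [Ht|n].
  - destruct (H t Ht) as [d [Hd Hq]]. exists (mkposreal d Hd). intros _. exact Hq.
  - exists (mkposreal 1 Rlt_0_1). intros; contradiction. }
destruct (choice _ Hc) as [delta Hdelta].
destruct (compactness_value_1d a b delta) as [d Hd].
exists d. split; [apply cond_pos|]. intros t Ht.
(* [compactness_value_1d] gives the point [u] of the finite cover only under a double negation. *)
destruct (classic (Q t d)) as [|n]; [assumption|].
exfalso. apply (Hd t Ht). intros [u [Hu [H1 H2]]]. apply n.
apply Hmon with (delta u); [|exact H2]. apply Hdelta; assumption.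
Qed.

Lemma locally_bounded {T : UniformSpace} (g : T -> C) t :
  continuous g t -> locally t (fun s => Cmod (g s) < Cmod (g t) + 1).
Proof.
intros H. apply continuous_Cmod_iff with (eps := 1) in H; [|lra].
generalize H. apply filter_imp. intros s Hs.
assert (A := Cmod_triangle (g s - g t) (g t)).
replace (g s - g t + g t)%C with (g s) in A by ring. lra.
Qed.

Section Param.
Variables (a b : R) (Hab : a <= b) (psi p d : R -> C) (z0 : C).
Hypothesis Hpsi : forall t, a <= t <= b -> continuous psi t.
Hypothesis Hp : forall t, a <= t <= b -> continuous p t.
Hypothesis Hd : forall t, a <= t <= b -> continuous d t.
Variable k : C -> C.
Hypothesis Hk : forall t, a <= t <= b -> locally (p t + d t * z0)%C (fun w => continuous k w).

Lemma kernel_continuous t z : a <= t <= b -> continuous k (p t + d t * z)%C ->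
  continuous (fun s => (psi s * k (p s + d s * z))%C) t.
Proof.
intros Ht H. apply continuous_Cmult; [apply Hpsi, Ht|].
apply (continuous_comp (fun s => (p s + d s * z)%C) k); [|exact H].
apply continuous_Cplus; [apply Hp, Ht|].
apply continuous_Cmult; [apply Hd, Ht|apply continuous_const].
Qed.

Lemma near_points t : a <= t <= b -> forall e, 0 < e -> exists d1, 0 < d1 /\
  forall s h, Rabs (s - t) < d1 -> Cmod h < d1 ->
    Cmod (p s + d s * (z0 + h) - (p t + d t * z0)) < e /\
    Cmod (psi s) < Cmod (psi t) + 1 /\ Cmod (d s) < Cmod (d t) + 1.
Proof.
intros Ht e He.
assert (C1 : continuous (fun s => (p s + d s * z0)%C) t).
{ apply continuous_Cplus; [apply Hp, Ht|].
  apply continuous_Cmult; [apply Hd, Ht|apply continuous_const]. }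
apply continuous_Cmod_iff with (eps := e / 2) in C1; [|lra].
assert (C2 := locally_bounded _ _ (Hpsi t Ht)). assert (C3 := locally_bounded _ _ (Hd t Ht)).
destruct (proj1 (locally_Rabs _ _) (filter_and _ _ C1 (filter_and _ _ C2 C3))) as [d1 [Hd1 HH]].
assert (P := Cmod_ge_0 (d t)).
exists (Rmin d1 (e / 2 / (Cmod (d t) + 1))). split.
{ apply Rmin_glb_lt; [exact Hd1|]. apply Rdiv_lt_0_compat; lra. }
intros s h Hs Hh.
destruct (HH s) as [K1 [K2 K3]]; [apply Rlt_le_trans with (1 := Hs), Rmin_l|].
split; [|split; assumption].
replace (p s + d s * (z0 + h) - (p t + d t * z0))%C
  with ((p s + d s * z0 - (p t + d t * z0)) + d s * h)%C by ring.
apply Rle_lt_trans with (1 := Cmod_triangle _ _). rewrite Cmod_mult.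
assert (Hh2 : Cmod h < e / 2 / (Cmod (d t) + 1)) by (apply Rlt_le_trans with (1 := Hh), Rmin_r).
assert (Cmod (d s) * Cmod h <= (Cmod (d t) + 1) * (e / 2 / (Cmod (d t) + 1))).
{ apply Rmult_le_compat; try apply Cmod_ge_0; lra. }
replace ((Cmod (d t) + 1) * (e / 2 / (Cmod (d t) + 1))) with (e / 2) in H by (field; lra). lra.
Qed.

Lemma near_continuous : exists d1, 0 < d1 /\ forall t, a <= t <= b ->
  forall h, Cmod h < d1 -> continuous k (p t + d t * (z0 + h))%C.
Proof.
apply uniform_segment.
- intros t d1 d2 H Hl h Hh. apply H. lra.
- intros t Ht. destruct (proj1 (locally_disk _ _) (Hk t Ht)) as [e [He H]].
  destruct (near_points t Ht e He) as [d1 [Hd1 HH]].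
  exists d1. split; [exact Hd1|]. intros s Hs h Hh. apply H, HH; assumption.
Qed.

(** The affine argument [p t + d t * z] covers the three uses of parameter integrals: circles around
    a moving centre, radii of the disk, and segments from 1 to a moving end. *)
Lemma CInt_param_continuous :
  continuous (fun z => CInt (fun t => (psi t * k (p t + d t * z))%C) a b) z0.
Proof.
destruct near_continuous as [d0 [Hd0 HC]].
apply continuous_Cmod_iff. intros eps Heps.
assert (Hb : 0 < b - a + 1) by lra.
(* The [+ 1] keeps the denominator positive when [a = b]. *)
set (e1 := eps / (b - a + 1)). assert (He1 : 0 < e1) by (apply Rdiv_lt_0_compat; lra).
destruct (uniform_segment a b (fun t d1 => forall h, Cmod h < d1 ->
   Cmod (psi t * k (p t + d t * (z0 + h)) - psi t * k (p t + d t * z0)) <= e1)) as [d1 [Hd1 H1]].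
- intros t d1 d2 H Hl h Hh. apply H. lra.
- intros t Ht.
  assert (Hkt := locally_singleton _ _ (Hk t Ht)).
  assert (P := Cmod_ge_0 (psi t)).
  (* One half of [e1] for each of the two values of [k] that are compared with its value at
     [p t + d t * z0]. *)
  set (e2 := e1 / 2 / (Cmod (psi t) + 1)).
  assert (He2 : 0 < e2) by (apply Rdiv_lt_0_compat; lra).
  apply continuous_Cmod_iff with (eps := e2) in Hkt; [|exact He2].
  apply locally_disk in Hkt. destruct Hkt as [e [He H]].
  destruct (near_points t Ht e He) as [d1 [Hd1 HH]].
  exists d1. split; [exact Hd1|]. intros s Hs h Hh.
  destruct (HH s h Hs Hh) as [K1 [K2 _]].
  destruct (HH s (RtoC 0) Hs) as [K3 _]; [rewrite Cmod_0; exact Hd1|].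
  apply H in K1. apply H in K3. rewrite Cplus_0_r in K3.
  replace (psi s * k (p s + d s * (z0 + h)) - psi s * k (p s + d s * z0))%C
    with (psi s * ((k (p s + d s * (z0 + h)) - k (p t + d t * z0)) +
       - (k (p s + d s * z0) - k (p t + d t * z0))))%C by ring.
  rewrite Cmod_mult.
  assert (T := Cmod_triangle (k (p s + d s * (z0 + h)) - k (p t + d t * z0))
    (- (k (p s + d s * z0) - k (p t + d t * z0)))). rewrite Cmod_opp in T.
  replace e1 with ((Cmod (psi t) + 1) * (2 * e2)) by (unfold e2; field; lra).
  apply Rmult_le_compat; try apply Cmod_ge_0; lra.
- apply locally_disk. exists (Rmin d0 d1). split; [apply Rmin_glb_lt; assumption|].
  intros z Hz. change C in (type of z).
  assert (Z0 : Cmod (z - z0) < d0) by (apply Rlt_le_trans with (1 := Hz), Rmin_l).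
  assert (Z1 : Cmod (z - z0) < d1) by (apply Rlt_le_trans with (1 := Hz), Rmin_r).
  replace z with (z0 + (z - z0))%C by ring. set (h := (z - z0)%C) in *.
  assert (K1 : forall t, a <= t <= b -> continuous (fun s => (psi s * k (p s + d s * (z0 + h)))%C) t).
  { intros t Ht. apply kernel_continuous; [exact Ht|]. apply HC; assumption. }
  assert (K2 : forall t, a <= t <= b -> continuous (fun s => (psi s * k (p s + d s * z0))%C) t).
  { intros t Ht. apply kernel_continuous; [exact Ht|]. apply (locally_singleton _ _ (Hk t Ht)). }
  rewrite <- CInt_minus by assumption.
  apply Rle_lt_trans with ((b - a) * e1).
  + apply CInt_bound; [exact Hab| |intros t Ht; apply H1; assumption].
    intros t Ht. apply continuous_Cminus; [apply K1|apply K2]; exact Ht.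
  + replace eps with ((b - a + 1) * e1) by (unfold e1; field; lra). nra.
Qed.

Variable k' : C -> C.
Hypothesis Hkd : forall t, a <= t <= b -> locally (p t + d t * z0)%C (fun w => Cderiv k w (k' w)).
Hypothesis Hkc : forall t, a <= t <= b -> continuous k' (p t + d t * z0)%C.

Lemma CInt_param_derive :
  Cderiv (fun z => CInt (fun t => (psi t * k (p t + d t * z))%C) a b) z0
    (CInt (fun t => (psi t * d t * k' (p t + d t * z0))%C) a b).
Proof.
destruct near_continuous as [d0 [Hd0 HC]].
apply Cderiv_eps. intros eps Heps.
assert (Hb : 0 < b - a + 1) by lra.
set (e1 := eps / (b - a + 1)). assert (He1 : 0 < e1) by (apply Rdiv_lt_0_compat; lra).
destruct (uniform_segment a b (fun t d1 => forall h, Cmod h < d1 ->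
   Cmod (psi t * k (p t + d t * (z0 + h)) - psi t * k (p t + d t * z0)
     - psi t * d t * k' (p t + d t * z0) * h) <= e1 * Cmod h)) as [d1 [Hd1 H1]].
- intros t d1 d2 H Hl h Hh. apply H. lra.
- intros t Ht.
  assert (Hkt := Hkc t Ht).
  assert (P := Cmod_ge_0 (psi t)). assert (P' := Cmod_ge_0 (d t)).
  set (e2 := e1 / 2 / ((Cmod (psi t) + 1) * (Cmod (d t) + 1))).
  assert (He2 : 0 < e2).
  { apply Rdiv_lt_0_compat; [lra|]. apply Rmult_lt_0_compat; lra. }
  apply continuous_Cmod_iff with (eps := e2) in Hkt; [|exact He2].
  destruct (proj1 (locally_disk _ _) (filter_and _ _ Hkt (Hkd t Ht))) as [e [He H]].
  destruct (near_points t Ht e He) as [d1 [Hd1 HH]].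
  exists d1. split; [exact Hd1|]. intros s Hs h Hh.
  (* The mean value inequality below needs the estimates on the whole segment of increments, not
     only at [h]. *)
  assert (Hseg : forall u, 0 <= u <= 1 -> Cmod (RtoC u * h) < d1).
  { intros u Hu. rewrite Cmod_mult, Cmod_R, Rabs_pos_eq by lra.
    generalize (Cmod_ge_0 h). nra. }
  destruct (HH s h Hs Hh) as [_ [K2 K3]].
  destruct (HH s (RtoC 0) Hs) as [K4 _]; [rewrite Cmod_0; exact Hd1|].
  rewrite Cplus_0_r in K4. apply H in K4. destruct K4 as [K4 _].
  set (c := k' (p t + d t * z0)%C) in *.
  (* On this segment [k w - c * w] has derivative [k' w - c], of modulus below [e2]. A second [e2]
     pays for replacing [k'] at [p s + d s * z0] by the constant [c]. *)
  assert (MV : Cmod ((k (p s + d s * (z0 + h)) - c * (p s + d s * (z0 + h))) -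
      (k (p s + d s * z0) - c * (p s + d s * z0))) <=
      e2 * Cmod ((p s + d s * (z0 + h)) - (p s + d s * z0))).
  { assert (Hpt : forall u : R, (p s + d s * z0 + RtoC u * (p s + d s * (z0 + h) - (p s + d s * z0)))%C =
       (p s + d s * (z0 + RtoC u * h))%C) by (intros; ring).
    apply (mean_value_C (fun w => (k w - c * w)%C) (fun w => (k' w - c)%C));
      intros u Hu; rewrite Hpt;
      destruct (H _ (proj1 (HH s (RtoC u * h)%C Hs (Hseg u Hu)))) as [L1 L2].
    - replace (k' (p s + d s * (z0 + RtoC u * h)) - c)%C
        with (k' (p s + d s * (z0 + RtoC u * h)) - c * 1)%C by ring.
      apply Cderiv_minus; [exact L2|apply Cderiv_scal, Cderiv_id].
    - left. exact L1. }
  replace (p s + d s * (z0 + h) - (p s + d s * z0))%C with (d s * h)%C in MV by ring.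
  replace (psi s * k (p s + d s * (z0 + h)) - psi s * k (p s + d s * z0)
     - psi s * d s * k' (p s + d s * z0) * h)%C with
   (psi s * (((k (p s + d s * (z0 + h)) - c * (p s + d s * (z0 + h))) -
      (k (p s + d s * z0) - c * (p s + d s * z0))) +
      - (k' (p s + d s * z0) - c) * (d s * h)))%C by ring.
  rewrite Cmod_mult. rewrite Cmod_mult in MV.
  assert (T := Cmod_triangle ((k (p s + d s * (z0 + h)) - c * (p s + d s * (z0 + h))) -
      (k (p s + d s * z0) - c * (p s + d s * z0))) (- (k' (p s + d s * z0) - c) * (d s * h))).
  rewrite (Cmod_mult (- _)), Cmod_opp, Cmod_mult in T.
  apply Rle_trans with ((Cmod (psi t) + 1) * (2 * e2 * ((Cmod (d t) + 1) * Cmod h))).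
  2:{ right. unfold e2. field. lra. }
  assert (Q := Cmod_ge_0 h). assert (Q1 := Cmod_ge_0 (d s)).
  assert (N : Cmod (d s) * Cmod h <= (Cmod (d t) + 1) * Cmod h) by (apply Rmult_le_compat_r; lra).
  assert (N1 : 0 <= Cmod (d s) * Cmod h) by (apply Rmult_le_pos; assumption).
  apply Rmult_le_compat; try apply Cmod_ge_0; [lra|].
  apply Rle_trans with (1 := T).
  assert (Cmod (k' (p s + d s * z0)%C - c) * (Cmod (d s) * Cmod h) <= e2 * (Cmod (d s) * Cmod h)).
  { apply Rmult_le_compat_r; [exact N1|]. left; exact K4. }
  nra.
- exists (Rmin d0 d1). split; [apply Rmin_glb_lt; assumption|].
  intros z Hz.
  assert (Z0 : Cmod (z - z0) < d0) by (apply Rlt_le_trans with (1 := Hz), Rmin_l).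
  assert (Z1 : Cmod (z - z0) < d1) by (apply Rlt_le_trans with (1 := Hz), Rmin_r).
  replace (CInt (fun t => (psi t * k (p t + d t * z))%C) a b) with
    (CInt (fun t => (psi t * k (p t + d t * (z0 + (z - z0))))%C) a b)
    by (replace (z0 + (z - z0))%C with z by ring; reflexivity).
  set (h := (z - z0)%C) in *.
  assert (K1 : forall t, a <= t <= b -> continuous (fun s => (psi s * k (p s + d s * (z0 + h)))%C) t).
  { intros t Ht. apply kernel_continuous; [exact Ht|]. apply HC; assumption. }
  assert (K2 : forall t, a <= t <= b -> continuous (fun s => (psi s * k (p s + d s * z0))%C) t).
  { intros t Ht. apply kernel_continuous; [exact Ht|]. apply (locally_singleton _ _ (Hk t Ht)). }
  assert (K3 : forall t, a <= t <= b -> continuous (fun s => (psi s * d s * k' (p s + d s * z0))%C) t).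
  { intros t Ht. apply continuous_Cmult.
    - apply continuous_Cmult; [apply Hpsi|apply Hd]; exact Ht.
    - apply (continuous_comp (fun s => (p s + d s * z0)%C) k'); [|apply Hkc, Ht].
      apply continuous_Cplus; [apply Hp, Ht|].
      apply continuous_Cmult; [apply Hd, Ht|apply continuous_const]. }
  assert (K4 : forall t, a <= t <= b -> continuous (fun s =>
      (psi s * k (p s + d s * (z0 + h)) - psi s * k (p s + d s * z0))%C) t).
  { intros t Ht. apply continuous_Cminus; [apply K1|apply K2]; exact Ht. }
  rewrite (Cmult_comm _ h), <- CInt_scal, <- CInt_minus by assumption.
  rewrite <- CInt_minus; trivial.
  2:{ intros t Ht. apply continuous_Cmult; [apply continuous_const|apply K3, Ht]. }
  apply Rle_trans with ((b - a) * (e1 * Cmod h)).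
  + apply CInt_bound; [exact Hab| |].
    * intros t Ht. apply continuous_Cminus; [apply K4, Ht|].
      apply continuous_Cmult; [apply continuous_const|apply K3, Ht].
    * intros t Ht. rewrite (Cmult_comm h). apply H1; assumption.
  + replace eps with ((b - a + 1) * e1) by (unfold e1; field; lra).
    assert (0 <= e1 * Cmod h) by (apply Rmult_le_pos; [lra|apply Cmod_ge_0]). nra.
Qed.

End Param.

(** * The exponential and Goursat's lemma *)

Lemma Cexp_plus z w : Cexp (z + w) = (Cexp z * Cexp w)%C.
Proof.
unfold Cexp, Cmult, Re, Im; simpl. rewrite exp_plus, cos_plus, sin_plus.
f_equal; ring.
Qed.

Lemma Cexp_0 : Cexp 0 = 1.
Proof. unfold Cexp, Re, Im; simpl. rewrite exp_0, cos_0, sin_0. unfold RtoC. f_equal; ring. Qed.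

Lemma Cexp_opp z : (Cexp z * Cexp (- z))%C = 1.
Proof. rewrite <- Cexp_plus, Cplus_opp_r. apply Cexp_0. Qed.

Lemma Cexp_neq_0 z : Cexp z <> 0.
Proof.
intros E. assert (H := Cexp_opp z). rewrite E, Cmult_0_l in H. apply C1_nz. symmetry. exact H.
Qed.

Lemma Cmod_Cexp z : Cmod (Cexp z) = exp (Re z).
Proof.
unfold Cmod, Cexp; simpl.
replace (exp (Re z) * cos (Im z) * (exp (Re z) * cos (Im z) * 1) +
  exp (Re z) * sin (Im z) * (exp (Re z) * sin (Im z) * 1)) with (Rsqr (exp (Re z))).
- apply sqrt_Rsqr. left. apply exp_pos.
- assert (H := sin2_cos2 (Im z)). unfold Rsqr in *. 
  transitivity (exp (Re z) * exp (Re z) * (sin (Im z) * sin (Im z) + cos (Im z) * cos (Im z))); [rewrite H|]; ring.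
Qed.

Lemma derive_factor (u : R -> R) (x l : R) : is_derive u x l ->
  exists v : R -> R, continuous v x /\ v x = l /\ forall y, u y = u x + v y * (y - x).
Proof.
intros H.
assert (H' : Cpath_derive (fun t => RtoC (u t)) x (RtoC l)).
{ split; [apply is_linear_scal_l|]. intros x' Hx eps.
  destruct H as [_ H]. generalize (H x' Hx eps). apply filter_imp. intros y Hy.
  rewrite <- Cmod_norm.
  change (Cmod (RtoC (u y) - RtoC (u x') - @scal R_Ring C_R_ModuleSpace (y - x')%R (RtoC l))%C <= eps * Rabs (y - x')).
  rewrite scal_R_Cmult, <- RtoC_mult, <- !RtoC_minus, Cmod_R. exact Hy. }
apply path_factor in H'. destruct H' as [psi [Hc [Hl Hg]]].
exists (fun t => Re (psi t)). split; [apply continuous_Re, Hc|]. split; [rewrite Hl; reflexivity|].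
intros y. assert (E := f_equal Re (Hg y)). unfold Re in *. simpl in E. rewrite E. ring.
Qed.

(** Write exp x = 1 + a(x) x, cos y = 1 + c(y) y and sin y = s(y) y. Then e^w - 1 - w is a sum of x
    (a(x) - 1), e^x c(y) y and i y (e^x s(y) - 1), which is at most m(w) |w| for a continuous [m]
    that vanishes at 0. *)
Lemma Cderiv_Cexp_0 : Cderiv Cexp 0 1.
Proof.
destruct (derive_factor exp 0 1) as [a [Ha [Ha0 Hea]]].
{ apply is_derive_Reals. rewrite <- exp_0. apply derivable_pt_lim_exp. }
destruct (derive_factor cos 0 0) as [c [Hc [Hc0 Hec]]].
{ apply is_derive_Reals. replace 0 with (- sin 0) at 2 by (rewrite sin_0; ring). apply derivable_pt_lim_cos. }
destruct (derive_factor sin 0 1) as [s [Hs [Hs0 Hes]]].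
{ apply is_derive_Reals. rewrite <- cos_0. apply derivable_pt_lim_sin. }
rewrite exp_0 in Hea. rewrite cos_0 in Hec. rewrite sin_0 in Hes.
assert (Hexp : continuous exp 0).
{ apply continuity_pt_filterlim. apply derivable_continuous_pt, derivable_pt_exp. }
assert (HRe : forall u : R -> R, continuous u 0 -> continuous (fun w : C => u (Re w)) (RtoC 0)).
{ intros u Hu. apply (continuous_comp (fun w : C => Re w) u); [apply continuous_Re, continuous_id|exact Hu]. }
assert (HIm : forall u : R -> R, continuous u 0 -> continuous (fun w : C => u (Im w)) (RtoC 0)).
{ intros u Hu. apply (continuous_comp (fun w : C => Im w) u); [apply continuous_Im, continuous_id|exact Hu]. }
set (m := fun w : C => Rabs (a (Re w) - 1) + exp (Re w) * Rabs (c (Im w)) + Rabs (exp (Re w) * s (Im w) - 1)).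
assert (Hm : continuous m (RtoC 0)).
{ assert (HA : forall u : C -> R, continuous u (RtoC 0) -> continuous (fun w => Rabs (u w)) (RtoC 0)).
  { intros u Hu. apply (continuous_comp u Rabs); [exact Hu|apply continuous_Rabs]. }
  repeat apply (continuous_plus (V := R_NormedModule)).
  - apply HA. apply (continuous_minus (V := R_NormedModule)); [apply HRe, Ha|apply continuous_const].
  - apply (continuous_mult (K := R_AbsRing)); [apply HRe, Hexp|]. apply HA, HIm, Hc.
  - apply HA. apply (continuous_minus (V := R_NormedModule)); [|apply continuous_const].
    apply (continuous_mult (K := R_AbsRing)); [apply HRe, Hexp|apply HIm, Hs]. }
assert (Hm0 : m (RtoC 0) = 0).
{ unfold m, Re, Im; simpl. rewrite Ha0, Hc0, Hs0, exp_0.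
  replace (1 - 1) with 0 by ring. replace (1 * 1 - 1) with 0 by ring. rewrite Rabs_R0. ring. }
apply Cderiv_eps. intros eps Heps.
specialize (Hm (fun y => Rabs (y - m (RtoC 0)) < eps)).
assert (Hb : locally (m (RtoC 0)) (fun y => Rabs (y - m (RtoC 0)) < eps)).
{ exists (mkposreal _ Heps). intros y Hy. exact Hy. }
destruct (proj1 (locally_disk (RtoC 0) _) (Hm Hb)) as [d [Hd H]].
exists d. split; [exact Hd|]. intros w Hw. specialize (H w Hw).
rewrite Hm0, Rminus_0_r in H. assert (H2 := Rle_abs (m w)).
replace (w - 0)%C with w by ring. rewrite Cexp_0.
destruct w as [x y].
replace (Cexp (x, y) - 1 - 1 * (x, y))%C with
  (RtoC (x * (a x - 1)) + RtoC (exp x * y * c y) + Ci * RtoC (y * (exp x * s y - 1)))%C.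
2:{ unfold Cexp, Cminus, Cplus, Cmult, Copp, RtoC, Ci, Re, Im; simpl.
    rewrite (Hec y), (Hes y). assert (E := Hea x). apply f_equal2; [lra|ring]. }
apply Rle_trans with (m (x, y) * Cmod (x, y)).
2:{ apply Rmult_le_compat_r; [apply Cmod_ge_0|lra]. }
eapply Rle_trans; [apply Cmod_triangle|].
eapply Rle_trans; [apply Rplus_le_compat_r, Cmod_triangle|].
rewrite Cmod_mult, Cmod_Ci, !Cmod_R, !Rabs_mult, (Rabs_pos_eq (exp x)) by (left; apply exp_pos).
assert (X := re_le_Cmod (x, y)). simpl in X.
assert (Y : Rabs y <= Cmod (x, y)) by apply (Rle_trans _ _ _ (Rmax_r _ _) (Rmax_Cmod (x, y))).
unfold m. simpl.
assert (P := exp_pos x).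
assert (P1 := Rabs_pos (a x - 1)). assert (P2 := Rabs_pos (c y)). assert (P3 := Rabs_pos (exp x * s y - 1)).
assert (P4 : 0 <= exp x * Rabs (c y)) by (apply Rmult_le_pos; lra).
assert (K1 := Rmult_le_compat_r _ _ _ P1 X).
assert (K2 := Rmult_le_compat_r _ _ _ P4 Y).
assert (K3 := Rmult_le_compat_r _ _ _ P3 Y). unfold Re, fst in K1. simpl. lra.
Qed.

Lemma Cderiv_Cexp z : Cderiv Cexp z (Cexp z).
Proof.
apply Cderiv_ext with (fun w => (Cexp z * Cexp (w - z))%C).
{ intros w. rewrite <- Cexp_plus. f_equal. ring. }
apply Cderiv_eq with (Cexp z * (1 * (1 - 0)))%C; [|ring]. apply Cderiv_scal.
apply Cderiv_comp; [|apply Cderiv_minus; [apply Cderiv_id|apply Cderiv_const]].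
replace (z - z)%C with (RtoC 0) by ring. apply Cderiv_Cexp_0.
Qed.

(** * Contour integrals around rectangles *)

Lemma path_horizontal (x y : R) : Cpath_derive (fun t => (t, y) : C) x (RtoC 1).
Proof.
apply path_factor. exists (fun _ => RtoC 1). split; [apply continuous_const|]. split; [reflexivity|].
intros s. unfold Cplus, Cmult, RtoC; simpl. f_equal; ring.
Qed.

Lemma path_vertical (x y : R) : Cpath_derive (fun t => (x, t) : C) y Ci.
Proof.
apply path_factor. exists (fun _ => Ci). split; [apply continuous_const|]. split; [reflexivity|].
intros s. unfold Cplus, Cmult, RtoC, Ci; simpl. f_equal; ring.
Qed.

Definition horizontal_side (g : C -> C) (y x w : R) : C := CInt (fun t => g (t, y)) x (x + w).
Definition vertical_side (g : C -> C) (x y h : R) : C := CInt (fun t => g (x, t)) y (y + h).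

(** The contour integral of [g], counterclockwise, around the rectangle with lower left corner (x,
    y), width [w] and height [h]; the factors [Ci] come from dz = i dt on the vertical sides. *)
Definition rectangle_integral (g : C -> C) (x y w h : R) : C :=
  (horizontal_side g y x w + Ci * vertical_side g (x + w) y h
   - horizontal_side g (y + h) x w - Ci * vertical_side g x y h)%C.

Definition continuous_on_rectangle (g : C -> C) (x y w h : R) : Prop :=
  forall s t, x <= s <= x + w -> y <= t <= y + h -> continuous g (s, t).

Lemma continuous_horizontal g (s t : R) : continuous g (s, t) -> continuous (fun u => g (u, t)) s.
Proof.
intros H. apply (continuous_comp (fun u => (u, t) : C) g); [|exact H].
apply (ex_derive_continuous (K := R_AbsRing) (V := C_R_NormedModule)). eexists. apply path_horizontal.
Qed.

Lemma continuous_vertical g (s t : R) : continuous g (s, t) -> continuous (fun u => g (s, u)) t.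
Proof.
intros H. apply (continuous_comp (fun u => (s, u) : C) g); [|exact H].
apply (ex_derive_continuous (K := R_AbsRing) (V := C_R_NormedModule)). eexists. apply path_vertical.
Qed.

Lemma rectangle_split g x y w h : 0 <= w -> 0 <= h ->
  continuous_on_rectangle g x y (2 * w) (2 * h) ->
  rectangle_integral g x y (2 * w) (2 * h) =
   (rectangle_integral g x y w h + rectangle_integral g (x + w) y w h +
    rectangle_integral g x (y + h) w h + rectangle_integral g (x + w) (y + h) w h)%C.
Proof.
intros Hw Hh Hg. unfold rectangle_integral.
assert (H : forall t, y <= t <= y + 2 * h -> horizontal_side g t x (2 * w) =
   (horizontal_side g t x w + horizontal_side g t (x + w) w)%C).
{ intros t Ht. unfold horizontal_side. replace (x + 2 * w) with (x + w + w) by ring.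
  symmetry. apply CInt_Chasles; [lra|lra|]. intros s Hs. apply continuous_horizontal, Hg; lra. }
assert (V : forall s, x <= s <= x + 2 * w -> vertical_side g s y (2 * h) =
   (vertical_side g s y h + vertical_side g s (y + h) h)%C).
{ intros s Hs. unfold vertical_side. replace (y + 2 * h) with (y + h + h) by ring.
  symmetry. apply CInt_Chasles; [lra|lra|]. intros t Ht. apply continuous_vertical, Hg; lra. }
rewrite !H, !V by lra.
replace (x + w + w) with (x + 2 * w) by ring. replace (y + h + h) with (y + 2 * h) by ring. ring.
Qed.

Lemma rectangle_bound g x y w h M : 0 <= w -> 0 <= h ->
  continuous_on_rectangle g x y w h ->
  (forall s t, x <= s <= x + w -> y <= t <= y + h -> Cmod (g (s, t)) <= M) ->
  Cmod (rectangle_integral g x y w h) <= 2 * (w + h) * M.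
Proof.
intros Hw Hh Hg HM. unfold rectangle_integral.
assert (H : forall t, y <= t <= y + h -> Cmod (horizontal_side g t x w) <= w * M).
{ intros t Ht. replace w with (x + w - x) at 2 by ring. apply CInt_bound; [lra| |].
  - intros s Hs. apply continuous_horizontal, Hg; assumption.
  - intros s Hs. apply HM; assumption. }
assert (V : forall s, x <= s <= x + w -> Cmod (vertical_side g s y h) <= h * M).
{ intros t Ht. replace h with (y + h - y) at 2 by ring. apply CInt_bound; [lra| |].
  - intros s Hs. apply continuous_vertical, Hg; assumption.
  - intros s Hs. apply HM; assumption. }
assert (H1 := H y). assert (H2 := H (y + h)). assert (V1 := V x). assert (V2 := V (x + w)).
eapply Rle_trans; [apply Cmod_triangle|]. rewrite Cmod_opp, Cmod_mult, Cmod_Ci.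
eapply Rle_trans; [apply Rplus_le_compat_r, Cmod_triangle|]. rewrite Cmod_opp.
eapply Rle_trans; [apply Rplus_le_compat_r, Rplus_le_compat_r, Cmod_triangle|]. rewrite Cmod_mult, Cmod_Ci.
specialize (H1 ltac:(lra)). specialize (H2 ltac:(lra)). specialize (V1 ltac:(lra)). specialize (V2 ltac:(lra)). lra.
Qed.

Lemma rectangle_minus g k x y w h : 0 <= w -> 0 <= h ->
  continuous_on_rectangle g x y w h -> continuous_on_rectangle k x y w h ->
  rectangle_integral (fun z => (g z - k z)%C) x y w h =
  (rectangle_integral g x y w h - rectangle_integral k x y w h)%C.
Proof.
intros Hw Hh Hg Hk. unfold rectangle_integral, horizontal_side, vertical_side.
rewrite !CInt_minus; try lra; try ring;
  intros t Ht; first [apply continuous_horizontal|apply continuous_vertical]; first [apply Hg|apply Hk]; lra.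
Qed.

Lemma rectangle_primitive A g x y w h : 0 <= w -> 0 <= h ->
  (forall z, Cderiv A z (g z)) -> (forall z, continuous g z) ->
  rectangle_integral g x y w h = 0.
Proof.
intros Hw Hh HA Hg. unfold rectangle_integral.
assert (H : forall t, horizontal_side g t x w = (A ((x + w)%R, t) - A (x, t))%C).
{ intros t. apply (CInt_derive x (x + w) ltac:(lra) (fun s => A (s, t))).
  - intros s _. apply continuous_horizontal, Hg.
  - intros s _. rewrite <- (Cmult_1_r (g (s, t))). apply (path_comp A); [apply HA|apply path_horizontal]. }
assert (V : forall s, (Ci * vertical_side g s y h)%C = (A (s, (y + h)%R) - A (s, y))%C).
{ intros s. unfold vertical_side. rewrite <- CInt_scal; [|lra|intros t _; apply continuous_vertical, Hg].
  apply (CInt_derive y (y + h) ltac:(lra) (fun t => A (s, t))).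
  - intros t _. apply continuous_Cmult; [apply continuous_const|]. apply continuous_vertical, Hg.
  - intros t _. rewrite (Cmult_comm Ci). apply (path_comp A); [apply HA|apply path_vertical]. }
rewrite !H, !V. ring.
Qed.

Section Goursat.
Variables (g : C -> C) (X Y W H : R).
Hypothesis (HW : 0 <= W) (HH : 0 <= H).
Hypothesis Hg : forall s t, X <= s <= X + W -> Y <= t <= Y + H -> exists l, Cderiv g (s, t) l.

Let side L n := L * (/ 2) ^ n.

Let quarter_bound (x y : R) n : R := Cmod (rectangle_integral g x y (side W n) (side H n)).

(* Bisection keeping a quarter on which the integral is at least a quarter of the previous one. *)
Fixpoint corner (n : nat) : R * R :=
  match n with
  | O => (X, Y)
  | S m => let (x, y) := corner m in
    let b := quarter_bound x y m / 4 in
    if Rle_dec b (quarter_bound x y (S m)) then (x, y)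
    else if Rle_dec b (quarter_bound (x + side W (S m)) y (S m)) then (x + side W (S m), y)
    else if Rle_dec b (quarter_bound x (y + side H (S m)) (S m)) then (x, y + side H (S m))
    else (x + side W (S m), y + side H (S m))
  end.

Lemma side_S L n : side L n = 2 * side L (S n).
Proof. unfold side. simpl. field. Qed.

Lemma side_pos L n : 0 <= L -> 0 <= side L n.
Proof. intros HL. apply Rmult_le_pos; [exact HL|]. apply pow_le. lra. Qed.

Lemma corner_spec n : forall x y, corner n = (x, y) ->
  (X <= x /\ x + side W n <= X + W) /\ (Y <= y /\ y + side H n <= Y + H) /\
  quarter_bound X Y 0 <= 4 ^ n * quarter_bound x y n.
Proof.
induction n as [|n IH]; intros x y E.
- simpl in E. injection E as <- <-. unfold side. simpl. lra.
- simpl in E. destruct (corner n) as [x0 y0]. destruct (IH x0 y0 eq_refl) as [IX [IY IQ]].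
  assert (SW := side_pos W (S n) HW). assert (SH := side_pos H (S n) HH).
  rewrite (side_S W n) in IX. rewrite (side_S H n) in IY.
  set (b := quarter_bound x0 y0 n / 4) in *.
  assert (K : forall x y, (x = x0 \/ x = x0 + side W (S n)) -> (y = y0 \/ y = y0 + side H (S n)) ->
     b <= quarter_bound x y (S n) ->
     (X <= x /\ x + side W (S n) <= X + W) /\ (Y <= y /\ y + side H (S n) <= Y + H) /\
     quarter_bound X Y 0 <= 4 ^ S n * quarter_bound x y (S n)).
  { intros x1 y1 Hx Hy Hb. split; [|split].
    - destruct Hx; lra.
    - destruct Hy; lra.
    - apply Rle_trans with (1 := IQ). simpl.
      assert (P : 0 < 4 ^ n) by (apply pow_lt; lra). unfold b in Hb. nra. }
  destruct (Rle_dec b (quarter_bound x0 y0 (S n))) as [h1|h1]; [injection E as <- <-; apply K; auto|].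
  destruct (Rle_dec b (quarter_bound (x0 + side W (S n)) y0 (S n))) as [h2|h2];
    [injection E as <- <-; apply K; auto|].
  destruct (Rle_dec b (quarter_bound x0 (y0 + side H (S n)) (S n))) as [h3|h3];
    [injection E as <- <-; apply K; auto|].
  injection E as <- <-. apply K; auto.
  (* If three quarters carry less than a fourth of the integral each, the triangle inequality forces
     the last one to carry at least a fourth. *)
  apply Rnot_le_lt in h1, h2, h3.
  assert (Q : quarter_bound x0 y0 n <= quarter_bound x0 y0 (S n) + quarter_bound (x0 + side W (S n)) y0 (S n)
     + quarter_bound x0 (y0 + side H (S n)) (S n) + quarter_bound (x0 + side W (S n)) (y0 + side H (S n)) (S n)).
  { unfold quarter_bound. rewrite (side_S W n), (side_S H n), rectangle_split; trivial.
    - eapply Rle_trans; [apply Cmod_triangle|]. apply Rplus_le_compat_r.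
      eapply Rle_trans; [apply Cmod_triangle|]. apply Rplus_le_compat_r. apply Cmod_triangle.
    - intros s t Hs Ht. destruct (Hg s t) as [l Hl]; try lra. apply Cderiv_continuous with l, Hl. }
  unfold b in *. lra.
Qed.

Lemma corner_mono n m : (n <= m)%nat ->
  fst (corner n) <= fst (corner m) /\ fst (corner m) + side W m <= fst (corner n) + side W n /\
  snd (corner n) <= snd (corner m) /\ snd (corner m) + side H m <= snd (corner n) + side H n.
Proof.
induction 1 as [|m _ IH]; [lra|].
assert (SW := side_pos W (S m) HW). assert (SH := side_pos H (S m) HH).
rewrite (side_S W m), (side_S H m) in IH. simpl. destruct (corner m) as [x y]. simpl in IH.
repeat match goal with |- context [Rle_dec ?a ?b] => destruct (Rle_dec a b) end; simpl; lra.
Qed.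

Lemma nested_limit (a e : nat -> R) :
  (forall n m, (n <= m)%nat -> a n <= a m /\ a m + e m <= a n + e n) -> (forall n, 0 <= e n) ->
  exists l, forall n, a n <= l <= a n + e n.
Proof.
intros Hm He.
destruct (completeness (fun r => exists n, r = a n)) as [l [Hu Hl]].
- exists (a O + e O). intros r [n ->]. generalize (proj2 (Hm O n (Nat.le_0_l n))) (He n). lra.
- exists (a O), O. reflexivity.
- exists l. intros n. split; [apply Hu; exists n; reflexivity|].
  apply Hl. intros r [m ->]. destruct (Nat.le_ge_cases n m) as [h|h].
  + generalize (proj2 (Hm n m h)) (He m). lra.
  + generalize (proj1 (Hm m n h)) (He n). lra.
Qed.

(** At the common point of the nested rectangles [g] is affine up to [eps] times the distance. The
    affine part has a primitive and integrates to 0; perimeter and diameter of the n-th rectangle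
    both scale like 2^(-n), which compensates the factor 4^n of the bisection. *)
Lemma rectangle_integral_zero : rectangle_integral g X Y W H = 0.
Proof.
destruct (nested_limit (fun n => fst (corner n)) (side W)) as [x Hx].
{ intros n m h. destruct (corner_mono n m h). tauto. }
{ intros n. apply side_pos, HW. }
destruct (nested_limit (fun n => snd (corner n)) (side H)) as [y Hy].
{ intros n m h. destruct (corner_mono n m h). tauto. }
{ intros n. apply side_pos, HH. }
assert (Hx0 := Hx O). assert (Hy0 := Hy O). unfold side in Hx0, Hy0. simpl in Hx0, Hy0.
destruct (Hg x y) as [l Hl]; [lra|lra|].
apply Cmod_eq_0. apply Rle_antisym; [|apply Cmod_ge_0]. apply le_epsilon. intros eps0 Heps0.
(* The final bound is 2 (W + H)^2 [eps]; the [+ 1] keeps [K] positive for a degenerate rectangle. *)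
set (K := 2 * (W + H) * (W + H) + 1).
assert (HK : 0 < K) by (unfold K; nra).
set (eps := eps0 / K). assert (Heps : 0 < eps) by (apply Rdiv_lt_0_compat; lra).
destruct (proj1 (Cderiv_eps _ _ _) Hl eps Heps) as [d [Hd Hdd]].
(* Width plus height bounds the diameter, so the whole n-th rectangle lies where the derivative
   estimate at its limit point holds. *)
assert (Hn : exists n, side (W + H) n < d).
{ destruct (pow_lt_1_zero (/ 2)) with (y := d / (W + H + 1)) as [n Hn].
  - rewrite Rabs_pos_eq; lra.
  - apply Rdiv_lt_0_compat; lra.
  - exists n. specialize (Hn n (Nat.le_refl n)). rewrite Rabs_pos_eq in Hn by (apply pow_le; lra).
    unfold side. assert (P : 0 < (/2) ^ n) by (apply pow_lt; lra).
    apply Rlt_le_trans with ((W + H + 1) * (/ 2) ^ n); [nra|].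
    apply Rmult_lt_compat_l with (r := W + H + 1) in Hn; [|lra].
    replace ((W + H + 1) * (d / (W + H + 1))) with d in Hn by (field; lra). lra. }
destruct Hn as [n Hn].
destruct (corner n) as [xn yn] eqn:En.
specialize (Hx n). specialize (Hy n). rewrite En in Hx, Hy. simpl in Hx, Hy.
destruct (corner_spec n xn yn En) as [IX [IY IQ]].
assert (SW := side_pos W n HW). assert (SH := side_pos H n HH).
assert (SWH : side (W + H) n = side W n + side H n) by (unfold side; ring).
set (p := (x, y) : C).
set (aff := fun z : C => (g p + l * (z - p))%C).
assert (Haff : rectangle_integral aff xn yn (side W n) (side H n) = 0).
{ apply (rectangle_primitive (fun z => ((g p - l * p) * z + l / 2 * (z * z))%C)); trivial.
  - intros z. unfold aff.
    replace (g p + l * (z - p))%C with ((g p - l * p) * 1 + l / 2 * (1 * z + z * 1))%C by field.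
    apply Cderiv_plus; apply Cderiv_scal; [apply Cderiv_id|]. apply Cderiv_mult; apply Cderiv_id.
  - intros z. apply continuous_Cplus; [apply continuous_const|].
    apply continuous_Cmult; [apply continuous_const|].
    apply continuous_Cminus; [apply continuous_id|apply continuous_const]. }
assert (Cg : continuous_on_rectangle g xn yn (side W n) (side H n)).
{ intros s t Hs Ht. destruct (Hg s t) as [l' Hl']; try lra. apply Cderiv_continuous with l', Hl'. }
assert (Ca : continuous_on_rectangle aff xn yn (side W n) (side H n)).
{ intros s t _ _. apply continuous_Cplus; [apply continuous_const|].
    apply continuous_Cmult; [apply continuous_const|].
    apply continuous_Cminus; [apply continuous_id|apply continuous_const]. }
assert (E : rectangle_integral g xn yn (side W n) (side H n) =
  rectangle_integral (fun z => (g z - aff z)%C) xn yn (side W n) (side H n)).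
{ rewrite rectangle_minus, Haff by assumption. ring. }
assert (B : quarter_bound xn yn n <= 2 * side (W + H) n * (eps * side (W + H) n)).
{ unfold quarter_bound. rewrite E, SWH. apply rectangle_bound; trivial.
  - intros s t Hs Ht. apply continuous_Cminus; [apply Cg|apply Ca]; assumption.
  - intros s t Hs Ht.
    assert (D : Cmod ((s, t) - p) <= side W n + side H n).
    { replace ((s, t) - p)%C with (RtoC (s - x) + Ci * RtoC (t - y))%C
        by (unfold p; apply injective_projections; simpl; ring).
      eapply Rle_trans; [apply Cmod_triangle|].
      rewrite Cmod_mult, Cmod_Ci, !Cmod_R, Rmult_1_l.
      apply Rplus_le_compat; apply Rabs_le; lra. }
    unfold aff. replace (g (s, t) - (g p + l * ((s, t) - p)))%C with
      (g (s, t) - g p - l * ((s, t) - p))%C by ring.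
    eapply Rle_trans; [apply Hdd; change ((x, y) : C) with p; lra|].
    apply Rmult_le_compat_l; [lra|exact D]. }
assert (Q0 : quarter_bound X Y 0 = Cmod (rectangle_integral g X Y W H)).
{ unfold quarter_bound, side. simpl. rewrite !Rmult_1_r. reflexivity. }
rewrite Q0 in IQ. rewrite Rplus_0_l.
apply Rle_trans with (1 := IQ).
apply Rle_trans with (4 ^ n * (2 * side (W + H) n * (eps * side (W + H) n))).
{ apply Rmult_le_compat_l; [apply pow_le; lra|exact B]. }
replace (4 ^ n * (2 * side (W + H) n * (eps * side (W + H) n))) with (2 * (W + H) * (W + H) * eps).
- replace eps0 with (K * eps) by (unfold eps; field; lra). unfold K. nra.
- unfold side. assert (P : 4 ^ n * ((/2) ^ n * (/2) ^ n) = 1).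
  { rewrite <- !Rpow_mult_distr. replace (4 * (/ 2 * / 2)) with 1 by field. apply pow1. }
  transitivity (2 * (W + H) * (W + H) * eps * (4 ^ n * ((/2) ^ n * (/2) ^ n))); [rewrite P|]; ring.
Qed.

End Goursat.

(** * Cauchy's formula for the derivative *)

Definition holo_at f z : Prop := exists l, Cderiv f z l.

Lemma holo_at_continuous f z : holo_at f z -> continuous f z.
Proof. intros [l Hl]. apply Cderiv_continuous with l, Hl. Qed.

Lemma holo_at_C_derive f z : holo_at f z -> Cderiv f z (C_derive f z).
Proof. intros [l Hl]. rewrite (C_derive_eq _ _ _ Hl). exact Hl. Qed.

Lemma Cexp_periodic (x : R) : Cexp (x, 0 + 2 * PI) = Cexp (x, 0).
Proof.
unfold Cexp, Re, Im; simpl. rewrite Rplus_0_l, cos_2PI, sin_2PI, cos_0, sin_0. reflexivity.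
Qed.

Lemma Cexp_opp_periodic (x : R) : Cexp (- (x, (0 + 2 * PI)%R)) = Cexp (- (x, 0)).
Proof.
unfold Cexp, Re, Im; simpl. rewrite Rplus_0_l, cos_neg, sin_neg, cos_2PI, sin_2PI, Ropp_0, cos_0, sin_0.
reflexivity.
Qed.

Lemma Ci_sqr : (Ci * Ci)%C = (- (1))%C.
Proof. unfold Ci, Cmult, Copp, RtoC; simpl; f_equal; ring. Qed.

Section Cauchy.
Variables (f : C -> C) (z l : C) (rho : R).
Hypothesis Hf : forall w, Cmod (w - z) < rho -> holo_at f w.
Hypothesis Hl : Cderiv f z l.

(** In the variable w = log of the distance vector from [z], circles become vertical segments and
    Goursat on rectangles suffices. The factor [1 *] gives the argument of [f] the shape required of
    parameter integrals. *)
Let g (w : C) : C := (Cexp (- w) * f (Cexp w + 1 * z))%C.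

Lemma g_holo w : exp (Re w) < rho -> exists l, Cderiv g w l.
Proof.
intros Hw. destruct (Hf (Cexp w + 1 * z)) as [m Hm].
{ replace (Cexp w + 1 * z - z)%C with (Cexp w) by ring. rewrite Cmod_Cexp. exact Hw. }
eexists. apply Cderiv_mult.
- apply (Cderiv_comp Cexp (fun w => (- w)%C)); [apply Cderiv_Cexp|apply Cderiv_opp, Cderiv_id].
- apply (Cderiv_comp f (fun w => (Cexp w + 1 * z)%C)); [exact Hm|].
  apply Cderiv_plus; [apply Cderiv_Cexp|apply Cderiv_const].
Qed.

(* [g w] is [f (z + e^w) e^(-w)]: by periodicity the horizontal sides of a rectangle of height
   [2 * PI] cancel, so Goursat's lemma compares circles around [z] of different radii. *)
Lemma circle_independent x y : x <= y -> exp y < rho ->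
  CInt (fun t => g (x, t)) 0 (2 * PI) = CInt (fun t => g (y, t)) 0 (2 * PI).
Proof.
intros Hxy Hy. assert (HPI := PI_RGT_0).
assert (E := rectangle_integral_zero g x 0 (y - x) (2 * PI) ltac:(lra) ltac:(lra)).
assert (E0 : rectangle_integral g x 0 (y - x) (2 * PI) = 0).
{ apply E. intros s t Hs _. apply g_holo. simpl.
  apply Rle_lt_trans with (2 := Hy). destruct (Rle_lt_or_eq_dec s y) as [h|h]; [lra| |].
  - left. apply exp_increasing, h.
  - rewrite h. lra. }
unfold rectangle_integral in E0.
assert (H : horizontal_side g (0 + 2 * PI) x (y - x) = horizontal_side g 0 x (y - x)).
{ apply CInt_ext; [lra|]. intros t _. unfold g. rewrite Cexp_periodic, Cexp_opp_periodic. reflexivity. }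
rewrite H in E0. unfold vertical_side in E0. rewrite Rplus_0_l in E0.
replace (x + (y - x)) with y in E0 by ring.
apply Ceq_minus.
transitivity (Ci * (0 - ((horizontal_side g 0 x (y - x) + Ci * CInt (fun t => g (y, t)) 0 (2 * PI) -
      horizontal_side g 0 x (y - x) - Ci * CInt (fun t => g (x, t)) 0 (2 * PI)))) * -(1))%C.
2:{ rewrite E0. ring. }
transitivity (- (Ci * Ci) * (CInt (fun t => g (x, t)) 0 (2 * PI) - CInt (fun t => g (y, t)) 0 (2 * PI)))%C.
- rewrite Ci_sqr. ring.
- ring.
Qed.

Lemma CInt_Cexp_opp x : CInt (fun t => Cexp (- (x, t))) 0 (2 * PI) = RtoC 0.
Proof.
assert (HPI := PI_RGT_0).
assert (HD : forall t, Cpath_derive (fun s => Cexp (- (x, s))) t (Cexp (- (x, t)) * (- (1) * Ci))%C).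
{ intros t. apply (path_comp Cexp (fun s => (- (x, s))%C)); [apply Cderiv_Cexp|].
  apply (path_comp (fun w => (- w)%C)); [apply Cderiv_opp, Cderiv_id|apply path_vertical]. }
rewrite (CInt_derive 0 (2 * PI) ltac:(lra) (fun t => (Ci * Cexp (- (x, t)))%C)).
- rewrite <- (Rplus_0_l (2 * PI)), Cexp_opp_periodic. as_Ceq; ring.
- intros t _. apply (ex_derive_continuous (K := R_AbsRing) (V := C_R_NormedModule)). eexists. apply HD.
- intros t _. replace (Cexp (- (x, t))) with (Ci * (Cexp (- (x, t)) * (- (1) * Ci)))%C.
  + apply path_scal, HD.
  + transitivity (- (Ci * Ci) * Cexp (- (x, t)))%C; [ring|]. rewrite Ci_sqr. ring.
Qed.

(** As the radius does not matter, the circle may be shrunk to where f(z + h) = f(z) + l h up to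
    [eps] |h|. Against e^(-w) the constant term integrates to 0, the linear one to 2 pi l, and the
    error is at most 2 pi [eps]. *)
Lemma cauchy_derivative x : exp x < rho ->
  CInt (fun t => (Cexp (- (x, t)) * f (Cexp (x, t) + 1 * z))%C) 0 (2 * PI) = (RtoC (2 * PI) * l)%C.
Proof.
intros Hx. assert (HPI := PI_RGT_0).
apply Ceq_minus, Cmod_eq_0. apply Rle_antisym; [|apply Cmod_ge_0].
apply le_epsilon. intros eps0 Heps0. rewrite Rplus_0_l.
set (eps := eps0 / (2 * PI)). assert (Heps : 0 < eps) by (apply Rdiv_lt_0_compat; lra).
destruct (proj1 (Cderiv_eps _ _ _) Hl eps Heps) as [d [Hd Hdd]].
set (y := Rmin x (ln d - 1)).
assert (Hyx : y <= x) by apply Rmin_l.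
assert (Hyd : exp y < d).
{ rewrite <- (exp_ln d Hd) at 1. apply exp_increasing.
  assert (A := Rmin_r x (ln d - 1)). fold y in A. lra. }
change (CInt (fun t => (Cexp (- (x, t)) * f (Cexp (x, t) + 1 * z))%C) 0 (2 * PI))
  with (CInt (fun t => g (x, t)) 0 (2 * PI)).
rewrite <- (circle_independent y x Hyx Hx).
assert (Cg : forall t, continuous (fun t => g (y, t)) t).
{ intros t. apply continuous_vertical, holo_at_continuous, g_holo. simpl.
  destruct (Rle_lt_or_eq_dec y x Hyx) as [h| ->]; [|exact Hx].
  apply Rlt_trans with (2 := Hx), exp_increasing, h. }
assert (Ce : forall t, continuous (fun t => Cexp (- (y, t))) t).
{ intros t. apply (continuous_vertical (fun w => Cexp (- w))).
  apply holo_at_continuous. eexists.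
  apply (Cderiv_comp Cexp (fun w => (- w)%C)); [apply Cderiv_Cexp|apply Cderiv_opp, Cderiv_id]. }
replace (CInt (fun t => g (y, t)) 0 (2 * PI) - RtoC (2 * PI) * l)%C with
  (CInt (fun t => (g (y, t) - f z * Cexp (- (y, t)) - l)%C) 0 (2 * PI)).
2:{ assert (H0 : 0 <= 2 * PI) by lra.
    assert (C1 : forall t, continuous (fun t => (f z * Cexp (- (y, t)))%C) t).
    { intros t. apply continuous_Cmult; [apply continuous_const|apply Ce]. }
    assert (C2 : forall t, continuous (fun t => (g (y, t) - f z * Cexp (- (y, t)))%C) t).
    { intros t. apply continuous_Cminus; [apply Cg|apply C1]. }
    assert (E1 : CInt (fun t => (g (y, t) - f z * Cexp (- (y, t)) - l)%C) 0 (2 * PI) =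
      (CInt (fun t => (g (y, t) - f z * Cexp (- (y, t)))%C) 0 (2 * PI) - CInt (fun _ => l) 0 (2 * PI))%C).
    { exact (CInt_minus 0 (2 * PI) H0 _ _ (fun t _ => C2 t) (fun t _ => continuous_const l t)). }
    assert (E2 : CInt (fun t => (g (y, t) - f z * Cexp (- (y, t)))%C) 0 (2 * PI) =
      (CInt (fun t => g (y, t)) 0 (2 * PI) - CInt (fun t => (f z * Cexp (- (y, t)))%C) 0 (2 * PI))%C).
    { exact (CInt_minus 0 (2 * PI) H0 _ _ (fun t _ => Cg t) (fun t _ => C1 t)). }
    assert (E3 : CInt (fun t => (f z * Cexp (- (y, t)))%C) 0 (2 * PI) =
      (f z * CInt (fun t => Cexp (- (y, t))) 0 (2 * PI))%C).
    { exact (CInt_scal 0 (2 * PI) H0 (f z) _ (fun t _ => Ce t)). }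
    rewrite CInt_Cexp_opp in E3. rewrite E3 in E2. rewrite E2, CInt_const in E1.
    rewrite E1, Rminus_0_r. as_Ceq; ring. }
replace eps0 with ((2 * PI - 0) * eps) by (unfold eps; field; lra).
apply CInt_bound; [lra| |].
- intros t _. apply continuous_Cminus; [|apply continuous_const].
  apply continuous_Cminus; [apply Cg|]. apply continuous_Cmult; [apply continuous_const|apply Ce].
- intros t _. set (w := (y, t) : C).
  assert (E := Cexp_opp w). unfold g. fold w.
  replace (Cexp (- w) * f (Cexp w + 1 * z) - f z * Cexp (- w) - l)%C with
    (Cexp (- w) * (f (Cexp w + 1 * z) - f z - l * Cexp w))%C.
  2:{ transitivity (Cexp (- w) * f (Cexp w + 1 * z) - f z * Cexp (- w) - l * (Cexp w * Cexp (- w)))%C; [ring|].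
      rewrite E. ring. }
  assert (B : Cmod (f (Cexp w + 1 * z) - f z - l * Cexp w) <= eps * Cmod (Cexp w)).
  { replace (Cexp w) with (Cexp w + 1 * z - z)%C at 2 3 by ring. apply Hdd.
    replace (Cexp w + 1 * z - z)%C with (Cexp w) by ring. rewrite Cmod_Cexp. exact Hyd. }
  rewrite Cmod_mult. apply Rle_trans with (Cmod (Cexp (- w)) * (eps * Cmod (Cexp w))).
  + apply Rmult_le_compat_l; [apply Cmod_ge_0|exact B].
  + right. rewrite (Rmult_comm eps), <- Rmult_assoc, <- Cmod_mult, Cmult_comm, E, Cmod_1. ring.
Qed.

End Cauchy.

Lemma cauchy_kernel_continuous x t :
  continuous (fun t => Cexp (- (x, t))) t /\ continuous (fun t => Cexp (x, t)) t.
Proof.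
split.
- apply (continuous_vertical (fun w => Cexp (- w))).
  apply holo_at_continuous. eexists.
  apply (Cderiv_comp Cexp (fun w => (- w)%C)); [apply Cderiv_Cexp|apply Cderiv_opp, Cderiv_id].
- apply (continuous_vertical Cexp). apply holo_at_continuous. eexists. apply Cderiv_Cexp.
Qed.

(** One radius serves for all [z] near [z0], which turns f' into a parameter integral of f. The 3
    leaves room for the disk of radius [2 * rho] around each such [z]. *)
Lemma C_derive_near_formula f z0 rho : 0 < rho ->
  (forall w, Cmod (w - z0) < 3 * rho -> holo_at f w) ->
  forall z, Cmod (z - z0) < rho ->
   C_derive f z = (/ RtoC (2 * PI) *
     CInt (fun t => (Cexp (- (ln rho, t)) * f (Cexp (ln rho, t) + 1 * z))%C) 0 (2 * PI))%C.
Proof.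
intros Hr Hf z Hz. assert (HPI := PI_RGT_0).
assert (HP : RtoC (2 * PI) <> 0) by (intros E; apply RtoC_inj in E; lra).
rewrite (cauchy_derivative f z (C_derive f z) (2 * rho)).
- field. exact HP.
- intros w Hw. apply Hf. replace (w - z0)%C with ((w - z) + (z - z0))%C by ring.
  eapply Rle_lt_trans; [apply Cmod_triangle|]. lra.
- apply holo_at_C_derive, Hf. lra.
- rewrite exp_ln; lra.
Qed.

(** Continuity of f' comes before its differentiability, because differentiating the integral
    formula in [holo_C_derive] requires the kernel f to have a continuous derivative. *)
Lemma C_derive_continuous f z0 : locally z0 (fun w => holo_at f w) -> continuous (C_derive f) z0.
Proof.
intros H. apply locally_disk in H. destruct H as [d [Hd H]]. assert (HPI := PI_RGT_0).
set (rho := d / 3). assert (Hr : 0 < rho) by (unfold rho; lra).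
assert (HF := C_derive_near_formula f z0 rho Hr). 
apply continuous_ext_loc with (fun z => (/ RtoC (2 * PI) *
     CInt (fun t => (Cexp (- (ln rho, t)) * f (Cexp (ln rho, t) + 1 * z))%C) 0 (2 * PI))%C).
- apply locally_disk. exists rho. split; [exact Hr|]. intros w Hw. symmetry. apply HF; [|exact Hw].
  intros u Hu. apply H. unfold rho in Hu. lra.
- apply continuous_Cmult; [apply continuous_const|].
  apply (CInt_param_continuous 0 (2 * PI) ltac:(lra) (fun t => Cexp (- (ln rho, t)))
     (fun t => Cexp (ln rho, t)) (fun _ => RtoC 1)).
  + intros t _. apply cauchy_kernel_continuous.
  + intros t _. apply cauchy_kernel_continuous.
  + intros t _. apply continuous_const.
  + intros t _. apply locally_disk. exists rho. split; [exact Hr|]. intros w Hw.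
    apply holo_at_continuous, H.
    replace (w - z0)%C with ((w - (Cexp (ln rho, t) + 1 * z0)) + Cexp (ln rho, t))%C by ring.
    eapply Rle_lt_trans; [apply Cmod_triangle|]. rewrite Cmod_Cexp. simpl. rewrite exp_ln by exact Hr.
    unfold rho in *. lra.
Qed.

Lemma holo_C_derive f z0 : locally z0 (fun w => holo_at f w) -> holo_at (C_derive f) z0.
Proof.
intros H0. assert (H := H0). apply locally_disk in H. destruct H as [d [Hd H]]. assert (HPI := PI_RGT_0).
set (rho := d / 3). assert (Hr : 0 < rho) by (unfold rho; lra).
assert (HF := C_derive_near_formula f z0 rho Hr).
assert (Hin : forall t w, Cmod (w - (Cexp (ln rho, t) + 1 * z0)) < rho -> Cmod (w - z0) < d).
{ intros t w Hw.
  replace (w - z0)%C with ((w - (Cexp (ln rho, t) + 1 * z0)) + Cexp (ln rho, t))%C by ring.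
  eapply Rle_lt_trans; [apply Cmod_triangle|]. rewrite Cmod_Cexp. simpl. rewrite exp_ln by exact Hr.
  unfold rho in *. lra. }
eexists.
apply Cderiv_ext_loc with (fun z => (/ RtoC (2 * PI) *
     CInt (fun t => (Cexp (- (ln rho, t)) * f (Cexp (ln rho, t) + 1 * z))%C) 0 (2 * PI))%C).
- apply locally_disk. exists rho. split; [exact Hr|]. intros w Hw. symmetry. apply HF; [|exact Hw].
  intros u Hu. apply H. unfold rho in Hu. lra.
- apply Cderiv_scal.
  apply (CInt_param_derive 0 (2 * PI) ltac:(lra) (fun t => Cexp (- (ln rho, t)))
     (fun t => Cexp (ln rho, t)) (fun _ => RtoC 1)) with (k' := C_derive f).
  + intros t _. apply cauchy_kernel_continuous.
  + intros t _. apply cauchy_kernel_continuous.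
  + intros t _. apply continuous_const.
  + intros t _. apply locally_disk. exists rho. split; [exact Hr|]. intros w Hw.
    apply holo_at_continuous, H, (Hin t), Hw.
  + intros t _. apply locally_disk. exists rho. split; [exact Hr|]. intros w Hw.
    apply holo_at_C_derive, H, (Hin t), Hw.
  + intros t _. apply C_derive_continuous. apply locally_disk. exists rho. split; [exact Hr|]. intros w Hw.
    apply H, (Hin t), Hw.
Qed.

(** * Compactness *)

Lemma cluster_point (u : nat -> C) (M : R) : (forall n, Cmod (u n) <= M) ->
  exists z, forall eps N, 0 < eps -> exists n, (N <= n)%nat /\ Cmod (u n - z) < eps.
Proof.
intros HM.
assert (HR : forall n, - M <= Re (u n) <= M).
{ intros n. apply Rabs_le_between. apply Rle_trans with (2 := HM n), re_le_Cmod. }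
assert (HI : forall n, - M <= Im (u n) <= M).
{ intros n. apply Rabs_le_between. apply Rle_trans with (2 := HM n).
  apply (Rle_trans _ _ _ (Rmax_r _ _) (Rmax_Cmod (u n))). }
assert (near : forall x (v : nat -> R), ValAdh v x -> forall eps N, 0 < eps ->
   exists n, (N <= n)%nat /\ Rabs (v n - x) < eps).
{ intros x v H eps N Heps. apply (H (fun y => Rabs (y - x) < eps)).
  exists (mkposreal _ Heps). intros y Hy. exact Hy. }
destruct (Bolzano_Weierstrass (fun n => Re (u n)) (fun x => - M <= x <= M)) as [x Hx];
  [apply compact_P3|exact HR|].
(* The real parts converge along [phi]. That [phi n >= n] is enough, without monotonicity, since a
   cluster point only asks for closeness at arbitrarily late indices. *)
assert (Hs : forall n : nat, exists m, (n <= m)%nat /\ Rabs (Re (u m) - x) < / (INR n + 1)).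
{ intros n. apply (near x (fun n => Re (u n)) Hx). apply Rinv_0_lt_compat. generalize (pos_INR n). lra. }
destruct (choice _ Hs) as [phi Hphi].
destruct (Bolzano_Weierstrass (fun n => Im (u (phi n))) (fun x => - M <= x <= M)) as [y Hy];
  [apply compact_P3|intros n; apply HI|].
exists (x, y). intros eps N Heps.
destruct (archimed_cor1 (eps / 2)) as [K [HK HK0]]; [lra|].
destruct (near y _ Hy (eps / 2) (Nat.max N K) ltac:(lra)) as [n [Hn Hny]].
exists (phi n). destruct (Hphi n) as [H1 H2]. split; [lia|].
assert (H3 : / (INR n + 1) < eps / 2).
{ apply Rle_lt_trans with (2 := HK). apply Rinv_le_contravar; [apply lt_0_INR, HK0|].
  apply Rle_trans with (INR n); [apply le_INR; lia|lra]. }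
replace (u (phi n) - (x, y))%C with (RtoC (Re (u (phi n)) - x) + Ci * RtoC (Im (u (phi n)) - y))%C
  by (apply injective_projections; unfold Re, Im; simpl; ring).
eapply Rle_lt_trans; [apply Cmod_triangle|].
rewrite Cmod_mult, Cmod_Ci, !Cmod_R. lra.
Qed.

Lemma maximum_on_disk (F : C -> R) c r : 0 <= r ->
  (forall z, Cmod (z - c) <= r -> continuous F z) ->
  exists z, Cmod (z - c) <= r /\ forall w, Cmod (w - c) <= r -> F w <= F z.
Proof.
intros Hr HF.
(* Used twice: a sequence with values tending to infinity would have a finite cluster value, and a
   maximizing sequence clusters at a maximum. *)
assert (step : forall v : nat -> C, (forall n, Cmod (v n - c) <= r) ->
   exists z, Cmod (z - c) <= r /\ forall eps N, 0 < eps -> exists n, (N <= n)%nat /\ Rabs (F (v n) - F z) < eps).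
{ intros v Hv. destruct (cluster_point v (r + Cmod c)) as [z Hz].
  - intros n. replace (v n) with ((v n - c) + c)%C by ring.
    eapply Rle_trans; [apply Cmod_triangle|]. generalize (Hv n). lra.
  - assert (Hzr : Cmod (z - c) <= r).
    { apply le_epsilon. intros e He. destruct (Hz e O He) as [n [_ Hn]].
      replace (z - c)%C with (- (v n - z) + (v n - c))%C by ring.
      eapply Rle_trans; [apply Cmod_triangle|]. rewrite Cmod_opp. generalize (Hv n). lra. }
    exists z. split; [exact Hzr|]. intros eps N Heps.
    assert (HL : locally z (fun w => Rabs (F w - F z) < eps)).
    { apply (HF z Hzr (fun y => Rabs (y - F z) < eps)). exists (mkposreal _ Heps). intros y Hy; exact Hy. }
    apply locally_disk in HL. destruct HL as [d [Hd HL]].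
    destruct (Hz d N Hd) as [n [Hn Hnd]]. exists n. split; [exact Hn|]. apply HL, Hnd. }
assert (Hbound : exists M, forall w, Cmod (w - c) <= r -> F w <= M).
{ apply NNPP. intros Hn.
  assert (Hv : forall n : nat, exists w, Cmod (w - c) <= r /\ INR n < F w).
  { intros n. apply NNPP. intros H. apply Hn. exists (INR n). intros w Hw. apply Rnot_lt_le. intros H'.
    apply H. exists w. split; assumption. }
  destruct (choice _ Hv) as [v Hvv].
  destruct (step v) as [z [Hz Hc]]; [intros n; apply Hvv|].
  destruct (INR_archimed 1 (F z + 1)) as [N HN]; [lra|].
  destruct (Hc 1 N ltac:(lra)) as [n [Hn1 Hn2]]. apply Rabs_def2 in Hn2.
  assert (A := proj2 (Hvv n)). apply le_INR in Hn1. lra. }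
destruct Hbound as [M0 HM0].
destruct (completeness (fun y => exists w, Cmod (w - c) <= r /\ y = F w)) as [M [Hub Hlub]].
- exists M0. intros y [w [Hw ->]]. apply HM0, Hw.
- exists (F c), c. split; [|reflexivity]. replace (c - c)%C with (RtoC 0) by ring. rewrite Cmod_0. exact Hr.
- assert (Hv : forall n : nat, exists w, Cmod (w - c) <= r /\ M - / (INR n + 1) < F w).
  { intros n. apply NNPP. intros H.
    assert (P : 0 < / (INR n + 1)) by (apply Rinv_0_lt_compat; generalize (pos_INR n); lra).
    assert (M <= M - / (INR n + 1)); [|lra].
    apply Hlub. intros y [w [Hw ->]]. apply Rnot_lt_le. intros H'. apply H. exists w. split; assumption. }
  destruct (choice _ Hv) as [v Hvv].
  destruct (step v) as [z [Hz Hc]]; [intros n; apply Hvv|].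
  exists z. split; [exact Hz|].
  assert (HMz : M <= F z).
  { apply le_epsilon. intros e He. destruct (archimed_cor1 (e / 2)) as [K [HK HK0]]; [lra|].
    destruct (Hc (e / 2) K ltac:(lra)) as [n [Hn1 Hn2]]. apply Rabs_def2 in Hn2.
    assert (A := proj2 (Hvv n)).
    assert (H3 : / (INR n + 1) <= / INR K).
    { apply Rinv_le_contravar; [apply lt_0_INR, HK0|]. apply le_INR in Hn1. lra. }
    lra. }
  intros w Hw. apply Rle_trans with (2 := HMz). apply Hub. exists w. split; [exact Hw|reflexivity].
Qed.

Implicit Types z w u v : C.

(** * Schwarz's lemma and Jack's lemma *)

Lemma Cmod_sqr_plus (a b : C) :
  Cmod (a + b) ^ 2 = Cmod a ^ 2 + 2 * Re (Cconj a * b) + Cmod b ^ 2.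
Proof. rewrite !Cmod2_alt. unfold Re, Im, Cconj; simpl. ring. Qed.

Lemma RtoC_neq_0 (r : R) : r <> 0 -> RtoC r <> 0.
Proof. intros H E. apply H, RtoC_inj, E. Qed.

Section Schwarz.
Variables (om : C -> C) (r : R).
Hypothesis Hhol : forall z, Cmod z < r -> holo_at om z.
Hypothesis Hle : forall z, Cmod z < r -> Cmod (om z) <= 1.
Hypothesis Hom0 : om 0 = 0.

Let phi (z : C) : C := if Ceq_dec z 0 then C_derive om 0 else (om z / z)%C.

Lemma phi_mult z : om z = (phi z * z)%C.
Proof.
unfold phi. destruct (Ceq_dec z 0) as [->|n]; [rewrite Hom0; ring|]. field. exact n.
Qed.

Lemma phi_holo z : z <> 0 -> Cmod z < r -> holo_at phi z.
Proof.
intros Hz Hr. destruct (Hhol z Hr) as [l Hl]. eexists.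
apply Cderiv_ext_loc with (fun w => (om w * / w)%C).
- apply locally_disk. exists (Cmod z). split; [apply Cmod_gt_0, Hz|].
  intros w Hw. unfold phi. destruct (Ceq_dec w 0) as [->|n]; [|reflexivity].
  replace (0 - z)%C with (- z)%C in Hw by ring. rewrite Cmod_opp in Hw. lra.
- apply Cderiv_mult; [exact Hl|]. apply (Cderiv_inv (fun w => w)); [exact Hz|apply Cderiv_id].
Qed.

Lemma phi_continuous z : Cmod z < r -> continuous phi z.
Proof.
intros Hr. destruct (Ceq_dec z 0) as [->|n]; [|apply holo_at_continuous, phi_holo; assumption].
generalize (holo_at_C_derive om _ (Hhol _ Hr)). unfold Cderiv. apply continuous_ext.
intros w. unfold phi. destruct (Ceq_dec w 0); [reflexivity|]. rewrite Hom0. f_equal; ring.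
Qed.

(** The mean value property, obtained although [phi] is only known to be continuous at 0: there the
    formula for [om] is used, elsewhere the one for a product with the factor [w - z]. The linear
    term has mean 0; it is included so that the perturbation [eps] |z|^2 of the maximum principle is
    handled by the same integral. *)
Lemma phi_mean (A B z : C) (d : R) : 0 < d -> Cmod z + d < r -> exists x, exp x <= d /\
  (forall t, continuous (fun t => (A * phi (Cexp (x, t) + 1 * z) + B * z * Cexp (x, t))%C) t) /\
  CInt (fun t => (A * phi (Cexp (x, t) + 1 * z) + B * z * Cexp (x, t))%C) 0 (2 * PI) =
   (RtoC (2 * PI) * (A * phi z))%C.
Proof.
intros Hd Hr. assert (HPI := PI_RGT_0).
assert (Hx : exists x, exp x <= d /\ (z <> 0 -> exp x < Cmod z)).
{ destruct (Ceq_dec z 0) as [->|n].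
  - exists (ln d). rewrite exp_ln by exact Hd. split; [lra|congruence].
  - assert (P := proj1 (Cmod_gt_0 _) n). exists (ln (Rmin d (Cmod z / 2))).
    assert (Q : 0 < Rmin d (Cmod z / 2)) by (apply Rmin_glb_lt; lra).
    rewrite exp_ln by exact Q. split; [apply Rmin_l|]. intros _.
    apply Rle_lt_trans with (1 := Rmin_r _ _). lra. }
destruct Hx as [x [Hxd Hxz]]. exists x. split; [exact Hxd|]. split.
- intros t. destruct (cauchy_kernel_continuous x t) as [_ Ck].
  apply continuous_Cplus; apply continuous_Cmult; try apply continuous_const; [|exact Ck].
  apply (continuous_comp (fun t => (Cexp (x, t) + 1 * z)%C) phi).
  + apply continuous_Cplus; [exact Ck|apply continuous_const].
  + apply phi_continuous. eapply Rle_lt_trans; [apply Cmod_triangle|].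
    rewrite Cmult_1_l, Cmod_Cexp. simpl. lra.
- destruct (Ceq_dec z 0) as [Ez|n].
  + subst z. rewrite Cmod_0 in Hr.
    rewrite <- (cauchy_derivative (fun w => (A * om w)%C) 0 (A * phi 0) r) with (x := x).
    * apply CInt_ext; [lra|]. intros t _.
      assert (E := Cexp_opp (x, t)). set (e := Cexp (x, t)) in *. set (e' := Cexp (- (x, t))) in *.
      replace (e + 1 * 0)%C with e by ring. rewrite (phi_mult e).
      transitivity (A * phi e * (e * e'))%C; [rewrite E|]; ring.
    * intros w Hw. destruct (Hhol w) as [l Hl]; [replace w with (w - 0)%C by ring; exact Hw|].
      eexists. apply Cderiv_scal, Hl.
    * apply Cderiv_scal. unfold phi. destruct (Ceq_dec 0 0) as [_|n]; [|congruence].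
      apply holo_at_C_derive, Hhol. rewrite Cmod_0. lra.
    * lra.
  + specialize (Hxz n).
    assert (Hin : forall w, Cmod (w - z) < Rmin (Cmod z) (r - Cmod z) -> w <> 0 /\ Cmod w < r).
    { intros w Hw. split.
      - intros E. subst w. replace (0 - z)%C with (- z)%C in Hw by ring. rewrite Cmod_opp in Hw.
        generalize (Rmin_l (Cmod z) (r - Cmod z)). lra.
      - replace w with ((w - z) + z)%C by ring. eapply Rle_lt_trans; [apply Cmod_triangle|].
        generalize (Rmin_r (Cmod z) (r - Cmod z)). lra. }
    assert (HF : forall w l, Cderiv phi w l -> Cderiv (fun w => ((w - z) * (A * phi w + B * z * (w - z)))%C) w
       ((1 - 0) * (A * phi w + B * z * (w - z)) + (w - z) * (A * l + B * z * (1 - 0)))%C).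
    { intros w l Hl. apply (Cderiv_mult (fun w => (w - z)%C) (fun w => (A * phi w + B * z * (w - z))%C)).
      - apply Cderiv_minus; [apply Cderiv_id|apply Cderiv_const].
      - apply (Cderiv_plus (fun w => (A * phi w)%C) (fun w => (B * z * (w - z))%C));
          [apply Cderiv_scal, Hl|].
        apply (Cderiv_scal (B * z) (fun w => (w - z)%C)). apply Cderiv_minus; [apply Cderiv_id|apply Cderiv_const]. }
    rewrite <- (cauchy_derivative (fun w => ((w - z) * (A * phi w + B * z * (w - z)))%C) z (A * phi z)
      (Rmin (Cmod z) (r - Cmod z))) with (x := x).
    * apply CInt_ext; [lra|]. intros t _.
      assert (E := Cexp_opp (x, t)). set (e := Cexp (x, t)) in *. set (e' := Cexp (- (x, t))) in *.
      replace (e + 1 * z - z)%C with e by ring.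
      transitivity (e * e' * (A * phi (e + 1 * z) + B * z * e))%C; [rewrite E|]; ring.
    * intros w Hw. destruct (Hin w Hw) as [H1 H2]. destruct (phi_holo w H1 H2) as [l Hl].
      eexists. apply HF, Hl.
    * destruct (phi_holo z n ltac:(lra)) as [l Hl].
      eapply Cderiv_eq; [apply HF, Hl|]. ring.
    * apply Rmin_glb_lt; lra.
Qed.

(* The term [eps * |z|^2] makes the function strictly subharmonic, so that its maximum over the closed
   disk is attained only on the boundary. *)
Lemma phi_bound_eps r1 eps : 0 < r1 < r -> 0 < eps -> forall z, Cmod z <= r1 ->
  Cmod (phi z) ^ 2 <= (/ r1) ^ 2 + eps * r1 ^ 2.
Proof.
intros Hr Heps z Hz. assert (HPI := PI_RGT_0).
destruct (maximum_on_disk (fun z => Cmod (phi z) ^ 2 + eps * Cmod z ^ 2) 0 r1) as [m [Hm Hmax]]; [lra| |].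
{ intros w Hw. replace (w - 0)%C with w in Hw by ring.
  assert (C1 : continuous (fun z => Cmod (phi z)) w) by (apply continuous_Cmod, phi_continuous; lra).
  assert (C2 : continuous (fun z : C => Cmod z) w) by (apply continuous_Cmod, continuous_id).
  simpl. apply (continuous_plus (V := R_NormedModule));
    repeat apply (continuous_mult (K := R_AbsRing)); try assumption; apply continuous_const. }
replace (m - 0)%C with m in Hm by ring.
assert (Hz' := Hmax z). replace (z - 0)%C with z in Hz' by ring. specialize (Hz' Hz). simpl in Hz'.
assert (P := Rmult_le_pos eps _ (Rlt_le _ _ Heps) (pow2_ge_0 (Cmod z))). simpl in P.
destruct (Rle_lt_or_eq_dec _ _ Hm) as [h|h].
- exfalso.
  (* These coefficients give twice the real part of conj(phi m) phi + [eps] conj(m) u. Total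
     division makes the second coefficient harmless at m = 0, where its product with [m] is 0 as
     wanted. *)
  destruct (phi_mean (2 * Cconj (phi m)) (RtoC (2 * eps) * Cconj m / m) m ((r1 - Cmod m) / 2)) as [x [Hx [Cx Ix]]]; [lra|lra|].
  set (e2 := exp x ^ 2). assert (He2 : 0 < e2) by (apply pow_lt, exp_pos).
  (* Maximality at [m] is combined with 2 Re (conj(a) b) <= |a|^2 + |b|^2. The expansion of |m +
     u|^2 leaves the deficit [eps] |u|^2, which contradicts the mean value. *)
  assert (Hpt : forall t, Re (2 * Cconj (phi m) * phi (Cexp (x, t) + 1 * m) +
      RtoC (2 * eps) * Cconj m / m * m * Cexp (x, t)) <= 2 * Cmod (phi m) ^ 2 - eps * e2).
  { intros t. set (u := Cexp (x, t)). set (w := (u + 1 * m)%C).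
    assert (Hu : Cmod u ^ 2 = e2) by (unfold u, e2; rewrite Cmod_Cexp; reflexivity).
    assert (Hw := Hmax w). replace (w - 0)%C with w in Hw by ring.
    assert (Hwr : Cmod w <= r1).
    { unfold w. eapply Rle_trans; [apply Cmod_triangle|]. rewrite Cmult_1_l. unfold u. rewrite Cmod_Cexp. simpl. lra. }
    specialize (Hw Hwr). simpl in Hw.
    assert (E1 := Cmod_sqr_plus m u). replace (m + u)%C with w in E1 by (unfold w; ring).
    assert (E2 := Cmod_sqr_plus (phi m) (- phi w)).
    assert (P2 := pow2_ge_0 (Cmod (phi m + - phi w))).
    assert (E3 : Re (2 * Cconj (phi m) * phi w + RtoC (2 * eps) * Cconj m / m * m * u) =
      2 * Re (Cconj (phi m) * phi w) + 2 * eps * Re (Cconj m * u)).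
    { replace (RtoC (2 * eps) * Cconj m / m * m * u)%C with (RtoC (2 * eps) * (Cconj m * u))%C.
      - unfold Re, Im, Cconj; simpl; ring.
      - destruct (Ceq_dec m 0) as [E|n]; [|field; exact n]. rewrite E.
        replace (Cconj 0) with (RtoC 0) by (unfold Cconj, RtoC; simpl; f_equal; ring). ring. }
    rewrite E3. rewrite Cmod_opp in E2.
    replace (Re (Cconj (phi m) * - phi w)) with (- Re (Cconj (phi m) * phi w)) in E2
      by (unfold Re, Im, Cconj; simpl; ring).
    simpl in *. nra. }
  assert (I2 : RInt (fun t => Re (2 * Cconj (phi m) * phi (Cexp (x, t) + 1 * m) +
      RtoC (2 * eps) * Cconj m / m * m * Cexp (x, t))) 0 (2 * PI) <= 2 * PI * (2 * Cmod (phi m) ^ 2 - eps * e2)).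
  { replace (2 * PI * (2 * Cmod (phi m) ^ 2 - eps * e2)) with (RInt (fun _ => 2 * Cmod (phi m) ^ 2 - eps * e2) 0 (2 * PI)).
    - apply RInt_le; [lra| | |intros t _; apply Hpt].
      + apply (ex_RInt_continuous (V := R_CompleteNormedModule)). intros t _. apply continuous_Re, Cx.
      + apply ex_RInt_const.
    - rewrite RInt_const. unfold scal; simpl; unfold mult; simpl. ring. }
  rewrite <- CInt_Re, Ix in I2; [|lra|intros t _; apply Cx].
  replace (Re (RtoC (2 * PI) * (2 * Cconj (phi m) * phi m))) with (2 * PI * (2 * Cmod (phi m) ^ 2)) in I2
    by (rewrite Cmod2_alt; unfold Re, Im, Cconj; simpl; ring).
  assert (0 < 2 * PI * (eps * e2)) by (apply Rmult_lt_0_compat; [lra|apply Rmult_lt_0_compat; assumption]). lra.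
- assert (Hphi : Cmod (phi m) <= / r1).
  { assert (E := f_equal Cmod (phi_mult m)). rewrite Cmod_mult, h in E.
    assert (L := Hle m ltac:(lra)). rewrite E in L.
    apply Rmult_le_reg_r with r1; [lra|]. rewrite Rinv_l by lra. exact L. }
  assert (Q := Cmod_ge_0 (phi m)). rewrite h in Hz'. simpl.
  assert (Cmod (phi m) * (Cmod (phi m) * 1) <= / r1 * (/ r1 * 1)) by nra. lra.
Qed.

Lemma schwarz z : Cmod z < r -> Cmod (om z) <= Cmod z / r.
Proof.
intros Hz. assert (P := Cmod_ge_0 z).
assert (H1 : forall r1, Cmod z < r1 < r -> Cmod (phi z) <= / r1).
{ intros r1 Hr1. assert (Hi : 0 < / r1) by (apply Rinv_0_lt_compat; lra).
  apply Rsqr_incr_0_var; [|lra]. unfold Rsqr. apply le_epsilon. intros e He.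
  assert (0 < r1 ^ 2) by (apply pow_lt; lra).
  assert (B := phi_bound_eps r1 (e / r1 ^ 2) ltac:(lra) ltac:(apply Rdiv_lt_0_compat; lra) z ltac:(lra)).
  replace (e / r1 ^ 2 * r1 ^ 2) with e in B by (field; lra). simpl in B. lra. }
assert (H2 : Cmod (phi z) * r <= 1).
{ assert (Q := Cmod_ge_0 (phi z)). apply Rnot_lt_le. intros H.
  destruct (Req_dec (Cmod (phi z)) 0) as [E|n]; [rewrite E in H; lra|].
  assert (Hpos : 0 < Cmod (phi z)) by lra.
  assert (Hinv : / Cmod (phi z) < r).
  { apply Rmult_lt_reg_l with (Cmod (phi z)); [exact Hpos|]. rewrite Rinv_r by lra. exact H. }
  (* If |phi z| > 1/r, a radius strictly between 1/|phi z| and r, and beyond |z|, contradicts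
     [H1]. *)
  set (r1 := (Rmax (Cmod z) (/ Cmod (phi z)) + r) / 2).
  assert (M1 := Rmax_l (Cmod z) (/ Cmod (phi z))). assert (M2 := Rmax_r (Cmod z) (/ Cmod (phi z))).
  assert (M3 : Rmax (Cmod z) (/ Cmod (phi z)) < r) by (apply Rmax_lub_lt; assumption).
  assert (B := H1 r1 ltac:(unfold r1; lra)).
  assert (L : / Cmod (phi z) < r1) by (unfold r1; lra).
  apply Rinv_lt_contravar in L; [rewrite Rinv_inv in L; lra|].
  apply Rmult_lt_0_compat; [apply Rinv_0_lt_compat, Hpos|unfold r1; lra]. }
rewrite (phi_mult z), Cmod_mult. apply Rmult_le_reg_r with r; [lra|].
replace (Cmod z / r * r) with (Cmod z) by (field; lra). nra.
Qed.

End Schwarz.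

(* Jack's lemma at a boundary point: comparing with [|z| / r] along all inward directions forces
   the logarithmic derivative to be real and at least 1. *)
Lemma jack (om : C -> C) r z0 l : 0 < r -> Cmod z0 = r ->
  (forall z, Cmod z < r -> Cmod (om z) <= Cmod z / r) ->
  Cderiv om z0 l -> Cmod (om z0) = 1 ->
  exists q : R, 1 <= q /\ (z0 * l = RtoC q * om z0)%C.
Proof.
intros Hr Hz0 Hle Hl Hom.
assert (Hom0 : om z0 <> 0) by (intros E; rewrite E, Cmod_0 in Hom; lra).
assert (Hz0n : z0 <> 0) by (intros E; rewrite E, Cmod_0 in Hz0; lra).
set (kappa := (z0 * l / om z0)%C).
(* Moving from [z0] to z0 (1 - s d) multiplies [om] by 1 - s d kappa to first order, while the bound
   |z|/r drops to |1 - s d|; comparing the terms of order s gives the inequality. *)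
assert (Hdir : forall d, 0 < Re d -> Re d <= Re (d * kappa)).
{ intros d Hd. apply le_epsilon. intros e He.
  assert (Hdn : 0 < Cmod d).
  { apply Rlt_le_trans with (1 := Hd). apply Rle_trans with (2 := re_le_Cmod d). apply Rle_abs. }
  assert (Hrd : 0 < 2 * (r * Cmod d)) by (apply Rmult_lt_0_compat; [lra|apply Rmult_lt_0_compat; lra]).
  destruct (proj1 (Cderiv_eps _ _ _) Hl (e / (2 * (r * Cmod d)))) as [dl [Hdl HD]].
  { apply Rdiv_lt_0_compat; lra. }
  assert (HD2 : 0 < Cmod d ^ 2) by (apply pow_lt, Hdn).
  (* The three bounds make the second-order term at most [s * e], put 1 - s d inside the unit disk,
     and keep the moved point where the derivative estimate holds. *)
  set (s := Rmin (Rmin (e / Cmod d ^ 2) (Re d / Cmod d ^ 2)) (dl / (2 * (r * Cmod d)))).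
  assert (Hs : 0 < s) by (repeat apply Rmin_glb_lt; apply Rdiv_lt_0_compat; lra).
  assert (Hs1 : s * Cmod d ^ 2 <= e).
  { replace e with (e / Cmod d ^ 2 * Cmod d ^ 2) by (field; lra). apply Rmult_le_compat_r; [lra|].
    eapply Rle_trans; [apply Rmin_l|apply Rmin_l]. }
  assert (Hs2 : s * Cmod d ^ 2 <= Re d).
  { replace (Re d) with (Re d / Cmod d ^ 2 * Cmod d ^ 2) by (field; lra). apply Rmult_le_compat_r; [lra|].
    eapply Rle_trans; [apply Rmin_l|apply Rmin_r]. }
  assert (Hs3 : s * (r * Cmod d) < dl).
  { apply Rle_lt_trans with (dl / (2 * (r * Cmod d)) * (r * Cmod d)).
    - apply Rmult_le_compat_r; [lra|apply Rmin_r].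
    - replace (dl / (2 * (r * Cmod d)) * (r * Cmod d)) with (dl / 2) by (field; split; lra). lra. }
  set (z := (z0 * (1 - RtoC s * d))%C).
  assert (Esq : Cmod (1 - RtoC s * d) ^ 2 = 1 - 2 * s * Re d + s ^ 2 * Cmod d ^ 2).
  { rewrite !Cmod2_alt. unfold Re, Im; simpl. ring. }
  assert (Hlt : Cmod (1 - RtoC s * d) < 1).
  { apply Rsqr_incrst_0; [|apply Cmod_ge_0|lra]. rewrite !Rsqr_pow2, Esq. nra. }
  assert (Hzr : Cmod z < r) by (unfold z; rewrite Cmod_mult, Hz0; nra).
  assert (B := Hle z Hzr).
  replace (Cmod z / r) with (Cmod (1 - RtoC s * d)) in B by (unfold z; rewrite Cmod_mult, Hz0; field; lra).
  assert (Ez : (z - z0 = - (RtoC s * (z0 * d)))%C) by (unfold z; ring).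
  assert (Ezm : Cmod (z - z0) = s * (r * Cmod d)).
  { rewrite Ez, Cmod_opp, !Cmod_mult, Cmod_R, Hz0, Rabs_pos_eq; lra. }
  specialize (HD z ltac:(lra)). rewrite Ezm in HD.
  replace (e / (2 * (r * Cmod d)) * (s * (r * Cmod d))) with (s * e / 2) in HD by (field; split; lra).
  set (err := (om z - om z0 - l * (z - z0))%C) in HD.
  assert (Eom : (om z / om z0 = 1 - RtoC s * (d * kappa) + err / om z0)%C).
  { unfold err, kappa. rewrite Ez. field. exact Hom0. }
  assert (B1 : Re (om z / om z0) <= Cmod (1 - RtoC s * d)).
  { apply Rle_trans with (2 := B). apply Rle_trans with (1 := Rle_abs _).
    apply Rle_trans with (1 := re_le_Cmod _). rewrite Cmod_div, Hom by exact Hom0. lra. }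
  assert (B2 : - (s * e / 2) <= Re (err / om z0)).
  { assert (T := re_le_Cmod (err / om z0)). rewrite Cmod_div, Hom in T by exact Hom0.
    apply Rabs_le_between in T. lra. }
  rewrite Eom in B1.
  replace (Re (1 - RtoC s * (d * kappa) + err / om z0)) with (1 - s * Re (d * kappa) + Re (err / om z0)) in B1
    by (unfold Re; simpl; ring).
  assert (B3 : Cmod (1 - RtoC s * d) <= 1 - s * Re d + s ^ 2 * Cmod d ^ 2 / 2).
  { assert (X := pow2_ge_0 (Cmod (1 - RtoC s * d) - 1)). nra. }
  assert (B4 : s * (Re d) <= s * (Re (d * kappa) + e)) by nra.
  apply Rmult_le_reg_l with s; lra. }
assert (Hkappa : (kappa * om z0)%C = (z0 * l)%C) by (unfold kappa; field; exact Hom0).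
clearbody kappa.
assert (HIm : Im kappa = 0).
{ destruct (Req_dec (Im kappa) 0) as [|n]; [assumption|]. exfalso.
  (* The direction is chosen to have real part 1 and a purely imaginary product with [kappa]. *)
  assert (X : 1 <= Re ((1, Re kappa / Im kappa) * kappa)).
  { apply (Hdir (1, Re kappa / Im kappa)). unfold Re; simpl; lra. }
  replace (Re ((1, Re kappa / Im kappa) * kappa)) with 0 in X; [lra|].
  unfold Re, Im in *; simpl. field. exact n. }
assert (HRe : 1 <= Re kappa).
{ rewrite <- (Cmult_1_l kappa). apply (Hdir 1). unfold Re; simpl; lra. }
exists (Re kappa). split; [exact HRe|].
replace (RtoC (Re kappa)) with kappa by (apply injective_projections; [reflexivity|exact HIm]).
symmetry. exact Hkappa.
Qed.

(** * Continuation and inverse functions *)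

(** If the supremum r of the good radii were below 1, points outside [Good] would accumulate on the
    closed disk of radius r, where every point is good and has a good neighbourhood. The boundary
    step thus only has to treat one point of one circle. *)
Lemma first_touch (Good : C -> Prop) :
  Good 0 -> (forall z, disk z -> Good z -> locally z Good) ->
  (forall r, 0 < r < 1 -> (forall z, Cmod z < r -> Good z) -> forall z, Cmod z = r -> Good z) ->
  forall z, disk z -> Good z.
Proof.
intros H0 Hopen Hstep.
destruct (completeness (fun r => 0 <= r <= 1 /\ forall z, Cmod z < r -> Good z)) as [r [Hub Hlub]].
- exists 1. intros r [Hr _]. lra.
- exists 0. split; [lra|]. intros z Hz. generalize (Cmod_ge_0 z). lra.
- assert (Hr0 : 0 <= r) by (apply Hub; split; [lra|]; intros z Hz; generalize (Cmod_ge_0 z); lra).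
  assert (Hr1 : r <= 1) by (apply Hlub; intros r' [Hr' _]; lra).
  assert (Hr : forall z, Cmod z < r -> Good z).
  { intros z Hz. apply NNPP. intros n.
    assert (r <= Cmod z); [|lra]. apply Hlub. intros r' [_ Hr']. apply Rnot_lt_le.
    intros h. apply n, Hr', h. }
  destruct (Rle_lt_or_eq_dec _ _ Hr1) as [h|h]; [|rewrite h in Hr; exact Hr]. exfalso.
  assert (Hcl : forall z, Cmod z <= r -> Good z).
  { intros z Hz. destruct (Rle_lt_or_eq_dec _ _ Hz) as [hz|hz]; [apply Hr, hz|].
    destruct (Rle_lt_or_eq_dec _ _ Hr0) as [h0|h0].
    - apply Hstep with r; [lra|exact Hr|exact hz].
    - rewrite <- h0 in hz. apply Cmod_eq_0 in hz. rewrite hz. exact H0. }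
  assert (Hbad : forall n : nat, exists z, Cmod z < Rmin 1 (r + / (INR n + 1)) /\ ~ Good z).
  { intros n. apply NNPP. intros H.
    assert (P : 0 < / (INR n + 1)) by (apply Rinv_0_lt_compat; generalize (pos_INR n); lra).
    assert (Q : r < Rmin 1 (r + / (INR n + 1))) by (apply Rmin_glb_lt; lra).
    assert (Rmin 1 (r + / (INR n + 1)) <= r); [|lra].
    apply Hub. split.
    - split; [lra|apply Rmin_l].
    - intros z Hz. apply NNPP. intros Hn. apply H. exists z. split; assumption. }
  destruct (choice _ Hbad) as [v Hv].
  destruct (cluster_point v 1) as [z Hz].
  { intros n. left. apply Rlt_le_trans with (1 := proj1 (Hv n)). apply Rmin_l. }
  assert (Hzr : Cmod z <= r).
  { apply le_epsilon. intros e He. destruct (archimed_cor1 (e / 2)) as [K [HK HK0]]; [lra|].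
    destruct (Hz (e / 2) K ltac:(lra)) as [n [Hn1 Hn2]].
    assert (H3 : / (INR n + 1) <= / INR K).
    { apply Rinv_le_contravar; [apply lt_0_INR, HK0|]. apply le_INR in Hn1. lra. }
    assert (A := Rlt_le_trans _ _ _ (proj1 (Hv n)) (Rmin_r _ _)).
    replace z with (- (v n - z) + v n)%C by ring.
    eapply Rle_trans; [apply Cmod_triangle|]. rewrite Cmod_opp. lra. }
  assert (HL : locally z Good) by (apply Hopen; [unfold disk; lra|apply Hcl, Hzr]).
  apply locally_disk in HL. destruct HL as [d [Hd HL]].
  destruct (Hz d O Hd) as [n [_ Hn]]. apply (proj2 (Hv n)), HL, Hn.
Qed.

(** The distance |k u - y| is minimized over a small closed disk. The minimum is interior because y
    is too close to k(u0), and it is 0 because otherwise a short Newton step would decrease it. *)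
Lemma open_mapping (k : C -> C) (u0 : C) :
  locally u0 (fun u => exists l : C, l <> 0 /\ Cderiv k u l) ->
  forall eps, 0 < eps -> exists eta, 0 < eta /\
    forall y, Cmod (y - k u0) < eta -> exists u, Cmod (u - u0) < eps /\ k u = y.
Proof.
intros Hk eps Heps.
destruct (locally_singleton _ _ Hk) as [a [Ha Hda]].
apply locally_disk in Hk. destruct Hk as [d0 [Hd0 Hk]].
assert (Pa := proj1 (Cmod_gt_0 _) Ha).
destruct (proj1 (Cderiv_eps _ _ _) Hda (Cmod a / 2) ltac:(lra)) as [d1 [Hd1 HD]].
set (e := Rmin eps (Rmin d0 d1) / 2).
assert (He : 0 < e) by (unfold e; apply Rdiv_lt_0_compat; [repeat apply Rmin_glb_lt; assumption|lra]).
assert (M1 := Rmin_l eps (Rmin d0 d1)). assert (M2 := Rmin_r eps (Rmin d0 d1)).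
assert (M3 := Rmin_l d0 d1). assert (M4 := Rmin_r d0 d1).
(* On the circle of radius [e] one has |k u - k u0| >= |a| e / 2, so a value within |a| e / 4 of
   k(u0) is closer to k(u0) than to the image of the circle. *)
exists (Cmod a * e / 4). split; [apply Rdiv_lt_0_compat; [apply Rmult_lt_0_compat|]; lra|].
intros y Hy.
destruct (maximum_on_disk (fun u => - Cmod (k u - y)) u0 e ltac:(lra)) as [u [Hu Hmax]].
{ intros w Hw. destruct (Hk w) as [l [_ Hl]]; [unfold e in Hw; lra|].
  apply (continuous_opp (V := R_NormedModule)), continuous_Cmod, continuous_Cminus;
    [apply Cderiv_continuous with l, Hl|apply continuous_const]. }
assert (Hmin0 : Cmod (k u - y) < Cmod a * e / 4).
{ assert (X := Hmax u0). replace (u0 - u0)%C with (RtoC 0) in X by ring. rewrite Cmod_0 in X.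
  specialize (X ltac:(lra)). replace (k u0 - y)%C with (- (y - k u0))%C in X by ring.
  rewrite Cmod_opp in X. lra. }
assert (Hint : Cmod (u - u0) < e).
{ destruct (Rle_lt_or_eq_dec _ _ Hu) as [h|h]; [exact h|]. exfalso.
  assert (B := HD u ltac:(unfold e in h; lra)). rewrite h in B.
  assert (T : Cmod (a * (u - u0)) <= Cmod (k u - y) + Cmod (y - k u0) + Cmod (k u - k u0 - a * (u - u0))).
  { assert (Eq : (a * (u - u0) = (k u - y) + (y - k u0) + - (k u - k u0 - a * (u - u0)))%C) by ring.
    apply (f_equal Cmod) in Eq. rewrite Eq.
    eapply Rle_trans; [apply Cmod_triangle|]. rewrite Cmod_opp. apply Rplus_le_compat_r, Cmod_triangle. }
  rewrite Cmod_mult, h in T. lra. }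
exists u. split; [unfold e in Hint; lra|].
apply Ceq_minus, NNPP. intros Hne. assert (Py := proj1 (Cmod_gt_0 _) Hne).
destruct (Hk u) as [l [Hl0 Hl]]; [unfold e in Hint; lra|].
assert (Pl := proj1 (Cmod_gt_0 _) Hl0).
destruct (proj1 (Cderiv_eps _ _ _) Hl (Cmod l / 2) ltac:(lra)) as [d2 [Hd2 HD2]].
set (A := Cmod (k u - y) / Cmod l). assert (HA : 0 < A) by (apply Rdiv_lt_0_compat; assumption).
set (t := Rmin (Rmin 1 (d2 / 2 / A)) ((e - Cmod (u - u0)) / A)).
assert (Ht : 0 < t).
{ repeat apply Rmin_glb_lt; try lra; apply Rdiv_lt_0_compat; lra. }
assert (Ht1 : t <= 1) by (eapply Rle_trans; [apply Rmin_l|apply Rmin_l]).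
assert (Ht2 : t * A <= d2 / 2).
{ replace (d2 / 2) with (d2 / 2 / A * A) by (field; lra). apply Rmult_le_compat_r; [lra|].
  eapply Rle_trans; [apply Rmin_l|apply Rmin_r]. }
assert (Ht3 : t * A <= e - Cmod (u - u0)).
{ replace (e - Cmod (u - u0)) with ((e - Cmod (u - u0)) / A * A) by (field; lra). apply Rmult_le_compat_r; [lra|].
  apply Rmin_r. }
(* A Newton step damped by [t]: the linear part shrinks k(u) - y by the factor 1 - t, and the
   remainder costs at most half of that gain. *)
set (h := (- (RtoC t * (k u - y) / l))%C).
assert (Hh : Cmod h = t * A).
{ unfold h, A. rewrite Cmod_opp, Cmod_div, Cmod_mult, Cmod_R, Rabs_pos_eq by (trivial; lra). field. lra. }
assert (Euh : (u + h - u)%C = h) by ring.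
assert (B := HD2 (u + h)%C). rewrite Euh, Hh in B. specialize (B ltac:(lra)).
assert (X := Hmax (u + h)%C).
assert (Hin : Cmod (u + h - u0) <= e).
{ replace (u + h - u0)%C with ((u - u0) + h)%C by ring. eapply Rle_trans; [apply Cmod_triangle|]. lra. }
specialize (X Hin).
assert (T : Cmod (k (u + h)%C - y) <= (1 - t) * Cmod (k u - y) + t * Cmod (k u - y) / 2).
{ replace (k (u + h)%C - y)%C with (RtoC (1 - t) * (k u - y) + (k (u + h)%C - k u - l * h))%C.
  - eapply Rle_trans; [apply Cmod_triangle|]. rewrite Cmod_mult, Cmod_R, Rabs_pos_eq by lra.
    apply Rplus_le_compat_l. apply Rle_trans with (1 := B). right. unfold A. field. lra.
  - unfold h. rewrite RtoC_minus. field. exact Hl0. }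
assert (0 < t * Cmod (k u - y)) by (apply Rmult_lt_0_compat; assumption). lra.
Qed.

Section Inverse.
Variables (S : C -> Prop) (k k' : C -> C).
Hypothesis Sopen : forall u, S u -> locally u S.
Hypothesis Hk : forall u, S u -> Cderiv k u (k' u).
Hypothesis Hk0 : forall u, S u -> k' u <> 0.
Hypothesis Hinj : forall u v, S u -> S v -> k u = k v -> u = v.
Variables (P U : C -> C).
Hypothesis HU : forall z, (exists u, S u /\ P z = k u) -> S (U z) /\ P z = k (U z).

(** Injectivity on [S] forces the value of [U] wherever [P] meets the image of [S], so a pointwise
    choice needs no tracking of branches. *)
Lemma inverse_value z u : S u -> P z = k u -> U z = u.
Proof.
intros Hu E. destruct (HU z) as [H1 H2]; [exists u; split; assumption|].
apply Hinj; trivial. congruence.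
Qed.

Lemma inverse_near z0 u0 : S u0 -> P z0 = k u0 -> continuous P z0 ->
  forall eps, 0 < eps -> locally z0 (fun z => S (U z) /\ P z = k (U z) /\ Cmod (U z - u0) < eps).
Proof.
intros Hu0 E HP eps Heps.
destruct (proj1 (locally_disk _ _) (Sopen u0 Hu0)) as [d [Hd HS]].
destruct (open_mapping k u0) with (eps := Rmin eps d) as [eta [Heta Ho]].
- generalize (Sopen u0 Hu0). apply filter_imp. intros u Hu. exists (k' u). split; [apply Hk0|apply Hk]; exact Hu.
- apply Rmin_glb_lt; assumption.
- apply continuous_Cmod_iff with (eps := eta) in HP; [|exact Heta].
  generalize HP. apply filter_imp. intros z Hz. rewrite E in Hz.
  destruct (Ho _ Hz) as [u [Hu Eu]].
  assert (Su : S u) by (apply HS; apply Rlt_le_trans with (1 := Hu), Rmin_r).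
  rewrite (inverse_value z u) by (trivial; symmetry; exact Eu).
  split; [exact Su|]. split; [symmetry; exact Eu|]. apply Rlt_le_trans with (1 := Hu), Rmin_l.
Qed.

(** With the factors [a] of [k] at [u0] and [b] of [P] at [z0], a(U z) (U z - u0) = b(z) (z - z0)
    near [z0]; hence b / (a o U) is the factor of [U], continuous once [U] is. *)
Lemma inverse_derive z0 u0 m : S u0 -> P z0 = k u0 -> Cderiv P z0 m -> Cderiv U z0 (m / k' u0).
Proof.
intros Hu0 E HP.
assert (HPc := Cderiv_continuous _ _ _ HP).
assert (EU := inverse_value z0 u0 Hu0 E).
assert (HUc : continuous U z0).
{ apply continuous_Cmod_iff. intros eps Heps. generalize (inverse_near z0 u0 Hu0 E HPc eps Heps).
  apply filter_imp. intros z [_ [_ H]]. rewrite EU. exact H. }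
destruct (Cderiv_factor _ _ _ (Hk u0 Hu0)) as [a [Ha [Ha0 Hea]]].
destruct (Cderiv_factor _ _ _ HP) as [b [Hb [Hb0 Heb]]].
assert (HaU : continuous (fun z => a (U z)) z0).
{ apply (continuous_comp U a); [exact HUc|rewrite EU; exact Ha]. }
assert (HaU0 : a (U z0) <> 0) by (rewrite EU, Ha0; apply Hk0, Hu0).
apply factor_Cderiv with (fun z => (b z / a (U z))%C).
- apply continuous_Cdiv; assumption.
- rewrite EU. congruence.
- assert (Hn : locally z0 (fun z => a (U z) <> 0)).
  { apply continuous_Cmod_iff with (eps := Cmod (a (U z0))) in HaU; [|apply Cmod_gt_0, HaU0].
    generalize HaU. apply filter_imp. intros w Hw E'. rewrite E' in Hw.
    replace (0 - a (U z0))%C with (- a (U z0))%C in Hw by ring. rewrite Cmod_opp in Hw. lra. }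
  generalize (filter_and _ _ Hn (inverse_near z0 u0 Hu0 E HPc 1 Rlt_0_1)).
  apply filter_imp. intros z [Hz [_ [E2 _]]]. change C in (type of z).
  assert (E3 : (a (U z) * (U z - u0) = b z * (z - z0))%C).
  { assert (E4 := Hea (U z)). rewrite <- E2, <- E, (Heb z) in E4.
    transitivity (P z0 + a (U z) * (U z - u0) - P z0)%C; [ring|]. rewrite <- E4. ring. }
  rewrite EU.
  replace (b z / a (U z) * (z - z0))%C with (b z * (z - z0) / a (U z))%C by (field; exact Hz).
  rewrite <- E3. as_Ceq. field. exact Hz.
Qed.

End Inverse.

(** * The logarithm on the right half-plane *)

Definition strip (l : C) : Prop := - (PI / 2) < Im l < PI / 2.

Lemma RHP_neq_0 u : 0 < Re u -> u <> 0.
Proof. intros H E. rewrite E in H. unfold Re in H; simpl in H; lra. Qed.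

Lemma acos_lt_PI2 x : 0 < x <= 1 -> 0 <= acos x < PI / 2.
Proof.
intros Hx. split; [apply acos_bound|]. apply Rnot_le_lt. intros H.
assert (B := acos_bound x). assert (HPI := PI_RGT_0).
assert (E := cos_acos x ltac:(lra)).
assert (cos (acos x) <= 0) by (apply cos_le_0; lra). lra.
Qed.

Lemma strip_Clog u : 0 < Re u -> strip (Clog u).
Proof.
intros Hu. assert (Pu := proj1 (Cmod_gt_0 _) (RHP_neq_0 u Hu)). assert (HPI := PI_RGT_0).
assert (Hx : 0 < Re u / Cmod u <= 1).
{ split; [apply Rdiv_lt_0_compat; assumption|]. apply Rmult_le_reg_r with (Cmod u); [exact Pu|].
  replace (Re u / Cmod u * Cmod u) with (Re u) by (field; lra).
  generalize (Rle_trans _ _ _ (Rle_abs (Re u)) (re_le_Cmod u)). lra. }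
assert (B := acos_lt_PI2 _ Hx). unfold strip, Clog, Carg. simpl. destruct (Rle_dec 0 (Im u)); lra.
Qed.

Lemma Cexp_Clog u : 0 < Re u -> Cexp (Clog u) = u.
Proof.
intros Hu. assert (Pu := proj1 (Cmod_gt_0 _) (RHP_neq_0 u Hu)).
assert (Hx : 0 < Re u / Cmod u <= 1).
{ split; [apply Rdiv_lt_0_compat; assumption|]. apply Rmult_le_reg_r with (Cmod u); [exact Pu|].
  replace (Re u / Cmod u * Cmod u) with (Re u) by (field; lra).
  generalize (Rle_trans _ _ _ (Rle_abs (Re u)) (re_le_Cmod u)). lra. }
assert (Hs : sin (acos (Re u / Cmod u)) = Rabs (Im u) / Cmod u).
{ rewrite sin_acos by lra. rewrite <- (sqrt_Rsqr (Rabs (Im u) / Cmod u)).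
  - f_equal. assert (E := Cmod2_alt u). unfold Rsqr.
    replace (Rabs (Im u) / Cmod u * (Rabs (Im u) / Cmod u)) with (Rsqr (Rabs (Im u)) / Cmod u ^ 2)
      by (unfold Rsqr; field; lra).
    rewrite <- Rsqr_abs. unfold Rsqr.
    replace (Im u * Im u) with (Cmod u ^ 2 - Re u ^ 2) by (rewrite E; ring). field. lra.
  - apply Rmult_le_pos; [apply Rabs_pos|]. left. apply Rinv_0_lt_compat, Pu. }
unfold Cexp, Clog. simpl. rewrite exp_ln by exact Pu.
unfold Carg. apply injective_projections; unfold Re, Im in *; simpl.
- destruct (Rle_dec 0 (snd u)); rewrite ?cos_neg, cos_acos by lra; field; lra.
- destruct (Rle_dec 0 (snd u)) as [h|h]; rewrite ?sin_neg, Hs.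
  + rewrite Rabs_pos_eq by exact h. field. lra.
  + rewrite Rabs_left by lra. field. lra.
Qed.

Lemma Cexp_inj_strip a b : strip a -> strip b -> Cexp a = Cexp b -> a = b.
Proof.
unfold strip. intros Ha Hb E. assert (HPI := PI_RGT_0).
assert (E1 : Cexp (a - b) = 1).
{ unfold Cminus. rewrite Cexp_plus, E, <- Cexp_plus, Cplus_opp_r. apply Cexp_0. }
assert (ER : Re (a - b) = 0).
{ assert (X := Cmod_Cexp (a - b)). rewrite E1, Cmod_1, <- exp_0 in X. symmetry. apply exp_inv, X. }
assert (EC : cos (Im (a - b)) = 1).
{ assert (X := f_equal fst E1). unfold Cexp in X. simpl in X. unfold Re, Im in *; simpl in *. rewrite ER, exp_0 in X. lra. }
assert (EI : Im (a - b) = 0).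
{ assert (B : - PI < Im (a - b) < PI) by (unfold Im in *; simpl; lra).
  destruct (Rtotal_order (Im (a - b)) 0) as [h|[h|h]]; [|exact h|]; exfalso.
  - rewrite <- cos_neg in EC. rewrite <- cos_0 in EC.
    assert (X := cos_decreasing_1 0 (- Im (a - b))). specialize (X ltac:(lra) ltac:(lra) ltac:(lra) ltac:(lra) ltac:(lra)). lra.
  - rewrite <- cos_0 in EC.
    assert (X := cos_decreasing_1 0 (Im (a - b))). specialize (X ltac:(lra) ltac:(lra) ltac:(lra) ltac:(lra) ltac:(lra)). lra. }
apply Ceq_minus. apply injective_projections; assumption.
Qed.

Lemma Re_Cexp_strip l : strip l -> 0 < Re (Cexp l).
Proof.
intros [H1 H2]. unfold Re at 1. simpl. apply Rmult_lt_0_compat; [apply exp_pos|apply cos_gt_0; assumption].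
Qed.

Lemma Clog_Cexp l : strip l -> Clog (Cexp l) = l.
Proof.
intros H. assert (P := Re_Cexp_strip l H).
apply Cexp_inj_strip; [apply strip_Clog, P|exact H|apply Cexp_Clog, P].
Qed.

Lemma Clog_1 : Clog 1 = 0.
Proof.
rewrite <- Cexp_0. apply Clog_Cexp. unfold strip; simpl. generalize PI_RGT_0. lra.
Qed.

Lemma open_halfplane (k : C -> R) a : (forall z, continuous k z) -> forall z, a < k z -> locally z (fun w => a < k w).
Proof.
intros Hc z Hz. apply (Hc z (fun y => a < y)). apply (open_gt a), Hz.
Qed.

Lemma continuous_ReC z : continuous (fun w : C => Re w) z.
Proof. apply continuous_Re, continuous_id. Qed.

Lemma continuous_ImC z : continuous (fun w : C => Im w) z.
Proof. apply continuous_Im, continuous_id. Qed.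

Lemma open_strip l : strip l -> locally l strip.
Proof.
intros [H1 H2].
assert (L1 := open_halfplane (fun w : C => Im w) (- (PI / 2)) continuous_ImC l H1).
assert (L2 := open_halfplane (fun w : C => - Im w) (- (PI / 2))
  (fun z => continuous_opp (V := R_NormedModule) _ _ (continuous_ImC z)) l ltac:(lra)).
generalize (filter_and _ _ L1 L2). apply filter_imp. intros w [A B]. split; lra.
Qed.

Lemma Cderiv_Clog u : 0 < Re u -> Cderiv Clog u (/ u).
Proof.
intros Hu.
apply Cderiv_ext_loc with (fun w => if Rlt_dec 0 (Re w) then Clog w else RtoC 0).
{ generalize (open_halfplane (fun w : C => Re w) 0 continuous_ReC u Hu). apply filter_imp.
  intros w Hw. destruct (Rlt_dec 0 (Re w)); [reflexivity|contradiction]. }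
apply Cderiv_eq with (1 / Cexp (Clog u))%C.
- apply (inverse_derive strip Cexp Cexp) with (P := fun w => w).
  + apply open_strip.
  + intros l _. apply Cderiv_Cexp.
  + intros l _. apply Cexp_neq_0.
  + apply Cexp_inj_strip.
  + intros w [l [Hl ->]]. assert (P := Re_Cexp_strip l Hl).
    destruct (Rlt_dec 0 (Re (Cexp l))) as [_|n]; [|contradiction].
    split; [apply strip_Clog, P|symmetry; apply Cexp_Clog, P].
  + apply strip_Clog, Hu.
  + symmetry. apply Cexp_Clog, Hu.
  + apply Cderiv_id.
- rewrite Cexp_Clog by exact Hu. field. apply RHP_neq_0, Hu.
Qed.

(** * Holomorphic functions on the disk *)

Lemma disk_open z : disk z -> locally z disk.
Proof.
unfold disk. intros H. apply locally_disk. exists (1 - Cmod z). split; [lra|].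
intros w Hw. replace w with ((w - z) + z)%C by ring. eapply Rle_lt_trans; [apply Cmod_triangle|]. lra.
Qed.

Lemma disk_scale t z : 0 <= t <= 1 -> disk z -> disk (RtoC t * z).
Proof.
unfold disk. intros Ht Hz. rewrite Cmod_mult, Cmod_R, Rabs_pos_eq by lra.
generalize (Cmod_ge_0 z). nra.
Qed.

Definition holo_disk f : Prop := forall z, disk z -> holo_at f z.

Lemma holo_disk_locally f z : holo_disk f -> disk z -> locally z (fun w => holo_at f w).
Proof. intros H Hz. generalize (disk_open z Hz). apply filter_imp. exact H. Qed.

Lemma holo_disk_C_derive f : holo_disk f -> holo_disk (C_derive f).
Proof. intros H z Hz. apply holo_C_derive, holo_disk_locally; assumption. Qed.

(* Written in the shape [psi t * k (p t + d t * z)] of [CInt_param_derive]. *)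
Definition radial_mean f z : C := CInt (fun t => (1 * f (0 + RtoC t * z))%C) 0 1.

Lemma continuous_RtoC_id t : continuous (fun t : R => RtoC t) t.
Proof. apply continuous_RtoC, continuous_id. Qed.

Lemma path_radial t z : Cpath_derive (fun t => (0 + RtoC t * z)%C) t z.
Proof. apply path_segment. Qed.

Lemma continuous_radial f z t : holo_disk f -> disk z -> 0 <= t <= 1 ->
  continuous (fun t => f (0 + RtoC t * z)%C) t.
Proof.
intros Hf Hz Ht. apply (continuous_comp (fun t : R => (0 + RtoC t * z)%C) f).
- apply (ex_derive_continuous (K := R_AbsRing) (V := C_R_NormedModule)). eexists. apply path_radial.
- apply holo_at_continuous, Hf. rewrite Cplus_0_l. apply disk_scale; assumption.
Qed.

Lemma radial_mean_derive f z : holo_disk f -> disk z ->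
  Cderiv (radial_mean f) z (CInt (fun t => (1 * RtoC t * C_derive f (0 + RtoC t * z))%C) 0 1).
Proof.
intros Hf Hz.
assert (Hd : forall t, 0 <= t <= 1 -> disk (0 + RtoC t * z)).
{ intros t Ht. rewrite Cplus_0_l. apply disk_scale; assumption. }
apply (CInt_param_derive 0 1 Rle_0_1 (fun _ => RtoC 1) (fun _ => RtoC 0) (fun t => RtoC t)) with (k' := C_derive f).
- intros t _. apply continuous_const.
- intros t _. apply continuous_const.
- intros t _. apply continuous_RtoC_id.
- intros t Ht. generalize (holo_disk_locally f _ Hf (Hd t Ht)). apply filter_imp. intros w. apply holo_at_continuous.
- intros t Ht. generalize (holo_disk_locally f _ Hf (Hd t Ht)). apply filter_imp. intros w. apply holo_at_C_derive.
- intros t Ht. apply holo_at_continuous, holo_disk_C_derive; [exact Hf|apply Hd, Ht].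
Qed.

(** Differentiation of z times the mean yields the integral of f(t z) + t z f'(t z), which is the
    derivative of t f(t z) in t. *)
Lemma radial_primitive f z : holo_disk f -> disk z -> Cderiv (fun z => (z * radial_mean f z)%C) z (f z).
Proof.
intros Hf Hz. eapply Cderiv_eq.
- apply Cderiv_mult; [apply Cderiv_id|apply radial_mean_derive; assumption].
- assert (C1 : forall t, 0 <= t <= 1 -> continuous (fun t => (1 * f (0 + RtoC t * z))%C) t).
  { intros t Ht. apply continuous_Cmult; [apply continuous_const|apply continuous_radial; assumption]. }
  assert (C2 : forall t, 0 <= t <= 1 -> continuous (fun t => (1 * RtoC t * C_derive f (0 + RtoC t * z))%C) t).
  { intros t Ht. apply continuous_Cmult.
    - apply continuous_Cmult; [apply continuous_const|apply continuous_RtoC_id].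
    - apply continuous_radial; trivial. apply holo_disk_C_derive, Hf. }
  assert (C3 : forall t, 0 <= t <= 1 -> continuous (fun t => (z * (1 * RtoC t * C_derive f (0 + RtoC t * z)))%C) t).
  { intros t Ht. apply continuous_Cmult; [apply continuous_const|apply C2, Ht]. }
  unfold radial_mean. rewrite Cmult_1_l.
  assert (E1 : (z * CInt (fun t => (1 * RtoC t * C_derive f (0 + RtoC t * z))%C) 0 1)%C =
    CInt (fun t => (z * (1 * RtoC t * C_derive f (0 + RtoC t * z)))%C) 0 1).
  { symmetry. exact (CInt_scal 0 1 Rle_0_1 z _ C2). }
  rewrite E1.
  assert (E2 : (CInt (fun t => (1 * f (0 + RtoC t * z))%C) 0 1 +
     CInt (fun t => (z * (1 * RtoC t * C_derive f (0 + RtoC t * z)))%C) 0 1)%C =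
     CInt (fun t => (1 * f (0 + RtoC t * z) + z * (1 * RtoC t * C_derive f (0 + RtoC t * z)))%C) 0 1).
  { symmetry. exact (CInt_plus 0 1 Rle_0_1 _ _ C1 C3). }
  rewrite E2.
  assert (E3 : CInt (fun t => (1 * f (0 + RtoC t * z) + z * (1 * RtoC t * C_derive f (0 + RtoC t * z)))%C) 0 1 =
    (RtoC 1 * f (0 + RtoC 1 * z) - RtoC 0 * f (0 + RtoC 0 * z))%C).
  { apply (CInt_derive 0 1 Rle_0_1 (fun t => (RtoC t * f (0 + RtoC t * z))%C)).
    - intros t Ht. apply continuous_Cplus; [apply C1|apply C3]; exact Ht.
    - intros t Ht.
      replace (1 * f (0 + RtoC t * z) + z * (1 * RtoC t * C_derive f (0 + RtoC t * z)))%C with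
        (1 * f (0 + RtoC t * z) + RtoC t * (C_derive f (0 + RtoC t * z) * z))%C by ring.
      apply path_mult.
      + apply path_factor. exists (fun _ => RtoC 1). split; [apply continuous_const|]. split; [reflexivity|].
        intros s. rewrite RtoC_minus. ring.
      + apply (path_comp f); [|apply path_radial]. apply holo_at_C_derive, Hf.
        rewrite Cplus_0_l. apply disk_scale; assumption. }
  rewrite E3. replace (0 + RtoC 1 * z)%C with z by ring. as_Ceq. ring.
Qed.

Lemma derive_0_constant f : (forall z, disk z -> Cderiv f z 0) -> forall z, disk z -> f z = f 0.
Proof.
intros H z Hz. apply Ceq_minus, Cmod_eq_0. apply Rle_antisym; [|apply Cmod_ge_0].
assert (X := mean_value_C f (fun _ => RtoC 0) 0 z 0).
rewrite Rmult_0_l in X. apply X.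
- intros s Hs. apply H. replace (0 + RtoC s * (z - 0))%C with (RtoC s * z)%C by ring.
  apply disk_scale; assumption.
- intros s _. rewrite Cmod_0. lra.
Qed.

(** This represents f(z)/z as the radial mean of f', which is holomorphic at 0 as well, with no
    removable singularity to treat. *)
Lemma radial_mean_C_derive f z : holo_disk f -> f 0 = 0 -> disk z -> f z = (z * radial_mean (C_derive f) z)%C.
Proof.
intros Hf H0 Hz.
assert (X := derive_0_constant (fun z => (f z - z * radial_mean (C_derive f) z)%C)).
apply Ceq_minus. rewrite X; [rewrite H0; ring| |exact Hz].
intros w Hw. apply Cderiv_eq with (C_derive f w - C_derive f w)%C; [|ring].
apply Cderiv_minus; [apply holo_at_C_derive, Hf, Hw|].
apply radial_primitive; [apply holo_disk_C_derive, Hf|exact Hw].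
Qed.

Lemma radial_mean_0 f : radial_mean f 0 = f 0.
Proof.
unfold radial_mean. transitivity (CInt (fun _ => f 0) 0 1).
- apply CInt_ext; [lra|]. intros t _. replace (0 + RtoC t * 0)%C with (RtoC 0) by ring. as_Ceq. ring.
- rewrite CInt_const. rewrite Rminus_0_r. as_Ceq. ring.
Qed.

(** * The derivative of a convex function *)

Lemma Re_inv_gt_half (w : C) : Cmod w < 1 -> / 2 < Re (/ (1 - w)).
Proof.
intros H. assert (E := Cmod2_alt w).
assert (H2 : Cmod w ^ 2 < 1) by (generalize (Cmod_ge_0 w); nra).
destruct w as [x y]. unfold Re, Im in *; simpl in *.
assert (D : 0 < (1 + - x) ^ 2 + (0 + - y) ^ 2) by nra. simpl in D.
apply Rmult_lt_reg_r with (1 := D). unfold Rdiv. rewrite (Rmult_assoc _ (/ _)), Rinv_l by lra. lra.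
Qed.

Lemma Re_unit_quotient (w : C) : Cmod w = 1 -> (1 - w)%C <> 0 -> Re (w / (1 - w)) = - / 2.
Proof.
intros H Hn. assert (E := Cmod2_alt w). rewrite H in E. destruct w as [x y]. unfold Re, Im in E; simpl in E.
assert (D : 2 - 2 * x <> 0).
{ intros D. apply Hn. assert (Hx : x = 1) by lra. rewrite Hx in *. assert (Hy : y = 0) by nra. rewrite Hy.
  unfold Cminus, Cplus, Copp, RtoC; simpl. f_equal; ring. }
unfold Re; simpl.
replace ((1 + - x) * ((1 + - x) * 1) + (0 + - y) * ((0 + - y) * 1)) with (2 - 2 * x) by nra.
transitivity ((x - (x * (x * 1) + y * (y * 1))) / (2 - 2 * x)); [|rewrite <- E]; field; exact D.
Qed.

Lemma derivative_is_power alpha f (z : C) : 0 <= alpha < 1 -> convex_of_order alpha f -> disk z ->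
  exists F : C, / 2 < Re F /\ C_derive f z = Cexp (RtoC (2 * (1 - alpha)) * Clog F).
Proof.
intros Ha [Hf [Hf0 [Hf1 Hconv]]] Hz.
assert (Hh : holo_disk f).
{ intros w Hw. destruct (Hf w Hw) as [l Hl]. exists l. apply is_derive_Cderiv, Hl. }
set (f1 := C_derive f) in *. set (f2 := C_derive f1) in *.
assert (Hh1 : holo_disk f1) by apply holo_disk_C_derive, Hh.
assert (Hh2 : holo_disk f2) by apply holo_disk_C_derive, Hh1.
set (b := 2 * (1 - alpha)). assert (Hb : 0 < b) by (unfold b; lra).
assert (HbC := RtoC_neq_0 b ltac:(lra)).
set (g := fun z => (f2 z / f1 z)%C).
assert (Hg : holo_disk g).
{ intros w Hw. destruct (Hh2 w Hw) as [l Hl]. destruct (Hh1 w Hw) as [m Hm]. eexists.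
  apply Cderiv_mult; [exact Hl|]. apply Cderiv_inv; [apply Hconv, Hw|exact Hm]. }
(* [z * radial_mean g z] is the primitive of f''/f' that vanishes at 0, hence a logarithm of f'; [F]
   is the root (f')^(1/b). *)
set (F := fun z => Cexp (/ RtoC b * (z * radial_mean g z))).
assert (HF : forall w, disk w -> Cderiv F w (F w * (/ RtoC b * g w))).
{ intros w Hw. apply (Cderiv_comp Cexp (fun z => (/ RtoC b * (z * radial_mean g z))%C)); [apply Cderiv_Cexp|].
  apply Cderiv_scal, radial_primitive; assumption. }
assert (HFn : forall w, F w <> 0) by (intros w; apply Cexp_neq_0).
assert (HF0 : F 0 = 1).
{ unfold F. replace (/ RtoC b * (0 * radial_mean g 0))%C with (RtoC 0) by ring. apply Cexp_0. }
set (om := fun z => (1 - / F z)%C).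
assert (Hom : forall w, disk w -> Cderiv om w (/ RtoC b * g w * (1 - om w))).
{ intros w Hw. eapply Cderiv_eq; [apply Cderiv_minus; [apply Cderiv_const|apply Cderiv_inv; [apply HFn|apply HF, Hw]]|].
  unfold om. field. auto. }
assert (Hom0 : om 0 = 0) by (unfold om; rewrite HF0; field).
assert (Hlt : forall w, disk w -> Cmod (om w) < 1).
{ apply (first_touch (fun w => Cmod (om w) < 1)).
  - rewrite Hom0, Cmod_0. lra.
  - intros w Hw H. assert (Hc := continuous_Cmod _ _ (Cderiv_continuous _ _ _ (Hom w Hw))).
    apply (Hc (fun y => y < 1)). apply (open_lt 1), H.
  - intros r Hr H z0 Hz0.
    assert (Hz0d : disk z0) by (unfold disk; lra).
    (* The points (1 - s) z0 lie inside the circle, where |om| < 1, and tend to [z0]. *)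
    assert (Hle : Cmod (om z0) <= 1).
    { apply Rnot_lt_le. intros h.
      assert (Hc := continuous_Cmod _ _ (Cderiv_continuous _ _ _ (Hom z0 Hz0d))).
      assert (L := Hc (fun y => 1 < y) (open_gt 1 _ h)). unfold filtermap in L.
      apply locally_disk in L. destruct L as [d [Hd L]].
      set (s := Rmin 1 (d / 2)). assert (Hs : 0 < s) by (apply Rmin_glb_lt; lra).
      assert (S1 := Rmin_l 1 (d / 2)). assert (S2 := Rmin_r 1 (d / 2)). fold s in S1, S2.
      assert (X := L (RtoC (1 - s) * z0)%C).
      assert (Y := H (RtoC (1 - s) * z0)%C).
      rewrite Cmod_mult, Cmod_R, Rabs_pos_eq, Hz0 in Y by lra. specialize (Y ltac:(nra)).
      replace (RtoC (1 - s) * z0 - z0)%C with (- (RtoC s * z0))%C in X by (rewrite RtoC_minus; ring).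
      rewrite Cmod_opp, Cmod_mult, Cmod_R, Rabs_pos_eq, Hz0 in X by lra. specialize (X ltac:(nra)). lra. }
    destruct (Rle_lt_or_eq_dec _ _ Hle) as [h|h]; [exact h|]. exfalso.
    assert (Hsch : forall w, Cmod w < r -> Cmod (om w) <= Cmod w / r).
    { apply schwarz.
      - intros w Hw. eexists. apply Hom. unfold disk. lra.
      - intros w Hw. left. apply H, Hw.
      - exact Hom0. }
    destruct (jack om r z0 _ ltac:(lra) Hz0 Hsch (Hom z0 Hz0d) h) as [q [Hq Eq]].
    destruct (Hconv z0 Hz0d) as [Hnz HRe].
    assert (Hn1 : (1 - om z0)%C <> 0).
    { unfold om. replace (1 - (1 - / F z0))%C with (/ F z0)%C by ring.
      intros E. apply C1_nz. rewrite <- (Cinv_r (F z0) (HFn z0)), E. ring. }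
    (* As Re (om / (1 - om)) = -1/2 on |om| = 1 and q >= 1, the convexity expression is at most 1 -
       b/2 = alpha, against the hypothesis. *)
    assert (Eg : (z0 * f2 z0 / f1 z0 = RtoC (b * q) * (om z0 / (1 - om z0)))%C).
    { transitivity (RtoC b * (z0 * (/ RtoC b * g z0 * (1 - om z0))) / (1 - om z0))%C.
      - unfold g. field. auto.
      - rewrite Eq, RtoC_mult. field. exact Hn1. }
    change (Re (1 + z0 * f2 z0 / f1 z0) > alpha) in HRe.
    rewrite Eg in HRe.
    assert (EH : Re (om z0 / (1 - om z0)) = - / 2).
    { apply Re_unit_quotient; assumption. }
    unfold Cplus in HRe. unfold Re at 1 in HRe. cbn [fst] in HRe.
    change (1 + Re (RtoC (b * q) * (om z0 / (1 - om z0))) > alpha) in HRe.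
    rewrite re_scal_l, EH in HRe. unfold b in HRe. nra. }
exists (F z).
assert (HFr : forall w, disk w -> / 2 < Re (F w)).
{ intros w Hw. assert (X := Re_inv_gt_half _ (Hlt w Hw)). unfold om in X.
  replace (/ (1 - (1 - / F w)))%C with (F w) in X; [exact X|]. field. split; [apply HFn|].
  replace (F w - (F w - 1))%C with (RtoC 1) by ring. exact C1_nz. }
split; [apply HFr, Hz|].
(* The claim speaks of the principal logarithm of [F], not of the exponent from which [F] was built;
   the product below has derivative 0 and value 1 at 0. *)
assert (HC := derive_0_constant (fun z => (f1 z * Cexp (- RtoC b * Clog (F z)))%C)).
assert (EC : (f1 z * Cexp (- RtoC b * Clog (F z)) = 1)%C).
{ rewrite HC; trivial.
  - rewrite HF0, Hf1, Clog_1. replace (- RtoC b * 0)%C with (RtoC 0) by ring. rewrite Cexp_0. ring.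
  - intros w Hw.
    assert (HL : Cderiv (fun z => Clog (F z)) w (/ F w * (F w * (/ RtoC b * g w)))).
    { apply (Cderiv_comp Clog F); [apply Cderiv_Clog; generalize (HFr w Hw); lra|apply HF, Hw]. }
    eapply Cderiv_eq; [apply Cderiv_mult; [apply holo_at_C_derive, Hh1, Hw|
      apply (Cderiv_comp Cexp (fun z => (- RtoC b * Clog (F z))%C)); [apply Cderiv_Cexp|apply Cderiv_scal, HL]]|].
    change (C_derive f1 w) with (f2 w). assert (Hnz := proj1 (Hconv w Hw)). unfold g. field. auto. }
assert (EE := Cexp_opp (RtoC b * Clog (F z))).
replace (- (RtoC b * Clog (F z)))%C with (- RtoC b * Clog (F z))%C in EE by ring.
transitivity (f1 z * (Cexp (RtoC b * Clog (F z)) * Cexp (- RtoC b * Clog (F z))))%C; [rewrite EE; ring|].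
transitivity (f1 z * Cexp (- RtoC b * Clog (F z)) * Cexp (RtoC b * Clog (F z)))%C; [ring|]. rewrite EC. ring.
Qed.

(** * The dominant *)

Definition Crpower u (a : R) : C := Cpower u (RtoC a).

Lemma Crpower_plus u (a b : R) : Crpower u (a + b) = (Crpower u a * Crpower u b)%C.
Proof. unfold Crpower, Cpower. rewrite <- Cexp_plus. f_equal. rewrite RtoC_plus. ring. Qed.

Lemma Crpower_1 u : 0 < Re u -> Crpower u 1 = u.
Proof. intros H. unfold Crpower, Cpower. rewrite Cmult_1_l. apply Cexp_Clog, H. Qed.

Lemma Crpower_0 u : Crpower u 0 = 1.
Proof. unfold Crpower, Cpower. rewrite Cmult_0_l. apply Cexp_0. Qed.

Lemma Crpower_pred u (a : R) : 0 < Re u -> Crpower u a = (u * Crpower u (a - 1))%C.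
Proof.
intros H. rewrite <- (Crpower_1 u H) at 2. rewrite <- Crpower_plus. do 2 f_equal. ring.
Qed.

Lemma Cderiv_Crpower u (a : R) : 0 < Re u ->
  Cderiv (fun u => Crpower u a) u (RtoC a * Crpower u (a - 1)).
Proof.
intros H. assert (Hn := RHP_neq_0 u H). eapply Cderiv_eq.
- apply (Cderiv_comp Cexp (fun u => (RtoC a * Clog u)%C)); [apply Cderiv_Cexp|].
  apply Cderiv_scal, Cderiv_Clog, H.
- change (Cexp (RtoC a * Clog u)) with (Crpower u a). rewrite (Crpower_pred u a H). field. exact Hn.
Qed.

Definition seg u (t : R) : C := (RtoC (1 - t) + RtoC t * u)%C.

Lemma seg_RHP u t : 0 < Re u -> 0 <= t <= 1 -> 0 < Re (seg u t).
Proof.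
intros Hu Ht. unfold seg, Re in *; simpl. destruct (Req_dec t 1) as [->|n]; nra.
Qed.

Lemma seg_path u t : Cpath_derive (seg u) t (u - 1)%C.
Proof.
apply path_factor. exists (fun _ => (u - 1)%C). split; [apply continuous_const|]. split; [reflexivity|].
intros s. unfold seg. rewrite !RtoC_minus. ring.
Qed.

Lemma seg_power_path u (a t : R) : 0 < Re u -> 0 <= t <= 1 ->
  Cpath_derive (fun t => Crpower (seg u t) a) t (RtoC a * Crpower (seg u t) (a - 1) * (u - 1))%C.
Proof.
intros Hu Ht. apply (path_comp (fun u => Crpower u a)); [apply Cderiv_Crpower, seg_RHP; assumption|apply seg_path].
Qed.

Lemma path_continuous (h : R -> C) t l : Cpath_derive h t l -> continuous h t.
Proof.
intros H. apply (ex_derive_continuous (K := R_AbsRing) (V := C_R_NormedModule)). exists l. exact H.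
Qed.

Lemma seg_power_continuous u (a t : R) : 0 < Re u -> 0 <= t <= 1 ->
  continuous (fun t => Crpower (seg u t) a) t.
Proof. intros Hu Ht. eapply path_continuous, seg_power_path; assumption. Qed.

Lemma path_RtoC t : Cpath_derive (fun t => RtoC t) t (RtoC 1).
Proof.
apply path_factor. exists (fun _ => RtoC 1). split; [apply continuous_const|]. split; [reflexivity|].
intros s. rewrite RtoC_minus. ring.
Qed.

Lemma path_RtoC_compl t : Cpath_derive (fun t => RtoC (1 - t)) t (- (1))%C.
Proof.
apply path_factor. exists (fun _ => (- (1))%C). split; [apply continuous_const|]. split; [reflexivity|].
intros s. rewrite !RtoC_minus. ring.
Qed.

(* With [z = 1 - 1/u], so that the disk becomes the half-plane [Re u > 1/2], the function
   [k_alpha(z) / z] is [dominant c u = u (u^c - 1) / (c (u - 1))] where [c = 1 - 2 alpha]; the integral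
   absorbs the removable singularities at [u = 1] and [c = 0]. *)
Definition dominant (c : R) u : C := (u * CInt (fun t => (1 * Crpower (RtoC (1 - t) + RtoC t * u) (c - 1)%R)%C) 0 1)%C.

(** The derivative of [dominant c] after an integration by parts. Direct differentiation leaves two
    competing terms; here a single integrand, with a positive factor when c > -1, lets signs be read
    off its argument. *)
Definition dominant' (c : R) u : C := (RtoC (c + 1) * CInt (fun t => (RtoC t * Crpower (seg u t) (c - 1)%R)%C) 0 1)%C.

Section Dominant.
Variable c : R.

Let A u t := Crpower (seg u t) (c - 1)%R.

Lemma A_continuous u t : 0 < Re u -> 0 <= t <= 1 -> continuous (A u) t.
Proof. apply seg_power_continuous. Qed.

Lemma tA_continuous u t : 0 < Re u -> 0 <= t <= 1 -> continuous (fun t => (RtoC t * A u t)%C) t.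
Proof. intros Hu Ht. apply continuous_Cmult; [apply continuous_RtoC_id|apply A_continuous; assumption]. Qed.

Lemma dominant_A u : dominant c u = (u * CInt (A u) 0 1)%C.
Proof. unfold dominant. f_equal. apply CInt_ext; [lra|]. intros t _. as_Ceq. unfold A, seg. ring. Qed.

Lemma dominant_derive u : 0 < Re u -> Cderiv (dominant c) u (dominant' c u).
Proof.
intros Hu.
set (B := fun t => Crpower (seg u t) (c - 1 - 1)%R).
assert (HB : forall t, 0 <= t <= 1 -> continuous B t) by (intros t Ht; apply seg_power_continuous; assumption).
eapply Cderiv_eq.
- apply Cderiv_mult; [apply Cderiv_id|].
  apply (CInt_param_derive 0 1 Rle_0_1 (fun _ => RtoC 1) (fun t => RtoC (1 - t)) (fun t => RtoC t)) with
    (k := fun w => Crpower w (c - 1)%R) (k' := fun w => (RtoC (c - 1) * Crpower w (c - 1 - 1)%R)%C).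
  + intros t _. apply continuous_const.
  + intros t _. eapply path_continuous, path_RtoC_compl.
  + intros t _. apply continuous_RtoC_id.
  + intros t Ht. generalize (open_halfplane (fun w : C => Re w) 0 continuous_ReC _ (seg_RHP u t Hu Ht)).
    apply filter_imp. intros w Hw. eapply Cderiv_continuous, Cderiv_Crpower, Hw.
  + intros t Ht. generalize (open_halfplane (fun w : C => Re w) 0 continuous_ReC _ (seg_RHP u t Hu Ht)).
    apply filter_imp. intros w Hw. apply Cderiv_Crpower, Hw.
  + intros t Ht. apply continuous_Cmult; [apply continuous_const|].
    eapply Cderiv_continuous, (Cderiv_Crpower (seg u t)), seg_RHP; assumption.
- cbv beta.
  assert (E1 : CInt (fun t => (1 * Crpower (RtoC (1 - t) + RtoC t * u) (c - 1)%R)%C) 0 1 = CInt (A u) 0 1).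
  { apply CInt_ext; [lra|]. intros t _. as_Ceq. unfold A, seg. ring. }
  set (K := fun t => (RtoC t * B t)%C).
  assert (HK : forall t, 0 <= t <= 1 -> continuous K t).
  { intros t Ht. apply continuous_Cmult; [apply continuous_RtoC_id|apply HB, Ht]. }
  assert (E2 : CInt (fun t => (1 * RtoC t * (RtoC (c - 1) * Crpower (RtoC (1 - t) + RtoC t * u) (c - 1 - 1)%R))%C) 0 1
     = (RtoC (c - 1) * CInt K 0 1)%C).
  { rewrite <- (CInt_scal 0 1 Rle_0_1 (RtoC (c - 1)) K HK). apply CInt_ext; [lra|].
    intros t _. as_Ceq. unfold K, B, seg. ring. }
  rewrite E1, E2. unfold dominant'.
  change (CInt (fun t => (RtoC t * Crpower (seg u t) (c - 1)%R)%C) 0 1) with (CInt (fun t => (RtoC t * A u t)%C) 0 1).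
  (* The integrands of the two sides differ by the derivative of [t (1 - t) A u t]. *)
  assert (HD : forall t, 0 <= t <= 1 -> Cpath_derive (fun t => (RtoC t * (RtoC (1 - t) * A u t))%C) t
     (1 * (RtoC (1 - t) * A u t) + RtoC t * (- (1) * A u t + RtoC (1 - t) * (RtoC (c - 1) * B t * (u - 1))))%C).
  { intros t Ht. apply (path_mult (fun t => RtoC t) (fun t => (RtoC (1 - t) * A u t)%C)); [apply path_RtoC|].
    apply (path_mult (fun t => RtoC (1 - t)) (A u)); [apply path_RtoC_compl|].
    apply seg_power_path; assumption. }
  set (D := fun t => (1 * (RtoC (1 - t) * A u t) + RtoC t * (- (1) * A u t + RtoC (1 - t) * (RtoC (c - 1) * B t * (u - 1))))%C).
  assert (HDc : forall t, 0 <= t <= 1 -> continuous D t).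
  { intros t Ht. assert (X1 := A_continuous u t Hu Ht). assert (X2 := HB t Ht).
    assert (X3 := path_continuous _ _ _ (path_RtoC_compl t)). assert (X4 := continuous_RtoC_id t).
    apply continuous_Cplus.
    - apply continuous_Cmult; [apply continuous_const|apply continuous_Cmult; assumption].
    - apply continuous_Cmult; [exact X4|]. apply continuous_Cplus.
      + apply continuous_Cmult; [apply continuous_const|exact X1].
      + apply continuous_Cmult; [exact X3|]. apply continuous_Cmult; [|apply continuous_const].
        apply continuous_Cmult; [apply continuous_const|exact X2]. }
  assert (ID : CInt D 0 1 = RtoC 0).
  { rewrite (CInt_derive 0 1 Rle_0_1 _ D HDc HD). rewrite Rminus_diag. as_Ceq. ring. }
  assert (X1 := fun t Ht => A_continuous u t Hu Ht). assert (X2 := fun t Ht => tA_continuous u t Hu Ht).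
  assert (Y1 : forall t, 0 <= t <= 1 -> continuous (fun t => (u * RtoC (c - 1) * K t)%C) t).
  { intros t Ht. apply continuous_Cmult; [apply continuous_const|apply HK, Ht]. }
  assert (Y2 : forall t, 0 <= t <= 1 -> continuous (fun t => (RtoC (c + 1) * (RtoC t * A u t))%C) t).
  { intros t Ht. apply continuous_Cmult; [apply continuous_const|apply X2, Ht]. }
  assert (P1 : CInt (fun t => (A u t + u * RtoC (c - 1) * K t)%C) 0 1 =
    (CInt (A u) 0 1 + u * RtoC (c - 1) * CInt K 0 1)%C).
  { rewrite <- (CInt_scal 0 1 Rle_0_1 (u * RtoC (c - 1))%C K HK). exact (CInt_plus 0 1 Rle_0_1 _ _ X1 Y1). }
  assert (P2 : CInt (fun t => (RtoC (c + 1) * (RtoC t * A u t) + D t)%C) 0 1 =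
    (RtoC (c + 1) * CInt (fun t => (RtoC t * A u t)%C) 0 1 + CInt D 0 1)%C).
  { assert (S : CInt (fun t => (RtoC (c + 1) * (RtoC t * A u t))%C) 0 1 =
      (RtoC (c + 1) * CInt (fun t => (RtoC t * A u t)%C) 0 1)%C) by exact (CInt_scal 0 1 Rle_0_1 _ _ X2).
    rewrite <- S. exact (CInt_plus 0 1 Rle_0_1 _ _ Y2 HDc). }
  rewrite ID in P2.
  assert (P3 : CInt (fun t => (A u t + u * RtoC (c - 1) * K t)%C) 0 1 =
     CInt (fun t => (RtoC (c + 1) * (RtoC t * A u t) + D t)%C) 0 1).
  { apply CInt_ext; [lra|]. intros t Ht. as_Ceq. unfold D, K.
    assert (EA : A u t = (seg u t * B t)%C) by (apply Crpower_pred, seg_RHP; assumption).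
    rewrite EA. unfold seg. rewrite RtoC_plus, !RtoC_minus. ring. }
  rewrite P1, P2 in P3. rewrite Cmult_assoc.
  transitivity (CInt (A u) 0 1 + u * RtoC (c - 1) * CInt K 0 1)%C; [as_Ceq; ring|]. rewrite P3. as_Ceq. ring.
Qed.

Lemma CInt_seg_power (a : R) u : 0 < Re u ->
  (RtoC a * (u - 1) * CInt (fun t => Crpower (seg u t) (a - 1)%R) 0 1 = Crpower u a - 1)%C.
Proof.
intros Hu.
assert (H1 : forall t, 0 <= t <= 1 -> continuous (fun t => Crpower (seg u t) (a - 1)%R) t)
  by (intros t Ht; apply seg_power_continuous; assumption).
assert (E : CInt (fun t => (RtoC a * (u - 1) * Crpower (seg u t) (a - 1))%C) 0 1 =
  (RtoC a * (u - 1) * CInt (fun t => Crpower (seg u t) (a - 1)) 0 1)%C)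
  by exact (CInt_scal 0 1 Rle_0_1 _ _ H1).
rewrite <- E.
rewrite (CInt_derive 0 1 Rle_0_1 (fun t => Crpower (seg u t) a)).
- unfold seg. replace (RtoC (1 - 1) + RtoC 1 * u)%C with u by (rewrite RtoC_minus; ring).
  replace (RtoC (1 - 0) + RtoC 0 * u)%C with (RtoC 1) by (rewrite RtoC_minus; ring).
  f_equal. unfold Crpower, Cpower. rewrite Clog_1.
  replace (RtoC a * 0)%C with (RtoC 0) by ring. rewrite Cexp_0. reflexivity.
- intros t Ht. apply continuous_Cmult; [apply continuous_const|apply H1, Ht].
- intros t Ht. replace (RtoC a * (u - 1) * Crpower (seg u t) (a - 1)%R)%C
    with (RtoC a * Crpower (seg u t) (a - 1)%R * (u - 1))%C by ring.
  apply seg_power_path; assumption.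
Qed.

Lemma dominant_explicit u : 0 < Re u ->
  (RtoC c * (u - 1) * dominant c u = u * (Crpower u c - 1))%C.
Proof.
intros Hu. rewrite dominant_A, <- (CInt_seg_power c u Hu). as_Ceq. unfold A. ring.
Qed.

(** In z = 1 - 1/u this is (z G)' = k_alpha'(z) = (1 - z)^(-(c + 1)). After division by [u], both
    terms combine into the derivative of t (1 - t + t u)^c in t. *)
Lemma dominant_ode u : 0 < Re u ->
  (dominant c u + u * (u - 1) * dominant' c u = Crpower u (c + 1))%C.
Proof.
intros Hu. rewrite dominant_A. unfold dominant'.
change (CInt (fun t => (RtoC t * Crpower (seg u t) (c - 1)%R)%C) 0 1) with (CInt (fun t => (RtoC t * A u t)%C) 0 1).
assert (X1 := fun t Ht => A_continuous u t Hu Ht). assert (X2 := fun t Ht => tA_continuous u t Hu Ht).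
set (k := (RtoC (c + 1) * (u - 1))%C).
assert (X3 : forall t, 0 <= t <= 1 -> continuous (fun t => (k * (RtoC t * A u t))%C) t).
{ intros t Ht. apply continuous_Cmult; [apply continuous_const|apply X2, Ht]. }
assert (P1 : CInt (fun t => (A u t + k * (RtoC t * A u t))%C) 0 1 =
    (CInt (A u) 0 1 + k * CInt (fun t => (RtoC t * A u t)%C) 0 1)%C).
{ assert (S : CInt (fun t => (k * (RtoC t * A u t))%C) 0 1 =
      (k * CInt (fun t => (RtoC t * A u t)%C) 0 1)%C) by exact (CInt_scal 0 1 Rle_0_1 _ _ X2).
  rewrite <- S. exact (CInt_plus 0 1 Rle_0_1 _ _ X1 X3). }
assert (P2 : CInt (fun t => (A u t + k * (RtoC t * A u t))%C) 0 1 = Crpower u c).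
{ transitivity (RtoC 1 * Crpower (seg u 1) c - RtoC 0 * Crpower (seg u 0) c)%C.
  - apply (CInt_derive 0 1 Rle_0_1 (fun t => (RtoC t * Crpower (seg u t) c)%C)).
    + intros t Ht. apply continuous_Cplus; [apply X1, Ht|apply X3, Ht].
    + intros t Ht.
      replace (A u t + k * (RtoC t * A u t))%C with
        (1 * Crpower (seg u t) c + RtoC t * (RtoC c * Crpower (seg u t) (c - 1)%R * (u - 1)))%C.
      * apply (path_mult (fun t => RtoC t) (fun t => Crpower (seg u t) c)); [apply path_RtoC|apply seg_power_path; assumption].
      * rewrite (Crpower_pred (seg u t) c) by (apply seg_RHP; assumption). unfold A, k.
        unfold seg at 1. rewrite RtoC_plus, RtoC_minus. ring.
  - replace (seg u 1) with u by (unfold seg; rewrite RtoC_minus; ring). as_Ceq. ring. }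
rewrite Crpower_plus, (Crpower_1 u Hu), <- P2, P1. unfold k. as_Ceq. ring.
Qed.

End Dominant.

Lemma dominant_explicit_0 u : 0 < Re u -> ((u - 1) * dominant 0 u = u * Clog u)%C.
Proof.
intros Hu. rewrite dominant_A.
assert (H1 : forall t, 0 <= t <= 1 -> continuous (fun t => Crpower (seg u t) (0 - 1)%R) t)
  by (intros t Ht; apply seg_power_continuous; assumption).
assert (E : ((u - 1) * CInt (fun t => Crpower (seg u t) (0 - 1)%R) 0 1 = Clog u)%C).
{ assert (E : CInt (fun t => ((u - 1) * Crpower (seg u t) (0 - 1))%C) 0 1 =
    ((u - 1) * CInt (fun t => Crpower (seg u t) (0 - 1)) 0 1)%C) by exact (CInt_scal 0 1 Rle_0_1 _ _ H1).
  rewrite <- E.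
  rewrite (CInt_derive 0 1 Rle_0_1 (fun t => Clog (seg u t))).
  - unfold seg. replace (RtoC (1 - 1) + RtoC 1 * u)%C with u by (rewrite RtoC_minus; ring).
    replace (RtoC (1 - 0) + RtoC 0 * u)%C with (RtoC 1) by (rewrite RtoC_minus; ring).
    rewrite Clog_1. as_Ceq. ring.
  - intros t Ht. apply continuous_Cmult; [apply continuous_const|apply H1, Ht].
  - intros t Ht. assert (Hs := seg_RHP u t Hu Ht). assert (Hn := RHP_neq_0 _ Hs).
    replace ((u - 1) * Crpower (seg u t) (0 - 1)%R)%C with (/ seg u t * (u - 1))%C.
    + apply (path_comp Clog); [apply Cderiv_Clog, Hs|apply seg_path].
    + assert (X := Crpower_pred (seg u t) 0 Hs). rewrite Crpower_0 in X.
      replace (Crpower (seg u t) (0 - 1)%R) with (/ seg u t)%C; [ring|].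
      rewrite <- (Cmult_1_r (/ seg u t)), X. field. exact Hn. }
rewrite <- E. as_Ceq. ring.
Qed.

(** * Positivity and injectivity of the dominant *)

Lemma sin_nonneg_var x : - PI < x -> 0 <= sin x -> 0 <= x.
Proof. intros H1 H2. apply Rnot_lt_le. intros h. generalize (sin_lt_0_var x H1 h). lra. Qed.

Lemma Im_Clog_sin u : 0 < Re u -> Im u = Cmod u * sin (Im (Clog u)) /\ Re u = Cmod u * cos (Im (Clog u)).
Proof.
intros Hu. assert (E := Cexp_Clog u Hu).
assert (M : exp (Re (Clog u)) = Cmod u) by (rewrite <- Cmod_Cexp, E; reflexivity).
rewrite <- M. split; rewrite <- E at 1; reflexivity.
Qed.

Lemma seg_arg u t : 0 < Re u -> 0 <= t <= 1 ->
  0 <= Im (Clog (seg u t)) <= Im (Clog u) \/ Im (Clog u) <= Im (Clog (seg u t)) <= 0.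
Proof.
intros Hu Ht. assert (Hs := seg_RHP u t Hu Ht). assert (HPI := PI_RGT_0).
assert (Su := strip_Clog u Hu). assert (Ss := strip_Clog _ Hs). unfold strip in *.
destruct (Im_Clog_sin u Hu) as [U1 U2]. destruct (Im_Clog_sin _ Hs) as [S1 S2].
assert (Pu := proj1 (Cmod_gt_0 _) (RHP_neq_0 u Hu)). assert (Ps := proj1 (Cmod_gt_0 _) (RHP_neq_0 _ Hs)).
set (th := Im (Clog u)) in *. set (ps := Im (Clog (seg u t))) in *.
assert (E1 : Im (seg u t) = t * Im u) by (unfold seg, Im; simpl; ring).
assert (E2 : Re (seg u t) = (1 - t) + t * Re u) by (unfold seg, Re; simpl; ring).
(* The cross product of [seg u t] and [u]: its sign compares their arguments, which differ by less
   than pi. *)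
assert (E3 : Cmod u * Cmod (seg u t) * sin (th - ps) = (1 - t) * Im u).
{ rewrite sin_minus. transitivity (Im u * Re (seg u t) - Re u * Im (seg u t)).
  - rewrite U1, U2, S1, S2. ring.
  - rewrite E1, E2. ring. }
assert (Pus : 0 < Cmod u * Cmod (seg u t)) by (apply Rmult_lt_0_compat; assumption).
destruct (Rle_dec 0 (Im u)) as [h|h].
- left. split; apply sin_nonneg_var || (apply Rminus_le_0, sin_nonneg_var); try lra; apply Rnot_lt_le; intros X.
  + assert (Cmod (seg u t) * sin ps < 0) by nra. nra.
  + assert (Cmod u * Cmod (seg u t) * sin (th - ps) < 0) by nra. nra.
- right. assert (Hp : 0 <= - ps).
  { apply sin_nonneg_var; [lra|]. rewrite sin_neg. apply Rnot_lt_le; intros X.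
    assert (0 < Cmod (seg u t) * sin ps) by nra. nra. }
  assert (Hq : 0 <= ps - th).
  { apply sin_nonneg_var; [lra|]. replace (ps - th) with (- (th - ps)) by ring. rewrite sin_neg.
    apply Rnot_lt_le; intros X.
    assert (0 < Cmod u * Cmod (seg u t) * sin (th - ps)) by nra. nra. }
  lra.
Qed.

Lemma Re_CInt_pos (h : R -> C) : (forall t, 0 <= t <= 1 -> continuous h t) ->
  (forall t, 0 < t < 1 -> 0 < Re (h t)) -> 0 < Re (CInt h 0 1).
Proof.
intros Hc Hp. rewrite CInt_Re by (trivial; lra). apply RInt_gt_0; [lra|exact Hp|].
intros t Ht. apply continuous_Re, Hc, Ht.
Qed.

Lemma Re_CInt_nonneg (h : R -> C) : (forall t, 0 <= t <= 1 -> continuous h t) ->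
  (forall t, 0 < t < 1 -> 0 <= Re (h t)) -> 0 <= Re (CInt h 0 1).
Proof.
intros Hc Hp. rewrite CInt_Re by (trivial; lra). apply RInt_ge_0; [lra| |exact Hp].
apply (ex_RInt_continuous (V := R_CompleteNormedModule)). intros t Ht.
rewrite Rmin_left, Rmax_right in Ht by lra. apply continuous_Re, Hc, Ht.
Qed.

Lemma dominant'_scal (c : R) u (k : C) : -1 < c -> 0 < Re u ->
  (k * dominant' c u)%C = (RtoC (c + 1) * CInt (fun t => (k * (RtoC t * Crpower (seg u t) (c - 1)%R))%C) 0 1)%C.
Proof.
intros Hc Hu. unfold dominant'.
assert (E : CInt (fun t => (k * (RtoC t * Crpower (seg u t) (c - 1)))%C) 0 1 =
  (k * CInt (fun t => (RtoC t * Crpower (seg u t) (c - 1))%C) 0 1)%C)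
  by exact (CInt_scal 0 1 Rle_0_1 k _ (fun t Ht => tA_continuous c u t Hu Ht)).
rewrite E. as_Ceq. ring.
Qed.

Lemma Re_Cexp_nonneg (l : C) : - (PI / 2) <= Im l <= PI / 2 -> 0 <= Re (Cexp l).
Proof.
intros [H1 H2]. unfold Re at 1; simpl. apply Rmult_le_pos; [left; apply exp_pos|apply cos_ge_0; lra].
Qed.

(** u G'(u) is the derivative of G(e^l) at l = log u. The integrand has argument arg u - (1 - c) arg
    u_t with arg u_t between 0 and arg u, hence between arg u and c arg u, inside the open strip
    because |c| <= 1. *)
Lemma dominant'_Re_pos (c : R) u : -1 < c <= 1 -> 0 < Re u -> 0 < Re (u * dominant' c u).
Proof.
intros Hc Hu. rewrite (dominant'_scal) by (trivial; lra).
rewrite re_scal_l. apply Rmult_lt_0_compat; [lra|]. apply Re_CInt_pos.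
- intros t Ht. apply continuous_Cmult; [apply continuous_const|apply tA_continuous; assumption].
- intros t Ht. replace (u * (RtoC t * Crpower (seg u t) (c - 1)%R))%C with
    (RtoC t * Cexp (Clog u + RtoC (c - 1) * Clog (seg u t)))%C.
  2:{ rewrite Cexp_plus, (Cexp_Clog u Hu). unfold Crpower, Cpower. ring. }
  rewrite re_scal_l. apply Rmult_lt_0_compat; [lra|]. apply Re_Cexp_strip.
  assert (Su := strip_Clog u Hu). assert (Sa := seg_arg u t Hu ltac:(lra)). unfold strip in *.
  rewrite im_plus, im_scal_l. destruct Sa; nra.
Qed.

Lemma dominant'_neq_0 (c : R) u : -1 < c <= 1 -> 0 < Re u -> dominant' c u <> 0.
Proof.
intros Hc Hu E. assert (H := dominant'_Re_pos c u Hc Hu). rewrite E, Cmult_0_r in H.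
unfold Re in H; simpl in H; lra.
Qed.

Lemma strip_convex (l m : C) t : strip l -> strip m -> 0 <= t <= 1 ->
  strip (RtoC t * l + RtoC (1 - t) * m).
Proof.
unfold strip. rewrite im_plus, !im_scal_l. intros Hl Hm Ht.
destruct (Req_dec t 0) as [->|n]; [lra|].
assert (0 <= (1 - t) * (Im m + PI / 2)) by (apply Rmult_le_pos; lra).
assert (0 <= (1 - t) * (PI / 2 - Im m)) by (apply Rmult_le_pos; lra).
assert (0 < t * (Im l + PI / 2)) by (apply Rmult_lt_0_compat; lra).
assert (0 < t * (PI / 2 - Im l)) by (apply Rmult_lt_0_compat; lra).
lra.
Qed.

(** The Noshiro-Warschawski argument for G(e^l) on the strip: the strip is convex, so the derivative
    with positive real part can be followed along the segment from log u to log v. *)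
Lemma dominant_inj (c : R) u v : -1 < c <= 1 -> 0 < Re u -> 0 < Re v -> dominant c u = dominant c v -> u = v.
Proof.
intros Hc Hu Hv E.
assert (Su := strip_Clog u Hu). assert (Sv := strip_Clog v Hv).
set (p := Clog u) in *. set (d := (Clog v - p)%C).
destruct (Ceq_dec d 0) as [E0|n].
{ rewrite <- (Cexp_Clog u Hu), <- (Cexp_Clog v Hv). f_equal. symmetry. apply Ceq_minus, E0. }
exfalso.
assert (Hst : forall s, 0 <= s <= 1 -> strip (p + RtoC s * d)).
{ intros s Hs. replace (p + RtoC s * d)%C with (RtoC s * Clog v + RtoC (1 - s) * p)%C
    by (unfold d; rewrite RtoC_minus; ring).
  apply strip_convex; assumption. }
set (h := fun s => Re (Cconj d * dominant c (Cexp (p + RtoC s * d)))).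
set (h' := fun s => Re (Cconj d * (dominant' c (Cexp (p + RtoC s * d)) * (Cexp (p + RtoC s * d) * d)))).
assert (Hh : forall s, 0 <= s <= 1 -> is_derive h s (h' s)).
{ intros s Hs. apply path_Re, path_scal. apply (path_comp (dominant c)).
  - apply dominant_derive, Re_Cexp_strip, Hst, Hs.
  - apply (path_comp Cexp); [apply Cderiv_Cexp|apply path_segment]. }
destruct (MVT_gen h 0 1 h') as [s [Hs Es]].
- intros s Hs. rewrite Rmin_left, Rmax_right in Hs by lra. apply Hh; lra.
- intros s Hs. rewrite Rmin_left, Rmax_right in Hs by lra.
  apply continuity_pt_filterlim, (ex_derive_continuous (V := R_NormedModule)). eexists. apply Hh; lra.
- rewrite Rmin_left, Rmax_right in Hs by lra.
  assert (E1 : h 1 = h 0).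
  { unfold h. replace (p + RtoC 1 * d)%C with (Clog v) by (unfold d; ring).
    replace (p + RtoC 0 * d)%C with (Clog u) by (unfold p; ring).
    rewrite !Cexp_Clog by assumption. rewrite E. reflexivity. }
  rewrite E1 in Es.
  assert (X := dominant'_Re_pos c _ Hc (Re_Cexp_strip _ (Hst s Hs))).
  assert (E2 : h' s = Cmod d ^ 2 * Re (Cexp (p + RtoC s * d) * dominant' c (Cexp (p + RtoC s * d)))).
  { unfold h'. rewrite <- re_scal_l. f_equal. rewrite RtoC_pow, <- RtoC_pow, Cmod2_conj. ring. }
  assert (0 < Cmod d ^ 2) by (apply pow_lt, Cmod_gt_0, n). nra.
Qed.

(** * Admissibility *)

Lemma ln_cos_derive x : - (PI / 2) < x < PI / 2 -> is_derive (fun x => ln (cos x)) x (- tan x).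
Proof.
intros H. assert (P := cos_gt_0 x ltac:(lra) ltac:(lra)).
auto_derive; [exact P|]. unfold tan. field. lra.
Qed.

Lemma ln_cos_tangent x y : - (PI / 2) < x < PI / 2 -> - (PI / 2) < y < PI / 2 ->
  ln (cos x) <= ln (cos y) - tan y * (x - y).
Proof.
intros Hx Hy.
assert (tan_le : forall a b, - (PI / 2) < a -> a <= b -> b < PI / 2 -> tan a <= tan b).
{ intros a b H1 [H2| ->] H3; [left; apply tan_increasing; lra|lra]. }
destruct (MVT_gen (fun x => ln (cos x)) y x (fun x => - tan x)) as [s [Hs Es]].
- intros s Hs. apply ln_cos_derive. unfold Rmin, Rmax in Hs. destruct (Rle_dec y x); lra.
- intros s Hs. apply continuity_pt_filterlim, (ex_derive_continuous (V := R_NormedModule) (fun x => ln (cos x))).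
  eexists. apply ln_cos_derive. unfold Rmin, Rmax in Hs. destruct (Rle_dec y x); lra.
- unfold Rmin, Rmax in Hs. destruct (Rle_dec y x) as [h|h].
  + assert (T := tan_le y s ltac:(lra) ltac:(lra) ltac:(lra)). nra.
  + assert (T := tan_le s y ltac:(lra) ltac:(lra) ltac:(lra)). nra.
Qed.

Lemma ln_Re_Cexp (l : C) : strip l -> ln (Re (Cexp l)) = Re l + ln (cos (Im l)).
Proof.
intros [H1 H2]. unfold Re at 1; simpl. rewrite ln_mult, ln_exp; [reflexivity|apply exp_pos|apply cos_gt_0; lra].
Qed.

(** Concavity of x + ln (cos y): in logarithmic coordinates the half-plane Re u > 1/2 is convex. The
    tangent to ln cos at the averaged ordinate lies above both values, and its slope terms cancel on
    averaging. *)
Lemma ln_Re_Cexp_concave (l m : C) t : strip l -> strip m -> 0 <= t <= 1 ->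
  t * ln (Re (Cexp l)) + (1 - t) * ln (Re (Cexp m)) <= ln (Re (Cexp (RtoC t * l + RtoC (1 - t) * m))).
Proof.
intros Hl Hm Ht.
assert (Hs : strip (RtoC t * l + RtoC (1 - t) * m)).
{ apply strip_convex; assumption. }
rewrite !ln_Re_Cexp by assumption. rewrite re_plus, im_plus, !re_scal_l, !im_scal_l.
set (x := Im l). set (y := Im m). set (s := t * x + (1 - t) * y).
unfold strip in *. rewrite im_plus, !im_scal_l in Hs. fold x y in Hl, Hm, Hs. fold s in Hs.
assert (A1 := ln_cos_tangent x s Hl Hs). assert (A2 := ln_cos_tangent y s Hm Hs).
assert (B1 := Rmult_le_compat_l t _ _ (proj1 Ht) A1).
assert (B2 := Rmult_le_compat_l (1 - t) _ _ ltac:(lra) A2).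
assert (E : t * (tan s * (x - s)) + (1 - t) * (tan s * (y - s)) = 0) by (unfold s; ring).
nra.
Qed.

(* For [c <= 0] the set of values [F^(c+1)] is convex, with supporting functional
   [x |-> Re (x * u0^(-c))] at [u0^(c+1)]; for [c >= 0] its complement is convex, and the functional is
   taken at the boundary point with the same argument as [F]. *)
Lemma admissible (c s : R) u F : -1 < c <= 1 -> Re u = / 2 -> / 2 < Re F -> 0 <= s ->
  (Crpower u (c + 1) - RtoC s * dominant' c u)%C <> Crpower F (c + 1).
Proof.
intros Hc Hu HF Hs E. assert (HPI := PI_RGT_0).
assert (Hu0 : 0 < Re u) by lra. assert (HF0 : 0 < Re F) by lra.
assert (Su := strip_Clog u Hu0). assert (SF := strip_Clog F HF0).
(* The functional x -> Re (e^(-c l) x) separates the two sides: it is nonnegative on G'(u), at most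
   1/2 at u^(c+1), and above 1/2 at F^(c+1). *)
assert (key : forall l : C,
  (forall t, 0 < t < 1 -> - (PI / 2) <= - c * Im l + (c - 1) * Im (Clog (seg u t)) <= PI / 2) ->
  Re (Cexp (RtoC (c + 1) * Clog u + RtoC (- c) * l)) <= / 2 ->
  / 2 < Re (Cexp (RtoC (c + 1) * Clog F + RtoC (- c) * l)) -> False).
{ intros l H1 H2 H3.
  assert (X := f_equal (fun w => Re (Cexp (RtoC (- c) * l) * w)) E). cbv beta in X.
  rewrite Cexp_plus in H2, H3.
  change (Cexp (RtoC (c + 1) * Clog u)) with (Crpower u (c + 1)%R) in H2.
  change (Cexp (RtoC (c + 1) * Clog F)) with (Crpower F (c + 1)%R) in H3.
  rewrite Cmult_comm in H2, H3. rewrite <- X in H3. clear X.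
  replace (Cexp (RtoC (- c) * l) * (Crpower u (c + 1)%R - RtoC s * dominant' c u))%C with
    (Cexp (RtoC (- c) * l) * Crpower u (c + 1)%R - RtoC s * (Cexp (RtoC (- c) * l) * dominant' c u))%C in H3 by ring.
  unfold Cminus in H3. rewrite re_plus, re_opp, re_scal_l in H3.
  assert (H4 : 0 <= Re (Cexp (RtoC (- c) * l) * dominant' c u)).
  { rewrite (dominant'_scal) by (trivial; lra).
    rewrite re_scal_l. apply Rmult_le_pos; [lra|]. apply Re_CInt_nonneg.
    - intros t Ht. apply continuous_Cmult; [apply continuous_const|apply tA_continuous; assumption].
    - intros t Ht. replace (Cexp (RtoC (- c) * l) * (RtoC t * Crpower (seg u t) (c - 1)%R))%C with
        (RtoC t * Cexp (RtoC (- c) * l + RtoC (c - 1) * Clog (seg u t)))%C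
        by (rewrite Cexp_plus; unfold Crpower, Cpower; ring).
      rewrite re_scal_l. apply Rmult_le_pos; [lra|]. apply Re_Cexp_nonneg.
      rewrite im_plus, !im_scal_l. apply H1, Ht. }
  nra. }
assert (Hl2 : ln (/ 2) < ln (Re F)) by (apply ln_increasing; lra).
destruct (Rle_dec c 0) as [h|h].
(* Here the functional takes exactly the value Re u = 1/2 at u^(c+1); at F^(c+1) concavity applies
   with weights c + 1 and -c. *)
- apply (key (Clog u)).
  + intros t Ht. assert (Sa := seg_arg u t Hu0 ltac:(lra)). unfold strip in Su. destruct Sa; nra.
  + replace (RtoC (c + 1) * Clog u + RtoC (- c) * Clog u)%C with (Clog u).
    * rewrite Cexp_Clog by exact Hu0. lra.
    * rewrite RtoC_plus, RtoC_opp. ring.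
  + assert (Hst : strip (RtoC (c + 1) * Clog F + RtoC (- c) * Clog u)).
    { replace (- c) with (1 - (c + 1)) by ring. apply strip_convex; trivial; lra. }
    assert (X := ln_Re_Cexp_concave (Clog F) (Clog u) (c + 1) SF Su ltac:(lra)).
    rewrite !Cexp_Clog in X by assumption. rewrite Hu in X.
    replace (1 - (c + 1)) with (- c) in X by ring.
    apply ln_lt_inv; [lra|apply Re_Cexp_strip, Hst|]. nra.
- set (phi := Im (Clog F)). unfold strip in SF. fold phi in SF.
  assert (Pc := cos_gt_0 phi ltac:(lra) ltac:(lra)).
  (* The logarithm of the point with argument [phi] on the line Re = 1/2. *)
  set (l := (- ln (2 * cos phi), phi) : C).
  assert (Sl : strip l) by (unfold strip; simpl; lra).
  assert (El : ln (Re (Cexp l)) = ln (/ 2)).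
  { rewrite ln_Re_Cexp by exact Sl. simpl. rewrite ln_mult, ln_Rinv by lra. ring. }
  assert (EF : ln (Re F) = Re (Clog F) + ln (cos phi)).
  { rewrite <- (Cexp_Clog F HF0) at 1. rewrite ln_Re_Cexp; [reflexivity|]. exact SF. }
  apply (key l).
  + intros t Ht. assert (Sa := seg_arg u t Hu0 ltac:(lra)). unfold strip in Su. change (Im l) with phi.
    assert (Ss := strip_Clog _ (seg_RHP u t Hu0 ltac:(lra))). unfold strip in Ss.
    set (ps := Im (Clog (seg u t))) in *.
    assert (0 <= c * (PI / 2 - phi)) by (apply Rmult_le_pos; lra).
    assert (0 <= c * (PI / 2 + phi)) by (apply Rmult_le_pos; lra).
    assert (0 <= (1 - c) * (PI / 2 - ps)) by (apply Rmult_le_pos; lra).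
    assert (0 <= (1 - c) * (PI / 2 + ps)) by (apply Rmult_le_pos; lra).
    lra.
  (* [Clog u] is the convex combination of [m] and [l] with weights 1/(c + 1) and c/(c + 1), so
     concavity bounds Re (e^m) from above by 1/2, as Re u = Re (e^l) = 1/2. *)
  + set (m := (RtoC (c + 1) * Clog u + RtoC (- c) * l)%C).
    destruct (classic (strip m)) as [Sm|Sm].
    * assert (X := ln_Re_Cexp_concave m l (/ (c + 1)) Sm Sl).
      assert (Hi : 0 < / (c + 1)) by (apply Rinv_0_lt_compat; lra).
      assert (Hi1 : / (c + 1) <= 1) by (rewrite <- Rinv_1; apply Rinv_le_contravar; lra).
      specialize (X ltac:(lra)).
      replace (RtoC (/ (c + 1)) * m + RtoC (1 - / (c + 1)) * l)%C with (Clog u) in X.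
      2:{ unfold m. assert (Hn := RtoC_neq_0 (c + 1) ltac:(lra)).
          rewrite RtoC_minus, RtoC_inv, RtoC_opp by lra. rewrite RtoC_plus in *. field. exact Hn. }
      rewrite Cexp_Clog, El, Hu in X by exact Hu0.
      apply Rnot_lt_le. intros Y. apply ln_increasing in Y; [|lra].
      assert (Z := Rmult_lt_compat_l _ _ _ Hi Y). lra.
    (* Outside the strip |Im m| still stays within 3 pi/2, where the cosine is nonpositive. *)
    * apply Rle_trans with 0; [|lra]. unfold Re at 1; simpl.
      assert (Pe := exp_pos (Re m)).
      assert (cos (Im m) <= 0); [|change (exp (Re m) * cos (Im m) <= 0); nra].
      unfold strip in *.
      assert (B : - (3 * (PI / 2)) <= Im m <= 3 * (PI / 2)).
      { unfold m. rewrite im_plus, !im_scal_l. change (Im l) with phi.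
        set (th := Im (Clog u)) in *.
        assert (0 <= c * (PI / 2 - phi)) by (apply Rmult_le_pos; lra).
        assert (0 <= c * (PI / 2 + phi)) by (apply Rmult_le_pos; lra).
        assert (0 <= (c + 1) * (PI / 2 - th)) by (apply Rmult_le_pos; lra).
        assert (0 <= (c + 1) * (PI / 2 + th)) by (apply Rmult_le_pos; lra).
        assert (0 <= (1 - c) * (PI / 2)) by (apply Rmult_le_pos; lra).
        lra. }
      destruct (Rle_dec (PI / 2) (Im m)) as [h1|h1]; [apply cos_le_0; lra|].
      rewrite <- cos_neg. apply cos_le_0; lra.
  (* Since [l] and [Clog F] share the imaginary part [phi], so does this combination, and only the
     real parts have to be compared. *)
  + assert (Sm : strip (RtoC (c + 1) * Clog F + RtoC (- c) * l)).
    { unfold strip. rewrite im_plus, !im_scal_l. change (Im l) with phi. fold phi. lra. }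
    apply ln_lt_inv; [lra|apply Re_Cexp_strip, Sm|].
    rewrite ln_Re_Cexp by exact Sm. rewrite im_plus, re_plus, !im_scal_l, !re_scal_l.
    rewrite ln_Re_Cexp in El by exact Sl. change (Im l) with phi in *. fold phi.
    replace ((c + 1) * phi + - c * phi) with phi by ring. nra.
Qed.

(** * The subordination *)

Lemma dominant_1 c : dominant c 1 = 1.
Proof.
assert (E := dominant_ode c 1 ltac:(unfold Re; simpl; lra)).
unfold Crpower, Cpower in E. rewrite Clog_1 in E.
replace (RtoC (c + 1) * 0)%C with (RtoC 0) in E by ring. rewrite Cexp_0 in E.
replace (dominant c 1) with (dominant c 1 + 1 * (1 - 1) * dominant' c 1)%C by ring. exact E.
Qed.

Lemma Cmod_Crpower u a : 0 < Re u -> Cmod (Crpower u a) = exp (a * ln (Cmod u)).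
Proof. intros Hu. unfold Crpower, Cpower. rewrite Cmod_Cexp, re_scal_l. reflexivity. Qed.

Lemma Cmod_minus_le a b : Cmod (a - b) <= Cmod a + Cmod b.
Proof. unfold Cminus. eapply Rle_trans; [apply Cmod_triangle|]. rewrite Cmod_opp. lra. Qed.

Lemma Cmod_minus_ge a b : Cmod a - Cmod b <= Cmod (a - b).
Proof.
assert (X := Cmod_triangle (a - b) b). replace (a - b + b)%C with a in X by ring. lra.
Qed.

(** Logarithmic growth at infinity: |u^c - 1| >= |u|^c - 1 >= c ln |u|, and the factor c cancels
    against the one in the closed form. The case c = 0 is the logarithm itself. *)
Lemma dominant_growth c u : 0 <= c -> 0 < Re u -> 1 <= Cmod u ->
  Cmod u * ln (Cmod u) <= Cmod (dominant c u) * (Cmod u + 1).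
Proof.
intros Hc Hu H1. assert (L : 0 <= ln (Cmod u)) by (rewrite <- ln_1; apply ln_le; lra).
assert (B := Cmod_minus_le u 1). rewrite Cmod_1 in B.
apply Rle_trans with (Cmod (dominant c u) * Cmod (u - 1)); [|apply Rmult_le_compat_l; [apply Cmod_ge_0|exact B]].
destruct (Rle_lt_or_eq_dec _ _ Hc) as [h|h].
- assert (E := f_equal Cmod (dominant_explicit c u Hu)).
  rewrite !Cmod_mult, Cmod_R, Rabs_pos_eq in E by lra.
  assert (X := Cmod_minus_ge (Crpower u c) 1). rewrite Cmod_1, Cmod_Crpower in X by exact Hu.
  assert (Y := exp_ineq1_le (c * ln (Cmod u))).
  apply Rmult_le_reg_l with c; [exact h|].
  replace (c * (Cmod (dominant c u) * Cmod (u - 1))) with (c * Cmod (u - 1) * Cmod (dominant c u)) by ring.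
  rewrite E. replace (c * (Cmod u * ln (Cmod u))) with (Cmod u * (c * ln (Cmod u))) by ring.
  apply Rmult_le_compat_l; lra.
- rewrite <- h. assert (E := f_equal Cmod (dominant_explicit_0 u Hu)).
  rewrite !Cmod_mult in E. rewrite (Rmult_comm (Cmod (dominant _ _))), E.
  apply Rmult_le_compat_l; [lra|].
  apply Rle_trans with (2 := re_le_Cmod _). apply Rle_trans with (2 := Rle_abs _). simpl. lra.
Qed.

(** For -1 < c < 0 this isolates the deviation of [dominant c] from its limit -1/c at infinity. *)
Lemma dominant_neg_explicit c u : 0 < Re u ->
  ((RtoC c * dominant c u + 1) * (u - 1) = Crpower u (c + 1) - 1)%C.
Proof.
intros Hu. rewrite Crpower_plus, (Crpower_1 u Hu).
transitivity (RtoC c * (u - 1) * dominant c u + (u - 1))%C; [ring|].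
rewrite dominant_explicit by exact Hu. ring.
Qed.

Lemma half_plane_disk u : / 2 < Re u -> Cmod (1 - / u) < 1.
Proof.
intros Hu. assert (Hn : u <> 0) by (apply RHP_neq_0; lra). assert (P := proj1 (Cmod_gt_0 _) Hn).
assert (E : Cmod (u - 1) ^ 2 = Cmod u ^ 2 - 2 * Re u + 1) by (rewrite !Cmod2_alt; unfold Re, Im; simpl; ring).
replace (1 - / u)%C with ((u - 1) / u)%C by (field; exact Hn).
rewrite Cmod_div by exact Hn. apply Rmult_lt_reg_r with (Cmod u); [exact P|].
replace (Cmod (u - 1) / Cmod u * Cmod u) with (Cmod (u - 1)) by (field; lra).
apply Rsqr_incrst_0; [|apply Cmod_ge_0|lra]. rewrite !Rsqr_pow2. nra.
Qed.

Lemma half_line_circle u : Re u = / 2 -> Cmod (1 - / u) = 1 /\ (u * (u - 1))%C = (- RtoC (Cmod u ^ 2))%C.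
Proof.
intros Hu. assert (Hn : u <> 0) by (apply RHP_neq_0; lra). assert (P := proj1 (Cmod_gt_0 _) Hn).
split.
- assert (E : Cmod (u - 1) ^ 2 = Cmod u ^ 2 - 2 * Re u + 1) by (rewrite !Cmod2_alt; unfold Re, Im; simpl; ring).
  replace (1 - / u)%C with ((u - 1) / u)%C by (field; exact Hn).
  rewrite Cmod_div by exact Hn.
  assert (Cmod (u - 1) = Cmod u).
  { apply Rsqr_inj; try apply Cmod_ge_0. rewrite !Rsqr_pow2, E, Hu. field. }
  rewrite H. field. lra.
- rewrite RtoC_pow, <- RtoC_pow, Cmod2_alt. destruct u as [x y]. unfold Re, Im in *; simpl in *.
  apply injective_projections; simpl; subst x; field.
Qed.

Lemma dominant_k_fun alpha z : disk z ->
  div_by_z (k_fun alpha) z = dominant (1 - 2 * alpha) (/ (1 - z)).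
Proof.
intros Hz. unfold div_by_z. destruct (Ceq_dec z 0) as [->|n].
{ replace (/ (1 - 0))%C with (RtoC 1) by (field; replace (1 - 0)%C with (RtoC 1) by ring; exact C1_nz).
  symmetry. apply dominant_1. }
assert (Hu := Re_inv_gt_half z Hz). set (u := (/ (1 - z))%C) in *.
assert (Hu0 : 0 < Re u) by lra. assert (Hun := RHP_neq_0 u Hu0).
assert (Hz1 : 0 < Re (1 - z)).
{ unfold Cminus. rewrite re_plus, re_opp, re_RtoC. assert (X := re_le_Cmod z). unfold disk in Hz.
  assert (Y := Rle_abs (Re z)). lra. }
assert (Hzn := RHP_neq_0 _ Hz1).
assert (Eu : (u - 1)%C = (z * u)%C) by (unfold u; field; exact Hzn).
assert (EL : Clog u = (- Clog (1 - z))%C).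
{ assert (S := strip_Clog _ Hz1).
  assert (S' : strip (- Clog (1 - z))) by (unfold strip in *; rewrite im_opp; lra).
  rewrite <- (Clog_Cexp _ S'). f_equal.
  assert (X := Cexp_opp (Clog (1 - z))). rewrite Cexp_Clog in X by exact Hz1.
  transitivity (/ (1 - z) * ((1 - z) * Cexp (- Clog (1 - z))))%C; [rewrite X; unfold u; ring|field; exact Hzn]. }
unfold k_fun. destruct (Req_EM_T alpha (1 / 2)) as [->|na].
- rewrite <- EL. replace (1 - 2 * (1 / 2)) with 0 by field.
  assert (E := dominant_explicit_0 u Hu0). rewrite Eu in E.
  replace (Clog u) with (z * dominant 0 u)%C; [field; exact n|].
  transitivity (z * u * dominant 0 u / u)%C; [field; exact Hun|]. rewrite E. field. exact Hun.
- set (c := 1 - 2 * alpha). assert (Hc : RtoC c <> 0) by (apply RtoC_neq_0; unfold c; lra).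
  assert (E := dominant_explicit c u Hu0). rewrite Eu in E.
  assert (EP : Cpower (1 - z) (2 * alpha - 1)%R = Crpower u c).
  { unfold Crpower, Cpower. f_equal. rewrite EL. replace (2 * alpha - 1) with (- c) by (unfold c; ring).
    rewrite RtoC_opp. ring. }
  rewrite EP. replace (1 - 2 * alpha)%C with (RtoC c) by (unfold c; rewrite RtoC_minus, RtoC_mult; reflexivity).
  replace (Crpower u c - 1)%C with (RtoC c * z * dominant c u)%C; [field; split; assumption|].
  transitivity (RtoC c * (z * u) * dominant c u / u)%C; [field; exact Hun|]. rewrite E. field. exact Hun.
Qed.

Section Main.
Variables (alpha : R) (f : C -> C).
Hypothesis Halpha : 0 <= alpha < 1.
Hypothesis Hf : convex_of_order alpha f.

Let c := 1 - 2 * alpha.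
Let P := radial_mean (C_derive f).

Lemma c_range : -1 < c <= 1.
Proof. unfold c. lra. Qed.

Lemma f_holo : holo_disk f.
Proof. intros z Hz. destruct (proj1 Hf z Hz) as [l Hl]. exists l. apply is_derive_Cderiv, Hl. Qed.

Lemma P_holo z : disk z -> exists m, Cderiv P z m /\ C_derive f z = (P z + z * m)%C.
Proof.
intros Hz. assert (Hh := holo_disk_C_derive f f_holo).
eexists. split; [apply radial_mean_derive; assumption|].
apply (Cderiv_unique (fun z => (z * P z)%C) z); [apply radial_primitive; assumption|].
eapply Cderiv_eq; [apply Cderiv_mult; [apply Cderiv_id|apply radial_mean_derive; assumption]|].
fold P. cbv beta. ring.
Qed.

Lemma P_continuous z : disk z -> continuous P z.
Proof. intros Hz. destruct (P_holo z Hz) as [m [Hm _]]. apply Cderiv_continuous with m, Hm. Qed.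

Lemma P_0 : P 0 = 1.
Proof. unfold P. rewrite radial_mean_0. apply Hf. Qed.

Lemma P_div z : disk z -> div_by_z f z = P z.
Proof.
intros Hz. unfold div_by_z. destruct (Ceq_dec z 0) as [->|n]; [symmetry; apply P_0|].
rewrite (radial_mean_C_derive f z f_holo (proj1 (proj2 Hf)) Hz). fold P. field. exact n.
Qed.

Variable U : C -> C.
Hypothesis HU : forall z, (exists u, 0 < Re u /\ P z = dominant c u) -> 0 < Re (U z) /\ P z = dominant c (U z).

Let om z : C := (1 - / U z)%C.
(** [U] inverts [dominant c] on Re u > 0, while [Good] asks for Re u > 1/2; the margin keeps [U]
    differentiable at a value on the line Re u = 1/2. *)
Let Good z : Prop := exists u, / 2 < Re u /\ P z = dominant c u.

Lemma RHP_open u : 0 < Re u -> locally u (fun u => 0 < Re u).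
Proof. apply open_halfplane, continuous_ReC. Qed.

Lemma U_value z u : 0 < Re u -> P z = dominant c u -> U z = u.
Proof.
apply (inverse_value (fun u => 0 < Re u) (dominant c)); [|exact HU].
intros u' v' Hu Hv E. apply (dominant_inj c); trivial. apply c_range.
Qed.

Lemma U_derive z u m : 0 < Re u -> P z = dominant c u -> Cderiv P z m -> Cderiv U z (m / dominant' c u).
Proof.
apply (inverse_derive (fun u => 0 < Re u) (dominant c) (dominant' c)).
- apply RHP_open.
- intros v Hv. apply dominant_derive, Hv.
- intros v Hv. apply dominant'_neq_0; [apply c_range|exact Hv].
- intros u' v' Hu Hv E. apply (dominant_inj c); trivial. apply c_range.
- exact HU.
Qed.

Lemma Good_U z : Good z -> / 2 < Re (U z) /\ P z = dominant c (U z).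
Proof. intros [u [Hu E]]. rewrite (U_value z u); [split; assumption|lra|exact E]. Qed.

Lemma om_derive z u m : 0 < Re u -> P z = dominant c u -> Cderiv P z m ->
  Cderiv om z (m / dominant' c u / (u * u)).
Proof.
intros Hu E Hm. assert (EU := U_value z u Hu E). assert (Hn := RHP_neq_0 u Hu).
assert (Hd := dominant'_neq_0 c u c_range Hu).
eapply Cderiv_eq.
- apply Cderiv_minus; [apply Cderiv_const|]. apply Cderiv_inv; [rewrite EU; exact Hn|].
  apply (U_derive z u m Hu E Hm).
- rewrite EU. field. split; assumption.
Qed.

Lemma om_holo z : disk z -> Good z -> holo_at om z.
Proof.
intros Hz HG. destruct (Good_U z HG) as [HUz E]. destruct (P_holo z Hz) as [m [Hm _]].
eexists. apply (om_derive z (U z) m); [lra|exact E|exact Hm].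
Qed.

Lemma om_lt_1 z : Good z -> Cmod (om z) < 1.
Proof. intros HG. apply half_plane_disk, Good_U, HG. Qed.

Lemma U_0 : U 0 = 1.
Proof. apply U_value; [unfold Re; simpl; lra|]. rewrite dominant_1. apply P_0. Qed.

Lemma om_0 : om 0 = 0.
Proof. unfold om. rewrite U_0. field. Qed.

Lemma Good_0 : Good 0.
Proof. exists 1. split; [unfold Re; simpl; lra|]. rewrite dominant_1. apply P_0. Qed.

Lemma Good_open z : disk z -> Good z -> locally z Good.
Proof.
intros Hz HG. destruct (Good_U z HG) as [HUz E].
destruct (proj1 (locally_disk _ _) (open_halfplane (fun w : C => Re w) (/ 2) continuous_ReC _ HUz)) as [d [Hd HH]].
generalize (inverse_near (fun u => 0 < Re u) (dominant c) (dominant' c) RHP_open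
  (fun v Hv => dominant_derive c v Hv) (fun v Hv => dominant'_neq_0 c v c_range Hv)
  (fun u v Hu Hv => dominant_inj c u v c_range Hu Hv) P U HU z (U z) ltac:(lra) E (P_continuous z Hz) d Hd).
apply filter_imp. intros w [_ [E' Hw]]. exists (U w). split; [apply HH, Hw|exact E'].
Qed.

(** * A point of the boundary circle *)

Section Circle.
Variables (r : R) (z0 : C).
Hypothesis Hr : 0 < r < 1.
Hypothesis HG : forall z, Cmod z < r -> Good z.
Hypothesis Hz0 : Cmod z0 = r.

Lemma z0_disk : disk z0.
Proof. unfold disk. lra. Qed.

Lemma om_schwarz z : Cmod z < r -> Cmod (om z) <= Cmod z / r.
Proof.
apply schwarz.
- intros w Hw. apply om_holo; [unfold disk; lra|apply HG, Hw].
- intros w Hw. left. apply om_lt_1, HG, Hw.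
- apply om_0.
Qed.

(** A sequence on the radius of [z0]; the offset 2 keeps the scaling factor at least 1/2. *)
Let zn (n : nat) : C := (RtoC (1 - / (INR n + 2)) * z0)%C.
Let un (n : nat) : C := U (zn n).

Lemma inv_n n : 0 < / (INR n + 2) <= / 2.
Proof.
assert (X := pos_INR n). split; [apply Rinv_0_lt_compat; lra|apply Rinv_le_contravar; lra].
Qed.

Lemma zn_mod n : Cmod (zn n) = (1 - / (INR n + 2)) * r.
Proof. unfold zn. assert (X := inv_n n). rewrite Cmod_mult, Cmod_R, Hz0, Rabs_pos_eq; lra. Qed.

Lemma zn_dist n : Cmod (zn n - z0) <= / (INR n + 2).
Proof.
unfold zn. assert (X := inv_n n).
replace (RtoC (1 - / (INR n + 2)) * z0 - z0)%C with (- (RtoC (/ (INR n + 2)) * z0))%C by (rewrite RtoC_minus; ring).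
rewrite Cmod_opp, Cmod_mult, Cmod_R, Hz0, Rabs_pos_eq; nra.
Qed.

Lemma zn_near d : 0 < d -> exists N, forall n, (N <= n)%nat -> Cmod (zn n - z0) < d.
Proof.
intros Hd. destruct (archimed_cor1 d Hd) as [N [HN HN0]]. exists N. intros n Hn.
apply Rle_lt_trans with (1 := zn_dist n). apply Rle_lt_trans with (2 := HN).
apply Rinv_le_contravar; [apply lt_0_INR, HN0|]. apply le_INR in Hn. lra.
Qed.

(** The bound on |un| comes from 1/U = 1 - om and Schwarz's lemma: |om| <= 1 - 1/(n + 2) at [zn n],
    so |1/U| >= 1/(n + 2). *)
Lemma un_spec n : / 2 < Re (un n) /\ P (zn n) = dominant c (un n) /\ Cmod (un n) <= INR n + 2.
Proof.
assert (X := inv_n n). assert (Y := pos_INR n).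
assert (Hzn : Cmod (zn n) < r) by (rewrite zn_mod; nra).
destruct (Good_U (zn n) (HG _ Hzn)) as [H1 H2]. split; [exact H1|]. split; [exact H2|].
assert (S := om_schwarz (zn n) Hzn). rewrite zn_mod in S.
replace ((1 - / (INR n + 2)) * r / r) with (1 - / (INR n + 2)) in S by (field; lra).
unfold om in S. change (U (zn n)) with (un n) in *.
assert (Hn := RHP_neq_0 (un n) ltac:(lra)). assert (Pu := proj1 (Cmod_gt_0 _) Hn).
assert (T := Cmod_minus_ge 1 (1 - / un n)). replace (1 - (1 - / un n))%C with (/ un n)%C in T by ring.
rewrite Cmod_1, Cmod_inv in T by exact Hn.
rewrite <- (Rinv_inv (Cmod (un n))), <- (Rinv_inv (INR n + 2)). apply Rinv_le_contravar; lra.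
Qed.

(** The rate 1/(n + 2) is the one that the bound |un| <= n + 2 turns into 1/|un|. *)
Lemma P_lipschitz : exists K N, 0 < K /\ forall n, (N <= n)%nat -> Cmod (P (zn n) - P z0) <= K * / (INR n + 2).
Proof.
destruct (P_holo z0 z0_disk) as [m [Hm _]].
destruct (proj1 (Cderiv_eps _ _ _) Hm 1 Rlt_0_1) as [d [Hd H]].
destruct (zn_near d Hd) as [N HN]. exists (Cmod m + 1), N. assert (X := Cmod_ge_0 m). split; [lra|].
intros n Hn. specialize (H _ (HN n Hn)).
assert (T := Cmod_minus_ge (P (zn n) - P z0) (m * (zn n - z0))). rewrite Cmod_mult in T.
apply Rle_trans with ((Cmod m + 1) * Cmod (zn n - z0)); [lra|].
apply Rmult_le_compat_l; [lra|apply zn_dist].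
Qed.

(* The values [un n] do not tend to infinity.  For [c < 0] the function [dominant c] has the finite
   limit [-1/c] at infinity, but approaches it more slowly than the Lipschitz function [P] can. *)
Lemma un_bounded : exists B, forall N, exists n, (N <= n)%nat /\ Cmod (un n) <= B.
Proof.
apply NNPP. intros Hno.
assert (Hinf : forall B, exists N, forall n, (N <= n)%nat -> B < Cmod (un n)).
{ intros B. apply NNPP. intros H. apply Hno. exists B. intros N. apply NNPP. intros H'.
  apply H. exists N. intros n Hn. apply Rnot_le_lt. intros h. apply H'. exists n. split; assumption. }
clear Hno.
destruct P_lipschitz as [K [N0 [HK HP]]].
(* For c >= 0 the logarithmic growth of [dominant c] contradicts the boundedness of [P] along the
   sequence. *)
destruct (Rle_dec 0 c) as [hc|hc].
- set (M := Cmod (P z0) + K). assert (HM : 0 < M) by (unfold M; generalize (Cmod_ge_0 (P z0)); lra).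
  destruct (Hinf (Rmax 1 (exp (2 * M)))) as [N1 H1].
  set (n := Nat.max N0 N1). specialize (H1 n ltac:(lia)). specialize (HP n ltac:(lia)).
  destruct (un_spec n) as [U1 [U2 _]]. assert (X := inv_n n).
  assert (L1 := Rle_lt_trans _ _ _ (Rmax_l _ _) H1). assert (L2 := Rle_lt_trans _ _ _ (Rmax_r _ _) H1).
  assert (G := dominant_growth c (un n) hc ltac:(lra) ltac:(lra)). rewrite <- U2 in G.
  assert (T := Cmod_minus_ge (P (zn n)) (P z0)).
  assert (PM : Cmod (P (zn n)) <= M) by (unfold M; nra).
  assert (LL : 2 * M < ln (Cmod (un n))) by (rewrite <- (ln_exp (2 * M)); apply ln_increasing; [apply exp_pos|exact L2]).
  assert (Q := Cmod_ge_0 (P (zn n))). nra.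
- apply Rnot_le_lt in hc. assert (Hcr := c_range).
  (* [A] vanishes exactly when P(z0) is the limit -1/c of [dominant c] at infinity. *)
  set (A := (RtoC c * P z0 + 1)%C).
  assert (HAn : forall n, (N0 <= n)%nat -> Cmod (RtoC c * P (zn n) + 1 - A) <= K * / (INR n + 2)).
  { intros n Hn. unfold A. replace (RtoC c * P (zn n) + 1 - (RtoC c * P z0 + 1))%C with (RtoC c * (P (zn n) - P z0))%C by ring.
    rewrite Cmod_mult, Cmod_R, Rabs_left by lra. specialize (HP n Hn).
    assert (Q := Cmod_ge_0 (P (zn n) - P z0)). nra. }
  assert (Hmod : forall n, Cmod (RtoC c * P (zn n) + 1) * Cmod (un n - 1) = Cmod (Crpower (un n) (c + 1) - 1)).
  { intros n. destruct (un_spec n) as [U1 [U2 _]]. rewrite U2, <- Cmod_mult, dominant_neg_explicit; [reflexivity|lra]. }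
  destruct (Ceq_dec A 0) as [EA|nA].
  (* The critical case: |c P + 1| is at most K/|un|, so its product with |un - 1| is at most 2 K,
     whereas it equals |un^(c+1) - 1|. The threshold makes |un|^(c+1) exceed 2 K + 2. *)
  + destruct (Hinf (Rmax 1 (exp (ln (2 * K + 2) / (c + 1))))) as [N1 H1].
    set (n := Nat.max N0 N1). specialize (H1 n ltac:(lia)). specialize (HAn n ltac:(lia)).
    destruct (un_spec n) as [U1 [U2 U3]]. assert (X := inv_n n).
    assert (L1 := Rle_lt_trans _ _ _ (Rmax_l _ _) H1). assert (L2 := Rle_lt_trans _ _ _ (Rmax_r _ _) H1).
    rewrite EA in HAn. replace (RtoC c * P (zn n) + 1 - 0)%C with (RtoC c * P (zn n) + 1)%C in HAn by ring.
    specialize (Hmod n).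
    assert (T := Cmod_minus_ge (Crpower (un n) (c + 1)) 1). rewrite Cmod_1, Cmod_Crpower in T by lra.
    assert (T2 := Cmod_minus_le (un n) 1). rewrite Cmod_1 in T2.
    set (x := Cmod (un n)) in *.
    assert (Lx : ln (2 * K + 2) / (c + 1) < ln x).
    { rewrite <- (ln_exp (ln (2 * K + 2) / (c + 1))). apply ln_increasing; [apply exp_pos|exact L2]. }
    assert (E1 : 2 * K + 2 < exp ((c + 1) * ln x)).
    { rewrite <- (exp_ln (2 * K + 2)) by lra. apply exp_increasing.
      apply Rmult_lt_compat_l with (r := c + 1) in Lx; [|lra].
      replace ((c + 1) * (ln (2 * K + 2) / (c + 1))) with (ln (2 * K + 2)) in Lx by (field; lra). exact Lx. }
    assert (Z : / (INR n + 2) <= / x) by (apply Rinv_le_contravar; lra).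
    assert (W : Cmod (RtoC c * P (zn n) + 1) * Cmod (un n - 1) <= K * / x * (x + 1)).
    { apply Rmult_le_compat; try apply Cmod_ge_0; [|exact T2].
      apply Rle_trans with (1 := HAn). apply Rmult_le_compat_l; lra. }
    assert (V : K * / x * (x + 1) <= 2 * K).
    { replace (K * / x * (x + 1)) with (K + K * / x) by (field; lra).
      assert (/ x <= 1) by (rewrite <- Rinv_1; apply Rinv_le_contravar; lra). nra. }
    lra.
  + assert (PA := proj1 (Cmod_gt_0 _) nA). set (a := Cmod A) in *.
    (* The thresholds give |un|^c <= a/8 and (3 a/8) |un| > 1 + a/2, which contradict (a/2) (|un| -
       1) <= |un|^(c+1) + 1. *)
    destruct (Hinf (Rmax (Rmax 1 (exp (ln (a / 8) / c))) ((1 + a / 2) * (8 / (3 * a))))) as [N1 H1].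
    destruct (INR_archimed 1 (2 * K / a)) as [N2 HN2]; [lra|]. rewrite Rmult_1_r in HN2.
    set (n := Nat.max N0 (Nat.max N1 N2)). specialize (H1 n ltac:(lia)). specialize (HAn n ltac:(lia)).
    assert (N2n : INR N2 <= INR n) by (apply le_INR; lia).
    destruct (un_spec n) as [U1 [U2 U3]]. assert (X := inv_n n).
    assert (L3 := Rle_lt_trans _ _ _ (Rmax_r _ _) H1).
    assert (L12 := Rle_lt_trans _ _ _ (Rmax_l _ _) H1).
    assert (L1 := Rle_lt_trans _ _ _ (Rmax_l _ _) L12). assert (L2 := Rle_lt_trans _ _ _ (Rmax_r _ _) L12).
    specialize (Hmod n).
    assert (T := Cmod_minus_le (Crpower (un n) (c + 1)) 1). rewrite Cmod_1, Cmod_Crpower in T by lra.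
    assert (T2 := Cmod_minus_ge (un n) 1). rewrite Cmod_1 in T2.
    set (x := Cmod (un n)) in *.
    assert (Lx : ln (a / 8) / c < ln x).
    { rewrite <- (ln_exp (ln (a / 8) / c)). apply ln_increasing; [apply exp_pos|exact L2]. }
    assert (Ec : exp (c * ln x) <= a / 8).
    { left. rewrite <- (exp_ln (a / 8)) by lra. apply exp_increasing.
      apply Rmult_lt_gt_compat_neg_l with (r := c) in Lx; [|lra].
      replace (c * (ln (a / 8) / c)) with (ln (a / 8)) in Lx by (field; lra). exact Lx. }
    assert (E1 : exp ((c + 1) * ln x) = exp (c * ln x) * x).
    { rewrite Rmult_plus_distr_r, exp_plus, Rmult_1_l, exp_ln by lra. reflexivity. }
    assert (Ka : K * / (INR n + 2) <= a / 2).
    { apply Rmult_le_reg_r with (INR n + 2); [generalize (pos_INR n); lra|].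
      rewrite Rmult_assoc, Rinv_l, Rmult_1_r by (generalize (pos_INR n); lra).
      apply Rmult_lt_compat_r with (r := a) in HN2; [|exact PA].
      replace (2 * K / a * a) with (2 * K) in HN2 by (field; lra). nra. }
    assert (Hlow : a / 2 <= Cmod (RtoC c * P (zn n) + 1)).
    { assert (T3 := Cmod_minus_ge A (A - (RtoC c * P (zn n) + 1))). fold a in T3.
      replace (A - (A - (RtoC c * P (zn n) + 1)))%C with (RtoC c * P (zn n) + 1)%C in T3 by ring.
      replace (A - (RtoC c * P (zn n) + 1))%C with (- (RtoC c * P (zn n) + 1 - A))%C in T3 by ring.
      rewrite Cmod_opp in T3. lra. }
    assert (W : a / 2 * (x - 1) <= Cmod (RtoC c * P (zn n) + 1) * Cmod (un n - 1)).
    { apply Rmult_le_compat; lra. }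
    assert (L4 : (1 + a / 2) < 3 * a / 8 * x).
    { apply Rmult_lt_compat_l with (r := 3 * a / 8) in L3; [|lra].
      replace (3 * a / 8 * ((1 + a / 2) * (8 / (3 * a)))) with (1 + a / 2) in L3 by (field; lra). exact L3. }
    assert (Z : exp (c * ln x) * x <= a / 8 * x) by (apply Rmult_le_compat_r; lra).
    lra.
Qed.

(** Only the weak inequality survives the passage to the limit; equality is what Jack's lemma and
    [admissible] exclude afterwards. *)
Lemma un_cluster : exists u, / 2 <= Re u /\ P z0 = dominant c u.
Proof.
destruct un_bounded as [B HB].
destruct (choice _ HB) as [phi Hphi].
destruct (cluster_point (fun N => un (phi N)) B) as [u Hu]; [intros N; apply Hphi|].
assert (Hre : / 2 <= Re u).
{ apply le_epsilon. intros e He. destruct (Hu e O He) as [n [_ Hn]].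
  destruct (un_spec (phi n)) as [U1 _].
  assert (X := Rle_trans _ _ _ (Rle_abs _) (re_le_Cmod (un (phi n) - u))).
  unfold Cminus in X. rewrite re_plus, re_opp in X. unfold Cminus in Hn. lra. }
exists u. split; [exact Hre|].
apply Ceq_minus, Cmod_eq_0. apply Rle_antisym; [|apply Cmod_ge_0].
apply le_epsilon. intros e He. rewrite Rplus_0_l.
assert (Cd := Cderiv_continuous _ _ _ (dominant_derive c u ltac:(lra))).
apply continuous_Cmod_iff with (eps := e / 2) in Cd; [|lra].
apply locally_disk in Cd. destruct Cd as [d [Hd HD]].
assert (CP := P_continuous z0 z0_disk).
apply continuous_Cmod_iff with (eps := e / 2) in CP; [|lra].
apply locally_disk in CP. destruct CP as [d' [Hd' HD']].
destruct (zn_near d' Hd') as [N HN].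
destruct (Hu d N Hd) as [n [Hn1 Hn2]].
specialize (HD _ Hn2). specialize (HN (phi n) ltac:(generalize (proj1 (Hphi n)); lia)).
specialize (HD' _ HN). destruct (un_spec (phi n)) as [_ [U2 _]]. rewrite <- U2 in HD.
replace (P z0 - dominant c u)%C with (- (P (zn (phi n)) - P z0) + (P (zn (phi n)) - dominant c u))%C by ring.
eapply Rle_trans; [apply Cmod_triangle|]. rewrite Cmod_opp. lra.
Qed.

Lemma Good_circle : Good z0.
Proof.
destruct un_cluster as [u [Hu E]].
destruct (Rle_lt_or_eq_dec _ _ Hu) as [h|h]; [exists u; split; assumption|]. exfalso.
symmetry in h. assert (Hu0 : 0 < Re u) by lra. assert (Hn := RHP_neq_0 u Hu0).
assert (Hd := dominant'_neq_0 c u c_range Hu0).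
destruct (P_holo z0 z0_disk) as [m [Hm Ef]].
assert (Hom := om_derive z0 u m Hu0 E Hm).
destruct (half_line_circle u h) as [Hc Huu].
assert (Eom : om z0 = (1 - / u)%C) by (unfold om; rewrite (U_value z0 u Hu0 E); reflexivity).
destruct (jack om r z0 _ (proj1 Hr) Hz0 om_schwarz Hom) as [q [Hq Eq]]; [rewrite Eom; exact Hc|].
rewrite Eom in Eq.
(* With om = (u - 1)/u and om' = m / (G'(u) u^2), Jack's relation z om' = q om becomes a formula for
   z P'. *)
assert (Em : (z0 * m = RtoC q * (u * (u - 1)) * dominant' c u)%C).
{ transitivity (z0 * (m / dominant' c u / (u * u)) * (u * u) * dominant' c u)%C; [field; split; assumption|].
  rewrite Eq. field. exact Hn. }
destruct (derivative_is_power alpha f z0 Halpha Hf z0_disk) as [F [HF EF]].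
apply (admissible c ((q - 1) * Cmod u ^ 2) u F c_range h HF).
- apply Rmult_le_pos; [lra|]. apply pow_le, Cmod_ge_0.
- transitivity (C_derive f z0).
  + rewrite Ef, Em, E. rewrite <- (dominant_ode c u Hu0).
    rewrite RtoC_mult, RtoC_minus. 
    replace (RtoC (Cmod u ^ 2)) with (- (u * (u - 1)))%C by (rewrite Huu; ring). ring.
  + rewrite EF. unfold Crpower, Cpower. do 3 f_equal. unfold c. ring.
Qed.

End Circle.

Lemma Good_disk z : disk z -> Good z.
Proof.
apply first_touch; [apply Good_0|apply Good_open|].
intros r Hr HG z0 Hz0. apply (Good_circle r z0 Hr HG Hz0).
Qed.

Lemma subordination : subordinate (div_by_z f) (div_by_z (k_fun alpha)).
Proof.
exists om. split; [|split; [apply om_0|split]].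
- intros z Hz. destruct (om_holo z Hz (Good_disk z Hz)) as [l Hl]. exists l. apply is_derive_Cderiv, Hl.
- intros z Hz. apply om_lt_1, Good_disk, Hz.
- intros z Hz. destruct (Good_U z (Good_disk z Hz)) as [H1 H2].
  rewrite P_div by exact Hz. rewrite dominant_k_fun by (apply om_lt_1, Good_disk, Hz).
  replace (/ (1 - om z))%C with (U z); [exact H2|].
  assert (Hn := RHP_neq_0 (U z) ltac:(lra)). unfold om. field. split; [exact Hn|].
  replace (U z - (U z - 1))%C with (RtoC 1) by ring. exact C1_nz.
Qed.

End Main.

Theorem corollary1p2 (alpha : R) (halpha : 0 <= alpha < 1) (f : C -> C)
  (hf : convex_of_order alpha f) :
  subordinate (div_by_z f) (div_by_z (k_fun alpha)).
Proof.
(* The inverse is chosen point by point, with the default 0 where no preimage exists; its regularity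
   follows later from the injectivity of the dominant. *)
destruct (choice (fun z u => (exists v, 0 < Re v /\ radial_mean (C_derive f) z = dominant (1 - 2 * alpha) v) ->
  0 < Re u /\ radial_mean (C_derive f) z = dominant (1 - 2 * alpha) u)) as [U HU].
- intros z.
  destruct (classic (exists v, 0 < Re v /\ radial_mean (C_derive f) z = dominant (1 - 2 * alpha) v)) as [[v Hv]|n].
  + exists v. intros _. exact Hv.
  + exists (RtoC 0). intros H. contradiction.
- apply (subordination alpha f halpha hf U HU).
Qed.
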